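(* Assume (A1) (see context). Let $K,N\in\mathbb N$, $\Delta x=1/K$, $\Delta t=T/N$, and assume $$\Delta t<\frac{\nu^2\varepsilon^2}{4\kappa^2\delta_0(\delta_0+\frac12)^2}(\Delta x)^2 .$$ Let $\{(\boldsymbol H^{(j)},\boldsymbol\Theta^{(j)})\}_{j=0}^N\subset\mathbb R^{K+3}\times\mathbb R^{K+3}$ be a solution of the scheme (Sch) (see context). Then the following hold. (O)(a) If $0\le H_k^{(0)}\le 1$ and $|\Theta_k^{(0)}|\le\xi_0$ for $k=0,\dots,K$, with a constant $\xi_0>0$ independent of $k$ and $j$, then $$0\le H_k^{(j)}\le 1,\qquad |\Theta_k^{(j)}|\le \xi_0\qquad (k=0,1,\dots,K,\ j=0,1,\dots,N).$$ (O)(b) Define $\mathscr F_{1,\mathrm d}:\mathbb R^{K+3}\times\mathbb R^{K+3}\to\mathbb R$ by $$\mathscr F_{1,\mathrm d}(\boldsymbol H,\boldsymbol\Theta):=\frac{\kappa_0^2}{2}\sum_{k=0}^{K}{}''\frac{|\delta_k^+H_k|^2+|\delta_k^-H_k|^2}{2}\Delta x+\frac c2\sum_{k=0}^{K}{}''|H_k-1|^2\Delta x$$ $$\qquad+\frac{\nu^2}{2}\sum_{k=0}^{K}{}''\frac{|\delta_k^+\Theta_k|^2+|\delta_k^-\Theta_k|^2}{2}\Delta x+\kappa\sum_{k=0}^{K}{}''\alpha(H_k)\frac{\gamma_\varepsilon(\delta_k^+\Theta_k)+\gamma_\varepsilon(\delta_k^-\Theta_k)}{2}\Delta x .$$ Then,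 for $j=0,1,\dots,N-1$, $$\frac{\mathscr F_{1,\mathrm d}(\boldsymbol H^{(j+1)},\boldsymbol\Theta^{(j+1)})-\mathscr F_{1,\mathrm d}(\boldsymbol H^{(j)},\boldsymbol\Theta^{(j)})}{\Delta t}\le-\sum_{k=0}^{K}{}''\left|\frac{H_k^{(j+1)}-H_k^{(j)}}{\Delta t}\right|^2\Delta x-\sum_{k=0}^{K}{}''\alpha_{0,k}^{(j+1)}\left|\frac{\Theta_k^{(j+1)}-\Theta_k^{(j)}}{\Delta t}\right|^2\Delta x\le0 .$$ (I) In addition, let $[\eta,\theta]$ be the solution of the system (S)$_\varepsilon$ (see context) and assume (A2): $\partial_t^l\partial_x^m\eta,\ \partial_t^l\partial_x^m\theta\in C(\overline Q)$ for $0\le l\le1$, $0\le m\le2$, $l+m\le2$. Let the scheme be started from $H_k^{(0)}=\tilde\eta(0,k\Delta x)$, $\Theta_k^{(0)}=\tilde\theta(0,k\Delta x)$ ($k=-1,0,\dots,K+1$), and let $C_1$ be a constant, the same for all meshes under consideration, with $$\max_{0\le j\le N}\ \max_{0\le k\le K}\ \max\{|H_k^{(j)}|,\ |\eta(j\Delta t,k\Delta x)|\}\le C_1 .$$ Put $a:=\max\{2(\kappa C_1/\nu)^2-(2\kappa\varepsilon+c),\ (L_{\alpha_0}+1)/\delta_0\}$. If $\Delta t$ (besides the bound above) satisfies $\Delta t<\frac1{3a}$, then $$\sup_{0\le j\le N}\|\boldsymbol e_\eta^{(j)}\|_{L^2_{\mathrm d}}+\sup_{0\le j\le N}\|\boldsymbol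 e_\theta^{(j)}\|_{L^2_{\mathrm d}}\to0\quad\text{as }\Delta x,\Delta t\to0 .$$
   Context: **Setting.** $0<T<\infty$, $\Omega=(0,1)$, $Q=(0,T)\times\Omega$. **(A1).** $\varepsilon\in(0,1)$, $\delta_0\in(0,1)$, $c>0$, $\kappa_0>0$, $\kappa>0$, $\nu>0$ are fixed constants. $\alpha_0:Q\to\mathbb R$ is Lipschitz continuous with Lipschitz constant $L_{\alpha_0}\ge0$ and $\inf\alpha_0(Q)=\delta_0>0$ (the same $\delta_0$; $\alpha_0$ is extended continuously to $\overline Q$). $\gamma_\varepsilon(\vartheta):=\sqrt{\varepsilon^2+|\vartheta|^2}$, so $\gamma_\varepsilon'(\vartheta)=\vartheta/\sqrt{\varepsilon^2+|\vartheta|^2}$. $\alpha(\eta):=\eta^2/2+\delta_0$, so $\alpha'(\eta)=\eta$. The initial data satisfy $[\eta_0,\theta_0]\in[H^1(\Omega)]^2$ and $0\le\eta_0\le1$ a.e. in $\Omega$. **Solution of (S)$_\varepsilon$.** A pair $[\eta,\theta]\in L^2(0,T;[L^2(\Omega)]^2)$ such that: $[\eta,\theta]\in W^{1,2}(0,T;[L^2(\Omega)]^2)\cap L^\infty(0,T;[H^1(\Omega)]^2)$ and $[\eta(0),\theta(0)]=[\eta_0,\theta_0]$ in $[L^2(\Omega)]^2$; and, for a.e. $t\in(0,T)$, $$\int_\Omega\bigl(\partial_t\eta(t)+c(\eta(t)-1)+\kappa\alpha'(\eta(t))\gamma_\varepsilon(\partial_x\theta(t))\bigr)\varphi\,dx+\kappa_0^2\int_\Omega\partial_x\eta(t)\partial_x\varphi\,dx=0\quad\forall\varphi\in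 H^1(\Omega),$$ $$\int_\Omega\alpha_0(t)\partial_t\theta(t)\psi\,dx+\int_\Omega\bigl(\kappa\alpha(\eta(t))\gamma_\varepsilon'(\partial_x\theta(t))+\nu^2\partial_x\theta(t)\bigr)\partial_x\psi\,dx=0\quad\forall\psi\in H^1(\Omega).$$ **Discrete notation.** For a sequence $\{f_k\}$: $\delta_k^+f_k=\frac{f_{k+1}-f_k}{\Delta x}$, $\delta_k^-f_k=\frac{f_k-f_{k-1}}{\Delta x}$, $\delta_k^{\langle1\rangle}f_k=\frac{f_{k+1}-f_{k-1}}{2\Delta x}$, $\delta_k^{\langle2\rangle}f_k=\frac{f_{k+1}-2f_k+f_{k-1}}{(\Delta x)^2}$; $\sum_{k=0}^K{}''f_k:=\frac12f_0+\sum_{k=1}^{K-1}f_k+\frac12f_K$; $\|\boldsymbol f\|_{L^2_{\mathrm d}}:=(\sum_{k=0}^K{}''|f_k|^2\Delta x)^{1/2}$ (only indices $0,\dots,K$ are used, also for vectors indexed by $-1,\dots,K+1$). $\alpha_{0,k}^{(j)}:=\alpha_0(j\Delta t,k\Delta x)$. **Scheme (Sch).** Vectors $\boldsymbol H^{(j)}=(H_k^{(j)})_{k=-1}^{K+1}$, $\boldsymbol\Theta^{(j)}=(\Theta_k^{(j)})_{k=-1}^{K+1}$, $j=0,\dots,N$, such that for $j=0,\dots,N-1$ and $k=0,\dots,K$ $$\frac{H_k^{(j+1)}-H_k^{(j)}}{\Delta t}=\kappa_0^2\delta_k^{\langle2\rangle}H_k^{(j+1)}-c(H_k^{(j+1)}-1)-\kappa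 H_k^{(j+1)}\frac{\gamma_\varepsilon(\delta_k^+\Theta_k^{(j)})+\gamma_\varepsilon(\delta_k^-\Theta_k^{(j)})}{2},$$ $$\alpha_{0,k}^{(j+1)}\frac{\Theta_k^{(j+1)}-\Theta_k^{(j)}}{\Delta t}=\frac\kappa2\Bigl\{\delta_k^+\bigl(\alpha(H_k^{(j+1)})\gamma_\varepsilon'(\delta_k^-\Theta_k^{(j+1)})\bigr)+\delta_k^-\bigl(\alpha(H_k^{(j+1)})\gamma_\varepsilon'(\delta_k^+\Theta_k^{(j+1)})\bigr)\Bigr\}+\nu^2\delta_k^{\langle2\rangle}\Theta_k^{(j+1)},$$ and, for all $j=0,\dots,N$, $\delta_k^{\langle1\rangle}H_k^{(j)}=0$ and $\delta_k^{\langle1\rangle}\Theta_k^{(j)}=0$ for $k=0,K$ (i.e. $H_{-1}^{(j)}=H_1^{(j)}$, $H_{K+1}^{(j)}=H_{K-1}^{(j)}$, and likewise for $\Theta$). Here $\delta_k^+(\alpha(H_k)\gamma_\varepsilon'(\delta_k^-\Theta_k))=\frac1{\Delta x}\bigl[\alpha(H_{k+1})\gamma_\varepsilon'(\tfrac{\Theta_{k+1}-\Theta_k}{\Delta x})-\alpha(H_k)\gamma_\varepsilon'(\tfrac{\Theta_k-\Theta_{k-1}}{\Delta x})\bigr]$, and similarly for the other term. **Extension and errors (used in (I)).** $\tilde\eta$ is the even reflection extension of $\eta$ to $[0,T]\times[-\Delta x,1+\Delta x]$: $\tilde\eta(t,x)=\eta(t,-x)$ for $-\Delta x\le x<0$,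 $\eta(t,x)$ for $0\le x\le1$, $\eta(t,2-x)$ for $1<x\le1+\Delta x$; $\tilde\theta$ is defined similarly from $\theta$. $e_{\eta,k}^{(j)}:=H_k^{(j)}-\tilde\eta(j\Delta t,k\Delta x)$, $e_{\theta,k}^{(j)}:=\Theta_k^{(j)}-\tilde\theta(j\Delta t,k\Delta x)$ for $k=-1,\dots,K+1$, $j=0,\dots,N$; $\boldsymbol e_\eta^{(j)}=(e_{\eta,k}^{(j)})_{k=-1}^{K+1}$, $\boldsymbol e_\theta^{(j)}=(e_{\theta,k}^{(j)})_{k=-1}^{K+1}$. *)

(* Defs.v *)
From HB Require Import structures.
From mathcomp Require Import all_boot all_order all_algebra.
From mathcomp Require Import all_classical all_reals all_analysis.
Set Implicit Arguments.
Unset Strict Implicit.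
Unset Printing Implicit Defensive.
Import Order.TTheory GRing.Theory Num.Theory.
Import numFieldNormedType.Exports.
Local Open Scope classical_set_scope.
Local Open Scope ring_scope.

Section Domains.
Variable R : realType.

Definition Omega : set R := `]0, 1[.
Definition Omega_bar : set R := `[0, 1].
Definition Qdom (T : R) : set (R * R) := `]0, T[%classic `*` Omega.
Definition Qdom_bar (T : R) : set (R * R) := `[0, T]%classic `*` Omega_bar.

End Domains.

Section Nonlinearities.
Variable R : realType.
Implicit Types eps v h : R.

Definition gamma eps v : R := Num.sqrt (eps ^+ 2 + `|v| ^+ 2).
Definition dgamma eps v : R := v / Num.sqrt (eps ^+ 2 + `|v| ^+ 2).
Definition alpha (delta0 : R) h : R := h ^+ 2 / 2 + delta0.
Definition dalpha h : R := h.

End Nonlinearities.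

(* Elements of L^2, H^1, W^{1,2}(0,T;L^2) and L^oo(0,T;H^1) are given by Borel
   representatives, functions of x : R or of t x : R; only the values on Omega,
   resp. Q, matter. *)
Section FunctionSpaces.
Variable R : realType.
Local Notation mu := (@lebesgue_measure R).

Definition L2 (f : R -> R) : Prop := (f \_ (@Omega R)) \in Lfun mu 2%:E.

Definition L2Q (T : R) (f : R -> R -> R) : Prop :=
  ((fun p : R * R => f p.1 p.2) \_ (Qdom T)) \in Lfun (mu \x mu)%E 2%:E.

(* C^1_c(]a, b[); in one dimension these test functions define the same weak
   derivative as C^oo_c(]a, b[) *)
Definition test_fun (a b : R) (phi : R -> R) : Prop :=
  [/\ forall x, derivable phi x 1, continuous (derive1 phi) &
      exists2 I : R * R, a < I.1 /\ I.2 < b &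
        forall x, x \notin `[I.1, I.2] -> phi x = 0].

Definition weak_deriv (a b : R) (u w : R -> R) : Prop :=
  forall phi, test_fun a b phi ->
    \int[mu]_(x in `]a, b[) (u x * derive1 phi x) =
    - \int[mu]_(x in `]a, b[) (w x * phi x).

(* u belongs to H^1(Omega) and has weak derivative ux *)
Definition H1 (u ux : R -> R) : Prop := [/\ L2 u, L2 ux & weak_deriv 0 1 u ux].

Definition in_H1 (u : R -> R) : Prop := exists ux, H1 u ux.

(* f belongs to W^{1,2}(0,T;L^2(Omega)) and has weak time derivative ft.
   L^2(0,T;L^2(Omega)) is identified with L^2(Q), so that the Bochner integral
   of t |-> f(t) phi'(t) is the class of x |-> \int_0^T f(t,x) phi'(t) dt. *)
Definition W12_L2 (T : R) (f ft : R -> R -> R) : Prop :=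
  [/\ L2Q T f, L2Q T ft &
      forall phi, test_fun 0 T phi ->
        {ae mu, forall x, @Omega R x ->
          \int[mu]_(t in `]0, T[) (f t x * derive1 phi t) =
          - \int[mu]_(t in `]0, T[) (ft t x * phi t)}].

(* f belongs to L^oo(0,T;H^1(Omega)) and has weak space derivative fx *)
Definition Linfty_H1 (T : R) (f fx : R -> R -> R) : Prop :=
  [/\ L2Q T f, L2Q T fx &
      exists M : R, {ae mu, forall t, t \in `]0, T[ ->
        H1 (f t) (fx t) /\
        Num.sqrt (\int[mu]_(x in @Omega R) (f t x ^+ 2)
                  + \int[mu]_(x in @Omega R) (fx t x ^+ 2)) <= M}].

(* f is a representative in C([0,T];L^2(Omega)); it exists and is unique for
   an element of W^{1,2}(0,T;L^2(Omega)), and gives its value at time 0. *)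
Definition time_continuous_L2 (T : R) (f : R -> R -> R) : Prop :=
  (forall t, t \in `[0, T] -> L2 (f t)) /\
  (forall s, s \in `[0, T] ->
    (fun t => \int[mu]_(x in @Omega R) ((f t x - f s x) ^+ 2))
      @ within [set` `[0, T]] (nbhs s) --> (0 : R)).

Definition eq_L2 (f g : R -> R) : Prop := f = g %[ae mu in @Omega R].

End FunctionSpaces.

Section System.
Variable R : realType.
Variables (T eps delta0 c kappa0 kappa nu : R) (alpha0 : R -> R -> R).
Variables (eta0 theta0 : R -> R).
Local Notation mu := (@lebesgue_measure R).

Definition weak_eq_eta (eta eta_t eta_x theta_x : R -> R) : Prop :=
  forall phi phi_x, H1 phi phi_x ->
    \int[mu]_(x in @Omega R)
       ((eta_t x + c * (eta x - 1)
         + kappa * dalpha (eta x) * gamma eps (theta_x x)) * phi x)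
    + kappa0 ^+ 2 * \int[mu]_(x in @Omega R) (eta_x x * phi_x x) = 0.

Definition weak_eq_theta (alpha0_t eta theta_t theta_x : R -> R) : Prop :=
  forall psi psi_x, H1 psi psi_x ->
    \int[mu]_(x in @Omega R) (alpha0_t x * theta_t x * psi x)
    + \int[mu]_(x in @Omega R)
       ((kappa * alpha delta0 (eta x) * dgamma eps (theta_x x)
         + nu ^+ 2 * theta_x x) * psi_x x) = 0.

Definition is_solution (eta theta : R -> R -> R) : Prop :=
  exists eta_t eta_x theta_t theta_x : R -> R -> R,
  [/\ W12_L2 T eta eta_t /\ W12_L2 T theta theta_t,
      Linfty_H1 T eta eta_x /\ Linfty_H1 T theta theta_x,
      time_continuous_L2 T eta /\ time_continuous_L2 T theta,
      eq_L2 (eta 0) eta0 /\ eq_L2 (theta 0) theta0 &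
      {ae mu, forall t, t \in `]0, T[ ->
        weak_eq_eta (eta t) (eta_t t) (eta_x t) (theta_x t) /\
        weak_eq_theta (alpha0 t) (eta t) (theta_t t) (theta_x t)}].

End System.

Section Regularity.
Variable R : realType.

(* d_t^l d_x^m f in C(Q_bar) for l <= 1, m <= 2, l + m <= 2: the derivatives
   exist in Q and g l m is their continuous extension to Q_bar. *)
Definition regular (T : R) (f : R -> R -> R) : Prop :=
  exists2 g : nat -> nat -> R -> R -> R, g 0%N 0%N = f &
  [/\ forall m t x, (m < 2)%N -> Qdom T (t, x) ->
        is_derive x 1 (g 0%N m t) (g 0%N m.+1 t x),
      forall m t x, (m <= 1)%N -> Qdom T (t, x) ->
        is_derive t 1 (fun s => g 0%N m s x) (g 1%N m t x) &
      forall l m, (l <= 1)%N -> (m <= 2)%N -> (l + m <= 2)%N ->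
        {within Qdom_bar T, continuous (fun p : R * R => g l m p.1 p.2)}].

End Regularity.

Section Discrete.
Variable R : realType.
Implicit Types (h : R) (f : int -> R) (k : int).

Definition dx (K : nat) : R := 1 / K%:R.
Definition dt (T : R) (N : nat) : R := T / N%:R.

(* component k = -1, ..., K+1 of a vector of R^(K+3) *)
Definition entry (K : nat) (v : 'rV[R]_K.+3) k : R :=
  v ord0 (inord (absz (k + 1))).

Definition dplus h f k : R := (f (k + 1) - f k) / h.
Definition dminus h f k : R := (f k - f (k - 1)) / h.
Definition dcentral h f k : R := (f (k + 1) - f (k - 1)) / (2 * h).
Definition dsecond h f k : R := (f (k + 1) - 2 * f k + f (k - 1)) / h ^+ 2.

(* the primed sum over k = 0, ..., K, with weight 1/2 on both end points *)
Definition trapsum (K : nat) f : R :=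
  f 0 / 2 + \sum_(1 <= k < K) f k%:Z + f K%:Z / 2.

Definition L2d_norm (K : nat) f : R :=
  Num.sqrt (trapsum K (fun k => `|f k| ^+ 2 * dx K)).

Definition mesh_ok (T eps delta0 kappa nu : R) (K N : nat) : Prop :=
  [/\ (0 < K)%N, (0 < N)%N &
      dt T N < nu ^+ 2 * eps ^+ 2
               / (4 * kappa ^+ 2 * delta0 * (delta0 + 1 / 2) ^+ 2)
               * dx K ^+ 2].

Definition scheme_eq_H (eps c kappa0 kappa : R) h (tau : R)
    (Hold Hnew Thold : int -> R) k : Prop :=
  (Hnew k - Hold k) / tau =
    kappa0 ^+ 2 * dsecond h Hnew k - c * (Hnew k - 1)
    - kappa * Hnew k * ((gamma eps (dplus h Thold k) + gamma eps (dminus h Thold k)) / 2).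

Definition scheme_eq_Theta (eps delta0 kappa nu : R) h (tau alpha0_k : R)
    (Hnew Thold Thnew : int -> R) k : Prop :=
  alpha0_k * ((Thnew k - Thold k) / tau) =
    kappa / 2 *
      (dplus h (fun i => alpha delta0 (Hnew i) * dgamma eps (dminus h Thnew i)) k
       + dminus h (fun i => alpha delta0 (Hnew i) * dgamma eps (dplus h Thnew i)) k)
    + nu ^+ 2 * dsecond h Thnew k.

Definition scheme_solution (T eps delta0 c kappa0 kappa nu : R)
    (alpha0 : R -> R -> R) (K N : nat) (H Th : nat -> 'rV[R]_K.+3) : Prop :=
  (forall j k : nat, (j < N)%N -> (k <= K)%N ->
     scheme_eq_H eps c kappa0 kappa (dx K) (dt T N)
       (entry (H j)) (entry (H j.+1)) (entry (Th j)) k%:Z /\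
     scheme_eq_Theta eps delta0 kappa nu (dx K) (dt T N)
       (alpha0 (j.+1%:R * dt T N) (k%:R * dx K))
       (entry (H j.+1)) (entry (Th j)) (entry (Th j.+1)) k%:Z) /\
  (forall j k : nat, (j <= N)%N -> k = 0%N \/ k = K ->
     dcentral (dx K) (entry (H j)) k%:Z = 0 /\
     dcentral (dx K) (entry (Th j)) k%:Z = 0).

Definition F1d (eps delta0 c kappa0 kappa nu : R) (K : nat)
    (H Th : 'rV[R]_K.+3) : R :=
  let h := dx K in let Hs := entry H in let Ths := entry Th in
  kappa0 ^+ 2 / 2 *
    trapsum K (fun k => (`|dplus h Hs k| ^+ 2 + `|dminus h Hs k| ^+ 2) / 2 * h)
  + c / 2 * trapsum K (fun k => `|Hs k - 1| ^+ 2 * h)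
  + nu ^+ 2 / 2 *
    trapsum K (fun k => (`|dplus h Ths k| ^+ 2 + `|dminus h Ths k| ^+ 2) / 2 * h)
  + kappa *
    trapsum K (fun k => alpha delta0 (Hs k) *
      ((gamma eps (dplus h Ths k) + gamma eps (dminus h Ths k)) / 2) * h).

Definition even_ext (f : R -> R -> R) (t x : R) : R :=
  if x < 0 then f t (- x) else if x <= 1 then f t x else f t (2 - x).

(* f~(j dt, k dx) for k = -1, ..., K+1 *)
Definition grid_val (T : R) (K N : nat) (f : R -> R -> R) (j : nat) k : R :=
  even_ext f (j%:R * dt T N) (k%:~R * dx K).

Definition grid_err (T : R) (K N : nat) (V : nat -> 'rV[R]_K.+3)
    (f : R -> R -> R) (j : nat) k : R :=
  entry (V j) k - grid_val T K N f j k.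

(* sup over j = 0, ..., N; the base point 0 is harmless as norms are >= 0 *)
Definition sup_err (T : R) (K N : nat) (V : nat -> 'rV[R]_K.+3)
    (f : R -> R -> R) : R :=
  \big[Num.max/0]_(j < N.+1) L2d_norm K (grid_err T N V f j).

End Discrete.

(* Main.v *)
Require Import Defs.
From HB Require Import structures.
From mathcomp Require Import all_boot all_order all_algebra.
From mathcomp Require Import all_classical all_reals all_analysis.
From mathcomp Require Import measurable_realfun.
From mathcomp Require Import ring lra.
Set Implicit Arguments.
Unset Strict Implicit.
Unset Printing Implicit Defensive.
Import Order.TTheory GRing.Theory Num.Theory.
Import numFieldNormedType.Exports.
Local Open Scope classical_set_scope.
Local Open Scope ring_scope.

(** The scheme is a finite volume scheme in disguise: every space difference in
    it is a difference of fluxes through the edges (k, k+1) of the mesh, the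
    ghost values make these fluxes odd under reflection at the two ends, and the
    weights 1/2 of the primed sum are exactly those for which summation by parts
    has no boundary term ([trapsum_by_parts]).

    Boundedness.  The flux of Theta has the sign of the difference quotient of
    Theta, so a node of maximum can only lose and a node of minimum can only
    gain; the equation for H has in addition reaction terms that push H into
    [0, 1].  This is [scheme_maximum_principle].

    Energy.  The two equations are tested with the increments of H and Theta.
    The functions alpha and gamma are convex, and because gamma is taken at the
    old time in the first equation and alpha at the new time in the second one,
    the coupling terms add up to the increment of alpha times gamma
    ([energy_step]).

    Convergence is consistency plus stability.  The exact solution is given by
    weak equations for almost every time.  Its weak derivatives agree almost
    everywhere with the classical ones, by the fundamental lemma of the calculus
    of variations and, for the time derivative, the theorem of Tonelli
    ([H1_classical], [time_deriv_ae]).  A weak equation with source A and flux B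
    continuous in space then says that B is a primitive of A that vanishes at
    both ends ([flux_of_weak]).  Stated as a uniform first-order expansion
    ([flux_relation]), this passes to all times by density and continuity.
    Nothing more is needed for consistency: the quotient of a twice
    differentiable function over an edge is its derivative at the midpoint up to
    o(dx), so the numerical fluxes agree with B at the midpoints up to o(dx), and
    their differences divided by dx agree with A up to o(1), at the end nodes as
    well because B vanishes there ([flux_consistency]).

    For stability the error equations are tested with the errors.  The
    monotonicity of the derivative of gamma makes the principal part of the
    second equation dissipative.  The coupling leaves the gradient of the error
    of Theta at the old time in one equation and at the new time in the other,
    each with half of the diffusion coefficient after the Young inequality; the
    energy therefore contains the time step times half of the diffusion
    ([error_energy_step]), and the discrete Gronwall inequality concludes
    ([scheme_convergence]). *)


(** * The nonlinearities gamma and alpha *)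

Section nonlinearities.
Variables (R : realType) (eps : R).
Hypothesis eps0 : 0 < eps.
Implicit Types a b v : R.

Lemma sqr_gamma v : gamma eps v ^+ 2 = eps ^+ 2 + v ^+ 2.
Proof.
rewrite /gamma sqr_sqrtr ?real_normK ?num_real//.
by rewrite addr_ge0 ?sqr_ge0.
Qed.

Lemma gamma_ge_eps v : eps <= gamma eps v.
Proof.
rewrite -[leLHS](ger0_norm (ltW eps0)) -sqrtr_sqr ler_sqrt.
  by rewrite lerDl sqr_ge0.
by rewrite addr_ge0// sqr_ge0.
Qed.

Lemma gamma_gt0 v : 0 < gamma eps v.
Proof. exact: lt_le_trans (gamma_ge_eps v). Qed.

Lemma norm_le_gamma v : `|v| <= gamma eps v.
Proof.
rewrite -(ler_pXn2r (n := 2)) ?nnegrE ?(ltW (gamma_gt0 _))//.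
by rewrite sqr_gamma real_normK ?num_real// lerDr sqr_ge0.
Qed.

Lemma gammaN v : gamma eps (- v) = gamma eps v.
Proof. by rewrite /gamma normrN. Qed.

Lemma dgammaE v : dgamma eps v = v / gamma eps v.
Proof. by []. Qed.

Lemma dgammaN v : dgamma eps (- v) = - dgamma eps v.
Proof. by rewrite !dgammaE gammaN mulNr. Qed.

Lemma dgamma_ge0 v : 0 <= v -> 0 <= dgamma eps v.
Proof. by move=> v0; rewrite dgammaE divr_ge0// ltW// gamma_gt0. Qed.

Lemma dgamma_le0 v : v <= 0 -> dgamma eps v <= 0.
Proof. by move=> v0; rewrite -oppr_ge0 -dgammaN dgamma_ge0// oppr_ge0. Qed.

Lemma norm_dgamma_le1 v : `|dgamma eps v| <= 1.
Proof.
rewrite dgammaE normrM normfV (gtr0_norm (gamma_gt0 v)).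
by rewrite ler_pdivrMr ?gamma_gt0// mul1r norm_le_gamma.
Qed.

(** [gamma ^+ 2] and [v ^+ 2] have the same increments, so that
    [(gamma a - gamma b) * (gamma a + gamma b) = (a - b) * (a + b)], and
    [`|a + b| <= gamma a + gamma b]. *)
Lemma gamma_lipschitz a b : `|gamma eps a - gamma eps b| <= `|a - b|.
Proof.
have A := gamma_gt0 a; have B := gamma_gt0 b.
rewrite -(ler_pM2r (addr_gt0 A B)) -{1}(gtr0_norm (addr_gt0 A B)) -normrM.
rewrite (_ : _ * _ = (a - b) * (a + b)); last first.
  by rewrite -!subr_sqr !sqr_gamma; ring.
rewrite normrM ler_wpM2l// (le_trans (ler_normD _ _))//.
by rewrite lerD// norm_le_gamma.
Qed.

(** This is the Cauchy-Schwarz inequality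
    [eps ^+ 2 + a * b <= gamma a * gamma b] for the vectors (eps, a) and (eps, b). *)
Lemma gamma_convex a b : dgamma eps a * (b - a) <= gamma eps b - gamma eps a.
Proof.
have A := gamma_gt0 a; have B := gamma_gt0 b.
have cs : eps ^+ 2 + a * b <= gamma eps a * gamma eps b.
  rewrite (le_trans (ler_norm _))// -(ler_pXn2r (n := 2)) ?nnegrE//; last first.
    by rewrite mulr_ge0 ?ltW.
  rewrite real_normK ?num_real// exprMn !sqr_gamma -subr_ge0.
  rewrite (_ : _ - _ = (eps * (a - b)) ^+ 2) ?sqr_ge0//; ring.
rewrite dgammaE mulrAC ler_pdivrMr// mulrBl -expr2 sqr_gamma mulrBr -expr2.
by rewrite [gamma eps b * _]mulrC; lra.
Qed.

(** The derivative of a convex function is monotone: add the two tangent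
    inequalities. *)
Lemma dgamma_mono a b : 0 <= (dgamma eps a - dgamma eps b) * (a - b).
Proof. by have := gamma_convex a b; have := gamma_convex b a; lra. Qed.

Lemma dgamma_lipschitz a b : `|dgamma eps a - dgamma eps b| <= 2 / eps * `|a - b|.
Proof.
have A := gamma_gt0 a; have B := gamma_gt0 b.
have -> : dgamma eps a - dgamma eps b =
    ((a - b) + dgamma eps b * (gamma eps b - gamma eps a)) / gamma eps a.
  by rewrite !dgammaE; field; rewrite !gt_eqF.
rewrite normrM normfV (gtr0_norm A) ler_pdivrMr//.
have h : `|a - b + dgamma eps b * (gamma eps b - gamma eps a)| <= 2 * `|a - b|.
  rewrite (le_trans (ler_normD _ _))// mulrDl !mul1r lerD2l normrM.
  rewrite -[leRHS]mul1r ler_pM// ?norm_dgamma_le1//.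
  by rewrite distrC gamma_lipschitz.
apply: le_trans h _.
rewrite (_ : _ * gamma eps a = 2 * `|a - b| * (gamma eps a / eps)); last by ring.
by rewrite ler_peMr ?mulr_ge0// ler_pdivlMr// mul1r gamma_ge_eps.
Qed.

Lemma lipschitz_continuous (f : R -> R) (L : R) : 0 < L ->
  (forall a b, `|f a - f b| <= L * `|a - b|) -> continuous f.
Proof.
move=> L0 H x; apply/cvgrPdist_le => e e0; near=> y.
rewrite (le_trans (H _ _))// -ler_pdivlMl// mulrC.
by near: y; apply: cvgr_dist_le => //; rewrite divr_gt0.
Unshelve. all: by end_near. Qed.

Lemma gamma_continuous : continuous (gamma eps).
Proof.
apply: (@lipschitz_continuous _ 1) => // a b; rewrite mul1r; exact: gamma_lipschitz.
Qed.

Lemma dgamma_continuous : continuous (dgamma eps).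
Proof.
apply: (@lipschitz_continuous _ (2 / eps)); first by rewrite divr_gt0.
exact: dgamma_lipschitz.
Qed.

Lemma alpha_convex delta0 a b : a * (a - b) >= alpha delta0 a - alpha delta0 b.
Proof. by rewrite /alpha; have := sqr_ge0 (a - b); nra. Qed.

End nonlinearities.

(** * The primed sum and reflection at both ends *)

Section trapsum.
Variable R : realType.
Implicit Types (f g Phi : int -> R) (K : nat) (h : R).

(** The weights 1/2 at the ends make the primed sum a sum over the edges
    of the averages of the end values. *)
Lemma trapsum_edges K f : (0 < K)%N ->
  trapsum K f = \sum_(0 <= k < K) (f k%:Z + f k.+1%:Z) / 2.
Proof.
case: K => // K _; rewrite /trapsum; elim: K => [|K IH].
  by rewrite big_geq// big_nat1; field.
by rewrite big_nat_recr//= [RHS]big_nat_recr//= -IH; field.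
Qed.

Lemma eq_trapsum K f g : (forall k, (k <= K)%N -> f k%:Z = g k%:Z) ->
  trapsum K f = trapsum K g.
Proof.
move=> fg; rewrite /trapsum (fg 0%N)// (fg K)//; congr (_ + _ + _).
by apply: eq_big_nat => k /andP[_ kK]; rewrite fg// ltnW.
Qed.

Lemma ler_trapsum K f g : (forall k, (k <= K)%N -> f k%:Z <= g k%:Z) ->
  trapsum K f <= trapsum K g.
Proof.
move=> fg; rewrite /trapsum; apply: lerD; [apply: lerD|].
- by rewrite ler_pM2r// (fg 0%N).
- by apply: ler_sum_nat => k /andP[_ kK]; rewrite fg// ltnW.
- by rewrite ler_pM2r// (fg K).
Qed.

Lemma trapsumD K f g : trapsum K (fun k => f k + g k) = trapsum K f + trapsum K g.
Proof. by rewrite /trapsum big_split/=; field. Qed.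

Lemma trapsumZ K a f : trapsum K (fun k => a * f k) = a * trapsum K f.
Proof. by rewrite /trapsum -mulr_sumr; field. Qed.

Lemma trapsumN K f : trapsum K (fun k => - f k) = - trapsum K f.
Proof. by rewrite /trapsum sumrN; field. Qed.

Lemma trapsumB K f g : trapsum K (fun k => f k - g k) = trapsum K f - trapsum K g.
Proof. by rewrite trapsumD trapsumN. Qed.

Lemma trapsum0 K : trapsum K (fun=> 0) = 0 :> R.
Proof. by rewrite /trapsum big1// !mul0r !addr0. Qed.

Lemma trapsum_ge0 K f : (forall k, (k <= K)%N -> 0 <= f k%:Z) -> 0 <= trapsum K f.
Proof. by move=> f0; rewrite -(trapsum0 K); exact: ler_trapsum. Qed.

Lemma intS_sub1 k : k.+1%:Z - 1 = k%:Z. Proof. by rewrite intS addrC addKr. Qed.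
Lemma int_add1 k : k%:Z + 1 = k.+1%:Z. Proof. by rewrite intS addrC. Qed.

(** Source of both summation formulas below: the two ghost edges are
    replaced by the first and the last edge, which doubles the end terms, and
    the weights 1/2 undo this.  Each edge is then met once from either end. *)
Lemma trapsum_stencil K (Phi Psi g : int -> R) : (0 < K)%N ->
  Psi (-1) = Phi 0 -> Phi K%:Z = Psi (K%:Z - 1) ->
  trapsum K (fun k => (Phi k + Psi (k - 1)) * g k) =
  \sum_(0 <= k < K) (Phi k%:Z * g k%:Z + Psi k%:Z * g (k%:Z + 1)).
Proof.
case: K => // K _ P0 PK; rewrite /trapsum.
have -> : (Phi 0 + Psi (0 - 1)) * g 0 / 2 = Phi 0 * g 0.
  by rewrite sub0r P0; field.
have -> : (Phi K.+1%:Z + Psi (K.+1%:Z - 1)) * g K.+1%:Z / 2 = Psi K%:Z * g K.+1%:Z.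
  by rewrite PK intS_sub1; field.
elim: K {PK} => [|K IH]; first by rewrite big_geq// big_nat1 addr0.
rewrite big_nat_recr//= [RHS]big_nat_recr//= -IH intS_sub1 !int_add1; ring.
Qed.

(** No boundary term is left: a flux that is odd under reflection vanishes
    at the ends in the discrete sense. *)
Lemma trapsum_by_parts K Phi g : (0 < K)%N ->
  Phi (-1) = - Phi 0 -> Phi K%:Z = - Phi (K%:Z - 1) ->
  trapsum K (fun k => (Phi k - Phi (k - 1)) * g k) =
  - \sum_(0 <= k < K) Phi k%:Z * (g (k%:Z + 1) - g k%:Z).
Proof.
move=> K0 P0 PK.
rewrite (@trapsum_stencil K Phi (fun k => - Phi k))//; last by rewrite P0 opprK.
by rewrite -sumrN; apply: eq_bigr => k _; ring.
Qed.

Lemma trapsum_average K Phi g : (0 < K)%N ->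
  Phi (-1) = Phi 0 -> Phi K%:Z = Phi (K%:Z - 1) ->
  trapsum K (fun k => (Phi k + Phi (k - 1)) / 2 * g k) =
  \sum_(0 <= k < K) Phi k%:Z * ((g k%:Z + g (k%:Z + 1)) / 2).
Proof.
move=> K0 P0 PK; rewrite -[RHS]/(\sum_(0 <= k < K) _).
transitivity (trapsum K (fun k => (Phi k + Phi (k - 1)) * (g k / 2))).
  by apply: eq_trapsum => k _; field.
by rewrite trapsum_stencil//; apply: eq_bigr => k _; field.
Qed.

(** The two ghost values, at the indices -1 and K+1, reflect the inner ones;
    this is the discrete Neumann condition. *)
Definition even_ends K f := f (-1) = f 1 /\ f (K%:Z + 1) = f (K%:Z - 1).

Lemma dcentral_even_ends K h f : h != 0 ->
  dcentral h f 0 = 0 -> dcentral h f K%:Z = 0 -> even_ends K f.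
Proof.
move=> h0; rewrite /dcentral sub0r add0r => /eqP + /eqP.
have h2 : (2 * h)^-1 != 0 by rewrite invr_eq0 mulf_neq0.
rewrite !mulf_eq0 (negPf h2) !orbF !subr_eq0 => /eqP e0 /eqP e1.
by split.
Qed.

Lemma dminusE h f (k : int) : dminus h f k = dplus h f (k - 1).
Proof. by rewrite /dplus /dminus subrK. Qed.

Lemma dsecondE h f (k : int) : h != 0 ->
  dsecond h f k = (dplus h f k - dplus h f (k - 1)) / h.
Proof. by move=> h0; rewrite /dsecond /dplus subrK; field. Qed.

Lemma dplus_even_ends K h f : even_ends K f ->
  dplus h f (-1) = - dplus h f 0 /\ dplus h f K%:Z = - dplus h f (K%:Z - 1).
Proof.
move=> [f0 fK]; rewrite /dplus addNr f0 add0r fK subrK.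
by split; rewrite -mulNr opprB.
Qed.

(** The ghost values are values at inner nodes, so no argument about
    neighbours has to treat the ends separately. *)
Lemma even_ends_neighbour K f (P : R -> Prop) : (0 < K)%N -> even_ends K f ->
  (forall k, (k <= K)%N -> P (f k%:Z)) ->
  forall k, (k <= K)%N -> P (f (k%:Z + 1)) /\ P (f (k%:Z - 1)).
Proof.
move=> K0 [f0 fK] Pf k kK; split.
  move: kK; rewrite leq_eqVlt => /orP[/eqP->|kK]; last by rewrite int_add1; exact: Pf.
  by rewrite fK; case: K K0 {fK} Pf => // K _ Pf; rewrite intS_sub1; exact: Pf.
case: k kK => [_|k kK]; last by rewrite intS_sub1; apply: Pf; exact: ltnW.
by rewrite sub0r f0; exact: (Pf 1%N).
Qed.

End trapsum.

(** * One time step: maximum principle and energy *)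

Section one_step.
Variables (R : realType) (eps delta0 c kappa0 kappa nu h tau : R) (K : nat).
Hypotheses (eps0 : 0 < eps) (delta0_gt0 : 0 < delta0) (c0 : 0 < c).
Hypotheses (kappa0_gt0 : 0 < kappa0) (kappa_gt0 : 0 < kappa) (nu0 : 0 < nu).
Hypotheses (h0 : 0 < h) (tau0 : 0 < tau) (K0 : (0 < K)%N).
Implicit Types (H Th f : int -> R).

Lemma alpha_gt0 x : 0 < alpha delta0 x.
Proof. by rewrite /alpha ltr_wpDl// mulr_ge0// sqr_ge0. Qed.

(** The two one-sided products in the scheme for Theta add up to one flux
    through the edge (k, k+1), with the coefficient alpha averaged over its ends. *)
Definition theta_flux H Th (k : int) : R :=
  kappa * ((alpha delta0 (H k) + alpha delta0 (H (k + 1))) / 2)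
    * dgamma eps (dplus h Th k) + nu ^+ 2 * dplus h Th k.

Definition gamma_avg Th (k : int) : R :=
  (gamma eps (dplus h Th k) + gamma eps (dplus h Th (k - 1))) / 2.

Lemma scheme_eq_HE Hold Hnew Thold (k : int) :
  scheme_eq_H eps c kappa0 kappa h tau Hold Hnew Thold k <->
  (Hnew k - Hold k) / tau =
    kappa0 ^+ 2 * ((dplus h Hnew k - dplus h Hnew (k - 1)) / h)
    - c * (Hnew k - 1) - kappa * Hnew k * gamma_avg Thold k.
Proof. by rewrite /scheme_eq_H dsecondE ?gt_eqF// dminusE. Qed.

Lemma scheme_eq_ThetaE a Hnew Thold Thnew (k : int) :
  scheme_eq_Theta eps delta0 kappa nu h tau a Hnew Thold Thnew k <->
  a * ((Thnew k - Thold k) / tau) =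
    (theta_flux Hnew Thnew k - theta_flux Hnew Thnew (k - 1)) / h.
Proof.
have e1 : dplus h (fun i => alpha delta0 (Hnew i) * dgamma eps (dminus h Thnew i)) k =
    (alpha delta0 (Hnew (k + 1)) * dgamma eps (dplus h Thnew k)
     - alpha delta0 (Hnew k) * dgamma eps (dplus h Thnew (k - 1))) / h.
  by rewrite {1}/dplus !dminusE addrK.
have e2 : dminus h (fun i => alpha delta0 (Hnew i) * dgamma eps (dplus h Thnew i)) k =
    (alpha delta0 (Hnew k) * dgamma eps (dplus h Thnew k)
     - alpha delta0 (Hnew (k - 1)) * dgamma eps (dplus h Thnew (k - 1))) / h.
  by [].
rewrite /scheme_eq_Theta e1 e2 dsecondE ?gt_eqF// /theta_flux subrK.
set x := kappa / 2 * _ + _; set y := _ / h.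
suff -> : x = y by [].
by rewrite /x /y; field; rewrite gt_eqF.
Qed.

Lemma exists_argmax f : exists2 m, (m <= K)%N & forall k, (k <= K)%N -> f k%:Z <= f m%:Z.
Proof.
elim: K => [|n [m mn fm]]; first by exists 0%N => // k; rewrite leqn0 => /eqP->.
have [le|lt] := leP (f n.+1%:Z) (f m%:Z).
  exists m => [|k]; first exact: leqW.
  by rewrite leq_eqVlt => /orP[/eqP->//|]; rewrite ltnS; exact: fm.
exists n.+1 => // k; rewrite leq_eqVlt => /orP[/eqP->//|]; rewrite ltnS => kn.
exact: le_trans (fm _ kn) (ltW lt).
Qed.

(** The reflected ghost values are covered too, so a maximum at an end node
    needs no separate treatment. *)
Lemma dplus_argmax f m : even_ends K f -> (m <= K)%N ->
  (forall k, (k <= K)%N -> f k%:Z <= f m%:Z) ->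
  dplus h f m%:Z <= 0 /\ 0 <= dplus h f (m%:Z - 1).
Proof.
move=> ef mK fm.
have [f1 f2] := even_ends_neighbour (P := fun y => y <= f m%:Z) K0 ef fm mK.
rewrite /dplus subrK; split; last by rewrite divr_ge0 ?subr_ge0// ltW.
by rewrite mulr_le0_ge0 ?subr_le0 ?invr_ge0// ltW.
Qed.

Lemma even_endsN f : even_ends K f -> even_ends K (fun k => - f k).
Proof. by move=> [f0 fK]; split; rewrite ?f0 ?fK. Qed.

Lemma dplusN f (k : int) : dplus h (fun k => - f k) k = - dplus h f k.
Proof. by rewrite /dplus -mulNr opprB opprK addrC. Qed.

Lemma gamma_avg_gt0 Th (k : int) : 0 < gamma_avg Th k.
Proof. by rewrite divr_gt0// addr_gt0// gamma_gt0. Qed.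

Section maximum_principle.
Variables (a Hold Hnew Thold Thnew : int -> R).
Hypotheses (eHn : even_ends K Hnew) (eTn : even_ends K Thnew).
Hypothesis a_gt0 : forall k, (k <= K)%N -> 0 < a k%:Z.
Hypothesis eqH : forall k, (k <= K)%N ->
  scheme_eq_H eps c kappa0 kappa h tau Hold Hnew Thold k%:Z.
Hypothesis eqTheta : forall k, (k <= K)%N ->
  scheme_eq_Theta eps delta0 kappa nu h tau (a k%:Z) Hnew Thold Thnew k%:Z.

(** At a node of minimum the diffusion is nonnegative, and if the minimum
    were negative then so would be the increment, while the reaction terms are
    positive. *)
Lemma H_nonneg : (forall k, (k <= K)%N -> 0 <= Hold k%:Z) ->
  forall k, (k <= K)%N -> 0 <= Hnew k%:Z.
Proof.
move=> Ho0 k kK; have [m mK Hm] := exists_argmax (fun k => - Hnew k).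
rewrite (@le_trans _ _ (Hnew m%:Z))//; last by rewrite -lerN2; exact: Hm.
have [d1 d2] := dplus_argmax (even_endsN eHn) mK Hm.
rewrite !dplusN oppr_le0 oppr_ge0 in d1 d2.
rewrite leNgt; apply/negP => neg.
have /scheme_eq_HE := eqH mK; have := Ho0 _ mK; have := gamma_avg_gt0 Thold m%:Z.
set G := gamma_avg _ _; set d := _ / h => G0 Hm0 E.
have d_ge0 : 0 <= d by rewrite divr_ge0 ?(ltW h0)// subr_ge0 (le_trans d2).
have L : (Hnew m%:Z - Hold m%:Z) / tau < 0.
  by rewrite pmulr_llt0 ?invr_gt0// subr_lt0 (lt_le_trans neg).
have t1 : 0 <= kappa0 ^+ 2 * d by rewrite mulr_ge0// sqr_ge0.
have t2 : c * (Hnew m%:Z - 1) < 0 by rewrite pmulr_rlt0// subr_lt0 (lt_trans neg).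
have t3 : kappa * Hnew m%:Z * G < 0 by rewrite pmulr_llt0// pmulr_rlt0.
lra.
Qed.

(** Same argument as for the lower bound at a node of maximum: above 1 both
    reaction terms pull H down. *)
Lemma H_le1 : (forall k, (k <= K)%N -> Hold k%:Z <= 1) ->
  forall k, (k <= K)%N -> Hnew k%:Z <= 1.
Proof.
move=> Ho1 k kK; have [m mK Hm] := exists_argmax Hnew.
rewrite (le_trans (Hm _ kK))//.
have [d1 d2] := dplus_argmax eHn mK Hm.
rewrite leNgt; apply/negP => big.
have /scheme_eq_HE := eqH mK; have := Ho1 _ mK; have := gamma_avg_gt0 Thold m%:Z.
set G := gamma_avg _ _; set d := _ / h => G0 Hm0 E.
have d_le0 : d <= 0.
  by rewrite mulr_le0_ge0 ?invr_ge0 ?(ltW h0)// subr_le0 (le_trans d1).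
have L : 0 < (Hnew m%:Z - Hold m%:Z) / tau by rewrite divr_gt0// subr_gt0; lra.
have t1 : kappa0 ^+ 2 * d <= 0 by rewrite mulr_ge0_le0// sqr_ge0.
have t2 : 0 < c * (Hnew m%:Z - 1) by rewrite mulr_gt0// subr_gt0.
have t3 : 0 < kappa * Hnew m%:Z * G.
  have Hm1 : 0 < Hnew m%:Z by lra.
  by apply: mulr_gt0 => //; exact: mulr_gt0.
lra.
Qed.

(** [dgamma] is odd and increasing and its coefficient is positive. *)
Lemma theta_flux_sign H Th (k : int) :
  (0 <= dplus h Th k -> 0 <= theta_flux H Th k) /\
  (dplus h Th k <= 0 -> theta_flux H Th k <= 0).
Proof.
have A : 0 <= kappa * ((alpha delta0 (H k) + alpha delta0 (H (k + 1))) / 2).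
  by rewrite mulr_ge0 ?(ltW kappa_gt0)// divr_ge0// addr_ge0// ltW// alpha_gt0.
have N : 0 <= nu ^+ 2 by exact: sqr_ge0.
rewrite /theta_flux; split => d.
  by rewrite addr_ge0// mulr_ge0// dgamma_ge0.
by rewrite -[leRHS]addr0 lerD// mulr_ge0_le0// dgamma_le0.
Qed.

(** At a node of maximum the flux to the right is nonpositive and the flux
    from the left nonnegative, so their difference cannot increase Theta. *)
Lemma Theta_le xi : (forall k, (k <= K)%N -> Thold k%:Z <= xi) ->
  forall k, (k <= K)%N -> Thnew k%:Z <= xi.
Proof.
move=> To k kK; have [m mK Hm] := exists_argmax Thnew.
rewrite (le_trans (Hm _ kK))//.
have [d1 d2] := dplus_argmax eTn mK Hm.
rewrite leNgt; apply/negP => big.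
have /scheme_eq_ThetaE E := eqTheta mK.
have L : 0 < a m%:Z * ((Thnew m%:Z - Thold m%:Z) / tau).
  rewrite mulr_gt0 ?a_gt0// divr_gt0// subr_gt0.
  exact: le_lt_trans (To _ mK) big.
have F1 := (theta_flux_sign Hnew Thnew m%:Z).2 d1.
have F2 := (theta_flux_sign Hnew Thnew (m%:Z - 1)).1 d2.
move: L; rewrite E ltNge mulr_le0_ge0 ?invr_ge0 ?(ltW h0)//.
by rewrite subr_le0 (le_trans F1).
Qed.

Lemma Theta_ge xi : (forall k, (k <= K)%N -> xi <= Thold k%:Z) ->
  forall k, (k <= K)%N -> xi <= Thnew k%:Z.
Proof.
move=> To k kK; have [m mK Hm] := exists_argmax (fun k => - Thnew k).
rewrite (@le_trans _ _ (Thnew m%:Z))//; last by rewrite -lerN2; exact: Hm.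
have [d1 d2] := dplus_argmax (even_endsN eTn) mK Hm.
rewrite !dplusN oppr_le0 oppr_ge0 in d1 d2.
rewrite leNgt; apply/negP => neg.
have /scheme_eq_ThetaE E := eqTheta mK.
have L : a m%:Z * ((Thnew m%:Z - Thold m%:Z) / tau) < 0.
  rewrite pmulr_rlt0 ?a_gt0// pmulr_llt0 ?invr_gt0// subr_lt0.
  exact: lt_le_trans neg (To _ mK).
have F1 := (theta_flux_sign Hnew Thnew m%:Z).1 d1.
have F2 := (theta_flux_sign Hnew Thnew (m%:Z - 1)).2 d2.
move: L; rewrite E ltNge divr_ge0 ?(ltW h0)//.
by rewrite subr_ge0 (le_trans F2).
Qed.

End maximum_principle.

Section energy.
Variables (a Hold Hnew Thold Thnew : int -> R).
Hypotheses (eHo : even_ends K Hold) (eHn : even_ends K Hnew).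
Hypotheses (eTo : even_ends K Thold) (eTn : even_ends K Thnew).
Hypothesis eqH : forall k, (k <= K)%N ->
  scheme_eq_H eps c kappa0 kappa h tau Hold Hnew Thold k%:Z.
Hypothesis eqTheta : forall k, (k <= K)%N ->
  scheme_eq_Theta eps delta0 kappa nu h tau (a k%:Z) Hnew Thold Thnew k%:Z.

Let dH k := Hnew k - Hold k.
Let dT k := Thnew k - Thold k.

(** The Dirichlet parts of the free energy are written over the edges, the
    form in which summation by parts produces them. *)
Definition edge_energy H Th : R :=
  kappa0 ^+ 2 / 2 * (\sum_(0 <= k < K) dplus h H k%:Z ^+ 2 * h)
  + c / 2 * trapsum K (fun k => (H k - 1) ^+ 2 * h)
  + nu ^+ 2 / 2 * (\sum_(0 <= k < K) dplus h Th k%:Z ^+ 2 * h)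
  + kappa * trapsum K (fun k => alpha delta0 (H k) * gamma_avg Th k * h).

Lemma trapsum_dirichlet f : even_ends K f ->
  trapsum K (fun k => (`|dplus h f k| ^+ 2 + `|dminus h f k| ^+ 2) / 2 * h) =
  \sum_(0 <= k < K) dplus h f k%:Z ^+ 2 * h.
Proof.
move=> ef; have [d0 dK] := dplus_even_ends h ef.
under eq_fun do rewrite dminusE !real_normK ?num_real//.
rewrite (@trapsum_average _ K (fun k => dplus h f k ^+ 2) (fun=> h))//.
- by apply: eq_bigr => k _; congr (_ * _); field.
- by rewrite d0 sqrrN.
- by rewrite dK sqrrN.
Qed.

Lemma trapsum_gamma_avg Th (w : int -> R) : even_ends K Th ->
  trapsum K (fun k => gamma_avg Th k * w k) =
  \sum_(0 <= k < K) gamma eps (dplus h Th k%:Z) * ((w k%:Z + w (k%:Z + 1)) / 2).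
Proof.
move=> eT; have [d0 dK] := dplus_even_ends h eT.
rewrite -(@trapsum_average _ K (fun k => gamma eps (dplus h Th k)))//.
- by rewrite d0 gammaN.
- by rewrite dK gammaN.
Qed.

Lemma theta_flux_even_ends H Th : even_ends K H -> even_ends K Th ->
  theta_flux H Th (-1) = - theta_flux H Th 0 /\
  theta_flux H Th K%:Z = - theta_flux H Th (K%:Z - 1).
Proof.
move=> [H0 HK] eT; have [d0 dK] := dplus_even_ends h eT.
rewrite /theta_flux d0 dK !dgammaN addNr H0 add0r HK subrK.
by split; ring.
Qed.

Lemma dplus_sub f g (k : int) :
  (dplus h f k - dplus h g k) * h = (f (k + 1) - g (k + 1)) - (f k - g k).
Proof. by rewrite /dplus; field; rewrite gt_eqF. Qed.

(** The equations are tested with the increments.  Convexity turns every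
    product of a derivative with an increment into a difference of energies.  In
    the coupling term the equation for H sees gamma at the old time and the flux
    of Theta sees alpha at the new time, so the two differences telescope:
    [al new * (gamma new - gamma old) + (al new - al old) * gamma old]. *)
Lemma energy_step :
  edge_energy Hnew Thnew - edge_energy Hold Thold <=
  - trapsum K (fun k => dH k / tau * dH k * h)
  - trapsum K (fun k => a k * (dT k / tau) * dT k * h).
Proof.
pose Dn := dplus h Hnew; pose Do := dplus h Hold.
pose Tn := dplus h Thnew; pose To := dplus h Thold.
pose al k := alpha delta0 (Hnew k).
have hn : h != 0 by rewrite gt_eqF.
have [Dn0 DnK] := dplus_even_ends h eHn.
have [Ph0 PhK] := theta_flux_even_ends eHn eTn.
have SH : trapsum K (fun k => dH k / tau * dH k * h) =
   - kappa0 ^+ 2 * (\sum_(0 <= k < K) Dn k%:Z * (dH (k%:Z + 1) - dH k%:Z))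
   - c * trapsum K (fun k => (Hnew k - 1) * dH k * h)
   - kappa * trapsum K (fun k => Hnew k * gamma_avg Thold k * dH k * h).
  rewrite mulNr -mulrN -(trapsum_by_parts dH K0 Dn0 DnK) -!trapsumZ -!trapsumB.
  apply: eq_trapsum => k kK; have /scheme_eq_HE := eqH kK.
  rewrite -/(dH k%:Z) => ->; rewrite -/Dn.
  by field.
have ST : trapsum K (fun k => a k * (dT k / tau) * dT k * h) =
   - (\sum_(0 <= k < K) theta_flux Hnew Thnew k%:Z * (dT (k%:Z + 1) - dT k%:Z)).
  rewrite -(trapsum_by_parts dT K0 Ph0 PhK).
  apply: eq_trapsum => k kK; have /scheme_eq_ThetaE := eqTheta kK.
  rewrite -/(dT k%:Z) => ->.
  by field.
have I1 : (\sum_(0 <= k < K) Dn k%:Z ^+ 2 * h) - (\sum_(0 <= k < K) Do k%:Z ^+ 2 * h)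
    <= 2 * (\sum_(0 <= k < K) Dn k%:Z * (dH (k%:Z + 1) - dH k%:Z)).
  rewrite -sumrB mulr_sumr; apply: ler_sum => k _.
  rewrite -dplus_sub -/Dn -/Do.
  by have := mulr_ge0 (sqr_ge0 (Dn k%:Z - Do k%:Z)) (ltW h0); lra.
have I2 : trapsum K (fun k => (Hnew k - 1) ^+ 2 * h) -
    trapsum K (fun k => (Hold k - 1) ^+ 2 * h) <=
    2 * trapsum K (fun k => (Hnew k - 1) * dH k * h).
  rewrite -trapsumB -trapsumZ; apply: ler_trapsum => k _.
  rewrite /dH.
  by have := mulr_ge0 (sqr_ge0 (Hnew k%:Z - Hold k%:Z)) (ltW h0); lra.
have I3 : nu ^+ 2 / 2 * ((\sum_(0 <= k < K) Tn k%:Z ^+ 2 * h)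
      - (\sum_(0 <= k < K) To k%:Z ^+ 2 * h))
    + kappa * (trapsum K (fun k => al k * gamma_avg Thnew k * h)
      - trapsum K (fun k => al k * gamma_avg Thold k * h))
    <= \sum_(0 <= k < K) theta_flux Hnew Thnew k%:Z * (dT (k%:Z + 1) - dT k%:Z).
  have tg Th : even_ends K Th -> trapsum K (fun k => al k * gamma_avg Th k * h) =
     \sum_(0 <= k < K) gamma eps (dplus h Th k%:Z) * ((al k%:Z * h + al (k%:Z + 1) * h) / 2).
    move=> eT; rewrite -(trapsum_gamma_avg (fun k => al k * h))//.
    by apply: eq_trapsum => k _; ring.
  rewrite !tg// -!sumrB !mulr_sumr -big_split; apply: ler_sum => k _ /=.
  rewrite -dplus_sub -/Tn -/To /theta_flux -/Tn.
  pose A := al k%:Z + al (k%:Z + 1).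
  have A0 : 0 < A by rewrite addr_gt0// alpha_gt0.
  have cv := gamma_convex eps0 (Tn k%:Z) (To k%:Z).
  have kA : 0 <= kappa * (A / 2) * h.
    by rewrite !mulr_ge0// ?invr_ge0// ltW.
  have cv' : kappa * (A / 2) * h * (gamma eps (Tn k%:Z) - gamma eps (To k%:Z)) <=
      kappa * (A / 2) * h * (dgamma eps (Tn k%:Z) * (Tn k%:Z - To k%:Z)).
    by rewrite ler_wpM2l//; lra.
  have q : nu ^+ 2 / 2 * (Tn k%:Z ^+ 2 * h - To k%:Z ^+ 2 * h) <=
      nu ^+ 2 * Tn k%:Z * ((Tn k%:Z - To k%:Z) * h).
    have -> : nu ^+ 2 * Tn k%:Z * ((Tn k%:Z - To k%:Z) * h) =
      nu ^+ 2 / 2 * (2 * Tn k%:Z * ((Tn k%:Z - To k%:Z) * h)) by field.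
    rewrite ler_wpM2l ?divr_ge0 ?sqr_ge0//.
    by have := mulr_ge0 (sqr_ge0 (Tn k%:Z - To k%:Z)) (ltW h0); lra.
  rewrite [X in _ <= X](_ : _ =
     kappa * (A / 2) * h * (dgamma eps (Tn k%:Z) * (Tn k%:Z - To k%:Z)) +
     nu ^+ 2 * Tn k%:Z * ((Tn k%:Z - To k%:Z) * h)); last by rewrite /A /al; field.
  rewrite addrC lerD// (le_trans _ cv')// le_eqVlt; apply/orP; left; apply/eqP.
  by rewrite /A /al; field.
have I4 : trapsum K (fun k => al k * gamma_avg Thold k * h)
    - trapsum K (fun k => alpha delta0 (Hold k) * gamma_avg Thold k * h) <=
    trapsum K (fun k => Hnew k * gamma_avg Thold k * dH k * h).
  rewrite -trapsumB; apply: ler_trapsum => k _.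
  have G := gamma_avg_gt0 Thold k%:Z.
  have Gh : 0 <= gamma_avg Thold k%:Z * h by rewrite mulr_ge0// ltW.
  have := ler_wpM2r Gh (alpha_convex delta0 (Hnew k%:Z) (Hold k%:Z)).
  rewrite /al /dH; lra.
rewrite SH ST /edge_energy -/Dn -/Do -/Tn -/To -/al.
have J1 := ler_wpM2l (sqr_ge0 kappa0) I1.
have J2 := ler_wpM2l (ltW c0) I2.
have J4 := ler_wpM2l (ltW kappa_gt0) I4.
rewrite /al in I3 J4.
lra.
Qed.

End energy.
End one_step.

(** * Lebesgue integrals of continuous functions on an interval *)

Section L2facts.
Context d (T : measurableType d) (R : realType).
Variable mu : {measure set T -> \bar R}.
Local Open Scope ereal_scope.

Lemma Lfun2_of_sqr (g : T -> R) : measurable_fun setT g ->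
  mu.-integrable setT (EFin \o (fun x => g x ^+ 2)%R) -> g \in Lfun mu 2%:E.
Proof.
move=> mg ig; rewrite inE/=; apply/andP; split; rewrite inE//=.
rewrite /finite_norm unlock poweR_lty//.
under eq_integral do rewrite /= powR_mulrn// -normrX ger0_norm ?sqr_ge0//.
exact: integrable_lty.
Qed.

(** On a set of finite measure [`|f| <= 1 + f ^+ 2]. *)
Lemma Lfun2_integrable (D : set T) (f : T -> R) : measurable D ->
  mu D < +oo -> f \_ D \in Lfun mu 2%:E -> mu.-integrable D (EFin \o f).
Proof.
move=> mD Dfin f2.
have mf : measurable_fun setT (f \_ D).
  by move: f2; rewrite inE => /andP[]; rewrite inE.
have i2 := integrableS measurableT mD (@subsetT _ D) (Lfun2_integrable_sqr f2).
have ic : mu.-integrable D (EFin \o cst 1%R).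
  apply: measurable_bounded_integrable => //.
  exact: bounded_cst.
have i := integrableD mD ic i2.
apply: (eq_integrable mD (EFin \o (f \_ D))).
  by move=> x xD; rewrite /= patchE xD.
apply: le_integrable i => //.
  apply/measurable_EFinP; exact: measurable_funS mf.
move=> x Dx; rewrite /= lee_fin [X in (_ <= X)%R]ger0_norm; last first.
  by rewrite addr_ge0 ?sqr_ge0.
rewrite -[X in (_ <= _ + X)%R](@real_normK _ (f \_ D x)) ?num_real//.
set y := `|_|%R; nra.
Qed.

End L2facts.

Section intervals.
Variable R : realType.
Notation mu := (@lebesgue_measure R).
Implicit Types (a b : R) (f F : R -> R).

Lemma Rintegral_oo_cc a b f : a < b -> mu.-integrable `[a, b] (EFin \o f) ->
  \int[mu]_(x in `]a, b[) f x = \int[mu]_(x in `[a, b]) f x.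
Proof.
move=> ab fi; rewrite Rintegral_itv_bndo_bndc; last first.
  by apply: integrableS fi => //; exact: subset_itv_oo_cc.
rewrite Rintegral_itv_obnd_cbnd//.
by apply: integrableS fi => //; exact: subset_itv_oc_cc.
Qed.

Lemma cont_integrable_cc a b f : {within `[a, b], continuous f} ->
  mu.-integrable `[a, b] (EFin \o f).
Proof.
by move=> cf; apply: continuous_compact_integrable => //; exact: segment_compact.
Qed.

Lemma cont_integrable_oo a b f : {within `[a, b], continuous f} ->
  mu.-integrable `]a, b[ (EFin \o f).
Proof.
by move=> /cont_integrable_cc; apply: integrableS => //; exact: subset_itv_oo_cc.
Qed.

Lemma cont_measurable_oo a b f : {within `[a, b], continuous f} ->
  measurable_fun `]a, b[ f.
Proof. by move=> /cont_integrable_oo /measurable_int /measurable_EFinP. Qed.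

Lemma cont_L2 f : {within `[0, 1], continuous f} -> L2 f.
Proof.
move=> cf; apply: Lfun2_of_sqr.
  by apply/measurable_restrict; [exact: measurable_itv|
    exact: measurableT|rewrite setTI; exact: cont_measurable_oo].
have cf2 : {within `[0, 1], continuous (fun x => f x * f x)}.
  by move=> x; apply: continuousM; exact: cf.
have i := cont_integrable_oo cf2.
rewrite integrable_mkcond// in i.
apply: (eq_integrable measurableT) i => // x _.
by rewrite /= !patchE /Omega /=; case: (x \in _); rewrite /= ?expr2 ?mulr0.
Qed.

Lemma Rintegral_FTC a b F f : a < b -> {within `[a, b], continuous F} ->
  {within `[a, b], continuous f} ->
  (forall x, x \in `]a, b[ -> is_derive x 1 F (f x)) ->
  \int[mu]_(x in `]a, b[) f x = F b - F a.
Proof.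
move=> ab cF cf dF; rewrite Rintegral_oo_cc//; last exact: cont_integrable_cc.
rewrite /Rintegral (@continuous_FTC2 _ f F)//.
  have /(continuous_within_itvP _ ab)[_ Fa Fb] := cF.
  by split => // x xab; have [] := dF _ xab.
by move=> x xab; rewrite derive1E; have [_ ->] := dF _ xab.
Qed.

Lemma test_fun_ends a b phi : test_fun a b phi -> phi a = 0 /\ phi b = 0.
Proof.
move=> [_ _ [I [aI Ib] phi0]]; split; apply: phi0.
  by rewrite in_itv/= leNgt aI.
by rewrite in_itv/= andbC leNgt Ib.
Qed.

Lemma test_fun_cont a b phi : test_fun a b phi -> continuous phi.
Proof.
move=> [dphi _ _] x; apply: differentiable_continuous; exact/derivable1_diffP.
Qed.

Lemma Rintegral_test_by_parts a b F f phi : a < b ->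
  {within `[a, b], continuous F} -> {within `[a, b], continuous f} ->
  (forall x, x \in `]a, b[ -> is_derive x 1 F (f x)) -> test_fun a b phi ->
  \int[mu]_(x in `]a, b[) (F x * derive1 phi x) =
  - \int[mu]_(x in `]a, b[) (f x * phi x).
Proof.
move=> ab cF cf dF tphi.
have [dphi cdphi _] := tphi.
have [phia phib] := test_fun_ends tphi.
have cphi : {within `[a, b], continuous phi}.
  exact/continuous_subspaceT/(test_fun_cont tphi).
have {}cdphi : {within `[a, b], continuous (derive1 phi)}.
  exact/continuous_subspaceT.
have c1 : {within `[a, b], continuous (fun x => F x * derive1 phi x)}.
  by move=> x; apply: continuousM; [exact: cF|exact: cdphi].
have c2 : {within `[a, b], continuous (fun x => f x * phi x)}.
  by move=> x; apply: continuousM; [exact: cf|exact: cphi].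
apply/eqP; rewrite -addr_eq0 -RintegralD//; [|exact: cont_integrable_oo..].
have -> : 0 = F b * phi b - F a * phi a by rewrite phia phib !mulr0 subrr.
apply/eqP; apply: (@Rintegral_FTC _ _ (fun x => F x * phi x)) => //.
- by move=> x; apply: continuousM; [exact: cF|exact: cphi].
- by move=> x; exact: (continuousD (c1 x) (c2 x)).
move=> x xab; have dFx := dF _ xab.
have dphix : is_derive x 1 phi (derive1 phi x).
  by rewrite derive1E; exact/derivableP.
suff -> : F x * derive1 phi x + f x * phi x =
    F x *: derive1 phi x + phi x *: f x by exact: is_deriveM.
by rewrite /GRing.scale/= [phi x * _]mulrC.
Qed.

End intervals.

(** * Cut-off test functions *)

Section cutoff.
Variable R : realType.
Notation mu := (@lebesgue_measure R).
Implicit Types (a b x y : R).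

(** A remainder of second order identifies the derivative; this avoids a
    case distinction at the kink of [Num.max 0]. *)
Lemma is_derive_quad (F : R -> R) y (L C : R) :
  (forall h, `|F (h + y) - F y - L * h| <= C * h ^+ 2) -> is_derive y 1 F L.
Proof.
move=> FC.
have cv : h^-1 *: (F (h *: 1 + y) - F y) @[h --> 0^'] --> L.
  apply/cvgrPdist_le => /= e e0.
  have C0 : 0 < `|C| + 1 by rewrite ltr_wpDl.
  near=> h.
  have h0 : h != 0 by near: h; exact: nbhs_dnbhs_neq.
  have he : `|h| <= e / (`|C| + 1).
    by near: h; apply: dnbhs0_le; rewrite divr_gt0.
  rewrite /GRing.scale /= mulr1 distrC.
  have -> : h^-1 * (F (h + y) - F y) - L = h^-1 * (F (h + y) - F y - L * h).
    by field.
  rewrite normrM normfV ler_pdivrMl ?normr_gt0// (le_trans (FC h))//.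
  rewrite -real_normK ?num_real// expr2 mulrCA ler_wpM2l//.
  have {}he : (`|C| + 1) * `|h| <= e by rewrite -ler_pdivlMl// mulrC.
  by apply: le_trans he; rewrite ler_wpM2r// (le_trans (ler_norm _))// lerDl.
apply: DeriveDef; first by apply/cvg_ex; exists L.
exact: cvg_lim.
Unshelve. all: by end_near. Qed.

(** The positive part is squared to be continuously differentiable at 0. *)
Definition possq y : R := Num.max 0 y ^+ 2.

Lemma possq_ge0 y : 0 <= possq y.
Proof. exact: sqr_ge0. Qed.

Lemma is_derive_possq y : is_derive y 1 possq (2 * Num.max 0 y).
Proof.
apply: (@is_derive_quad _ _ _ 1) => h; rewrite mul1r /possq.
have [hy|hy] := leP 0 (h + y); have [y0|y0] := leP 0 y;
  rewrite ler_norml; apply/andP; split; nra.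
Qed.

Lemma max0_cont : continuous (Num.max 0 : R -> R).
Proof. by move=> x; apply: continuous_max; [exact: cvg_cst|exact: cvg_id]. Qed.

(** With [psi] the product of the two squared positive parts, this is
    [n psi / (1 + n psi)]: it vanishes outside of ]a, b[ and tends to 1 inside. *)
Definition cutoff a b (n : nat) x : R :=
  1 - (1 + n%:R * (possq (x - a) * possq (b - x)))^-1.

Definition dcutoff a b (n : nat) x : R :=
  (n%:R * (2 * Num.max 0 (x - a) * possq (b - x)
           - possq (x - a) * (2 * Num.max 0 (b - x)))) *
  (1 + n%:R * (possq (x - a) * possq (b - x))) ^- 2.

Lemma cutoff_den_gt0 a b n x : 0 < 1 + n%:R * (possq (x - a) * possq (b - x)).
Proof. by rewrite ltr_pwDl// mulr_ge0// mulr_ge0 ?possq_ge0. Qed.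

Lemma is_derive_cutoff a b n x : is_derive x 1 (cutoff a b n) (dcutoff a b n x).
Proof.
have da : is_derive x 1 (fun x => possq (x - a)) (2 * Num.max 0 (x - a)).
  rewrite -[X in is_derive _ _ _ X]mulr1.
  apply: (@is_derive1_comp _ possq (fun x => x - a)); first exact: is_derive_possq.
  have : is_derive x 1 (id - cst a) (1 - 0) by exact: is_deriveB.
  by rewrite subr0.
have db : is_derive x 1 (fun x => possq (b - x)) (- (2 * Num.max 0 (b - x))).
  rewrite -mulrN1.
  apply: (@is_derive1_comp _ possq (fun x => b - x)); first exact: is_derive_possq.
  have : is_derive x 1 (cst b - id) (0 - 1) by exact: is_deriveB.
  by rewrite sub0r.
have dab := is_deriveM da db.
have dn := is_deriveZ n%:R dab.
have d1 := is_deriveD (is_derive_cst (1 : R) x 1) dn.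
have den0 : (cst 1 + n%:R *: ((fun x => possq (x - a)) * (fun x => possq (b - x)))) x
  != 0 by rewrite gt_eqF//; exact: cutoff_den_gt0.
have dV := is_deriveV den0 d1.
have dB := is_deriveB (is_derive_cst (1 : R) x 1) dV.
rewrite /cutoff /dcutoff.
set L := (X in is_derive _ _ _ X).
set L' := (X in is_derive _ _ _ X) in dB.
suff -> : L = L' by exact: dB.
rewrite /L /L' /GRing.scale /=.
rewrite -[X in _ = _ - - X * _]/((1 + n%:R * (possq (x - a) * possq (b - x))) ^- 2).
set w := _ ^- 2; ring.
Qed.

Lemma possq_cont : continuous possq.
Proof.
move=> x; rewrite /possq.
rewrite (_ : (fun y => _) = (fun y => Num.max 0 y * Num.max 0 y)); last first.
  by apply/funext => y; rewrite expr2.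
by apply: continuousM; exact: max0_cont.
Qed.

Lemma dcutoff_cont a b n : continuous (dcutoff a b n).
Proof.
have cB c : continuous (fun x : R => x - c).
  by move=> x; apply: cvgB; [exact: cvg_id|exact: cvg_cst].
have Bc c : continuous (fun x : R => c - x).
  by move=> x; apply: cvgB; [exact: cvg_cst|exact: cvg_id].
have c1 : continuous (fun x => possq (x - a)).
  by move=> x; apply: (@continuous_comp _ _ _ (fun x => x - a) possq); [exact: cB|exact: possq_cont].
have c2 : continuous (fun x => possq (b - x)).
  by move=> x; apply: (@continuous_comp _ _ _ (fun x => b - x) possq); [exact: Bc|exact: possq_cont].
have c3 : continuous (fun x => 2 * Num.max 0 (x - a)).
  move=> x; apply: cvgM; first exact: cvg_cst.
  by apply: (@continuous_comp _ _ _ (fun x => x - a) (Num.max 0)); [exact: cB|exact: max0_cont].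
have c4 : continuous (fun x => 2 * Num.max 0 (b - x)).
  move=> x; apply: cvgM; first exact: cvg_cst.
  by apply: (@continuous_comp _ _ _ (fun x => b - x) (Num.max 0)); [exact: Bc|exact: max0_cont].
move=> x; rewrite /dcutoff; apply: cvgM.
  apply: cvgM; first exact: cvg_cst.
  by apply: cvgB; apply: cvgM; (exact: c1 || exact: c2 || exact: c3 || exact: c4).
apply: cvgV; first by rewrite sqrf_eq0 gt_eqF//; exact: cutoff_den_gt0.
have cd : (1 + n%:R * (possq (y - a) * possq (b - y))) @[y --> x] -->
  1 + n%:R * (possq (x - a) * possq (b - x)).
  apply: cvgD; first exact: cvg_cst.
  apply: cvgM; first exact: cvg_cst.
  by apply: cvgM; [exact: c1|exact: c2].
exact: (cvgM cd cd).
Qed.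

Lemma cutoff_out a b n x : x \notin `]a, b[ -> cutoff a b n x = 0.
Proof.
rewrite in_itv/= negb_and -!leNgt => xab; rewrite /cutoff.
suff -> : possq (x - a) * possq (b - x) = 0 by rewrite mulr0 addr0 invr1 subrr.
case/orP: xab => h.
  by rewrite {1}/possq max_l ?expr0n ?mul0r// subr_le0.
by rewrite {2}/possq max_l ?expr0n ?mulr0// subr_le0.
Qed.

Lemma cutoff_test A B a b n : A < a -> b < B -> test_fun A B (cutoff a b n).
Proof.
move=> Aa bB; split.
- by move=> x; have [] := is_derive_cutoff a b n x.
- rewrite (_ : derive1 _ = dcutoff a b n); first exact: dcutoff_cont.
  by apply/funext => x; rewrite derive1E; have [_ ->] := is_derive_cutoff a b n x.
exists (a, b) => //= x xab; apply: cutoff_out; apply: contra xab.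
exact: subset_itv_oo_cc.
Qed.

Lemma cutoff_ge0_le1 a b n x : 0 <= cutoff a b n x <= 1.
Proof.
rewrite /cutoff; have D := cutoff_den_gt0 a b n x; apply/andP; split.
  by rewrite subr_ge0 invf_le1// lerDl mulr_ge0// mulr_ge0 ?possq_ge0.
by rewrite gerBl invr_ge0 ltW.
Qed.

Lemma cutoff_cvg a b x : cutoff a b n x @[n --> \oo] --> (\1_`]a, b[ x : R).
Proof.
rewrite indicE; have [xab|xab] := boolP (x \in `]a, b[%classic); last first.
  apply: cvg_near_cst; apply: nearW => n /=; apply: cutoff_out.
  by apply: contra xab => xab; rewrite inE.
rewrite /= -[X in _ --> X]subr0.
apply: cvgB; first exact: cvg_cst.
set p := possq (x - a) * possq (b - x).
have p0 : 0 < p.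
  move: xab; rewrite inE/= in_itv/= => /andP[ax xb].
  by rewrite mulr_gt0// exprn_gt0// lt_max subr_gt0 ?ax ?xb orbT.
apply/cvgrPdist_le => /= e e0.
near=> n.
have n0 : (0 < n)%N by near: n; exact: nbhs_infty_gt.
have D : 0 < 1 + n%:R * p by rewrite ltr_pwDl// mulr_ge0// ltW.
rewrite sub0r normrN ger0_norm ?invr_ge0 ?(ltW D)//.
rewrite -[leRHS]invrK lef_pV2 ?posrE ?invr_gt0//.
rewrite (@le_trans _ _ (n%:R * p))//; last by rewrite lerDr.
rewrite -ler_pdivrMr//; near: n; exact: nbhs_infty_ger.
Unshelve. all: by end_near. Qed.

End cutoff.

(** * The fundamental lemma of the calculus of variations *)

Section fundamental.
Variable R : realType.
Notation mu := (@lebesgue_measure R).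
Implicit Types (a b x y : R).

Lemma Rintegral_cutoff_cvg A B (v : R -> R) a b :
  mu.-integrable `]A, B[ (EFin \o v) -> `]a, b[ `<=` `]A, B[ ->
  \int[mu]_(x in `]A, B[) (v x * cutoff a b n x) @[n --> \oo] -->
  \int[mu]_(x in `]a, b[) v x.
Proof.
move=> iv sub.
have mv : measurable_fun `]A, B[ v by move/measurable_int/measurable_EFinP : iv.
have mvb n : measurable_fun `]A, B[ (fun x => v x * cutoff a b n x).
  apply: measurable_funM => //; apply: measurable_funTS.
  apply: continuous_measurable_fun => x; apply: differentiable_continuous.
  by apply/derivable1_diffP; have [] := is_derive_cutoff a b n x.
have mvi : measurable_fun `]A, B[ (fun x => v x * \1_`]a, b[ x).
  by apply: measurable_funM => //; apply: measurable_indic.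
have [] := @dominated_convergence _ _ _ mu `]A, B[ _
  (fun n x => (v x * cutoff a b n x)%:E) (fun x => (v x * \1_`]a, b[ x)%:E)
  (fun x => `|v x|%:E).
- exact: measurable_itv.
- by move=> n; exact: ((measurable_EFinP _ _).2 (mvb n)).
- exact: ((measurable_EFinP _ _).2 mvi).
- apply: aeW => x _; apply: cvg_EFin; first exact: nearW.
  by apply: cvgM; [exact: cvg_cst|exact: cutoff_cvg].
- exact: integrable_norm.
- apply: aeW => x n _; rewrite lee_fin normrM ler_piMr//.
  have /andP[b0 b1] := cutoff_ge0_le1 a b n x.
  by rewrite ger0_norm.
move=> i _ cv.
have -> : \int[mu]_(x in `]a, b[) v x = fine (\int[mu]_(x in `]A, B[) (v x * \1_`]a, b[ x)%:E).
  rewrite /Rintegral -[in LHS](setIidr sub) integral_mkcondr.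
  congr fine; apply: eq_integral => x _; rewrite patchE indicE.
  by case: (x \in _); rewrite ?mulr1 ?mulr0.
apply: fine_cvg; rewrite fineK; first exact: cv.
exact: integrable_fin_num.
Qed.

(** Countably many test functions suffice, which is needed when the null set
    of the hypothesis depends on the test function.  The cut-offs give a zero
    integral over every interval with rational ends; the indefinite integral of v
    is continuous, hence constant, and its derivative is v almost everywhere. *)
Lemma fundamental_lemma_rat A B (v : R -> R) : A < B ->
  mu.-integrable `]A, B[ (EFin \o v) ->
  (forall p q : rat, A < ratr p -> p < q -> ratr q < B ->
     forall n, \int[mu]_(x in `]A, B[) (v x * cutoff (ratr p) (ratr q) n x) = 0) ->
  {ae mu, forall x, x \in `]A, B[ -> v x = 0}.
Proof.
move=> AB iv v0.
(* extended by 0, to have an indefinite integral on the closed interval *)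
pose w := v \_ `]A, B[.
have iw : mu.-integrable setT (EFin \o w).
  by rewrite /w -restrict_EFin; apply/integrable_restrict => //; rewrite setTI.
have iwE D : measurable D -> mu.-integrable D (EFin \o w).
  by move=> mD; apply: integrableS iw.
pose F (x : R) : R := \int[mu]_(t in `[A, x]) w t.
have cF : {within `[A, B], continuous F}.
  exact: (parameterized_integral_continuous (ltW AB) (iwE _ (measurable_itv _))).
have Fpq (p q : rat) : A < ratr p -> p < q -> ratr q < B ->
    F (ratr q) = F (ratr p).
  move=> Ap pq' qB; have pq : ratr p < ratr q :> R by rewrite ltr_rat.
  apply/eqP; rewrite -subr_eq0.
  rewrite /F (@Rintegral_itvB _ w (BLeft A) (BRight (ratr q)))//; last 3 first.
  - exact: iwE.
  - by rewrite bnd_simp ltW.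
  - by rewrite bnd_simp ltW.
  rewrite -Rintegral_itv_bndo_bndc; last exact: iwE.
  have sub : `]ratr p, ratr q[ `<=` `]A, B[.
    by apply: subset_itvW; exact: ltW.
  rewrite (_ : \int[mu]_(x in _) _ = \int[mu]_(x in `]ratr p, ratr q[) v x).
    have cv := Rintegral_cutoff_cvg iv sub.
    apply/eqP; rewrite -(cvg_lim (@Rhausdorff R) cv); apply: lim_near_cst => //.
    by apply: nearW => n; exact: v0 Ap pq' qB n.
  apply: eq_Rintegral => x; rewrite inE => xpq.
  by rewrite /w patchE mem_set//; exact: sub.
have Fconst x y : x \in `]A, B[ -> y \in `]A, B[ -> F x = F y.
  move=> xAB yAB.
  have Fcv z : z \in `]A, B[ -> {for z, continuous F}.
    by move=> zAB; exact: (within_continuous_continuous AB cF).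
  have near_rat z e : z \in `]A, B[ -> 0 < e ->
    exists2 p : rat, (ratr p : R) \in `]A, B[ & `|F z - F (ratr p)| <= e.
    move=> zAB e0.
    have /cvgrPdist_le/(_ _ e0)/nbhs_ballP[d /= d0 dF] := Fcv _ zAB.
    have := zAB; rewrite in_itv/= => /andP[Az zB].
    have : Num.max A (z - d) < Num.min B (z + d).
      rewrite gt_max !lt_min AB; apply/and3P; split; [lra|lra|lra].
    move=> /rat_in_itvoo[p]; rewrite in_itv/= gt_max lt_min.
    move=> /andP[/andP[Ap zp] /andP[pB pz]]; exists p; first by rewrite in_itv/= Ap.
    by apply: dF; rewrite /ball/= ltr_norml; apply/andP; split; lra.
  apply/eqP; rewrite -subr_eq0 -normr_le0; apply/ler_addgt0Pl => e e0.
  have e20 : 0 < e / 2 by rewrite divr_gt0.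
  have [p + xp] := near_rat _ _ xAB e20; have [q + yq] := near_rat _ _ yAB e20.
  rewrite !in_itv/= => /andP[Aq qB] /andP[Ap pB].
  have FE : F (ratr p) = F (ratr q).
    have [pq|qp|->//] := ltgtP p q; last exact: Fpq.
    by apply/esym; exact: Fpq.
  rewrite addr0 [e]splitr (_ : F x - F y = (F x - F (ratr p)) - (F y - F (ratr q))).
    by rewrite (le_trans (ler_normB _ _))// lerD.
  by rewrite FE; ring.
have locw : locally_integrable setT w by apply: integrable_locally.
have := @FTC1 R w (BLeft A) (fun y => iwE _ (measurable_itv _)) locw.
apply: filterS; first exact: (ae_filter_ringOfSetsType mu).
move=> x /= H xAB.
have := xAB; rewrite in_itv/= => /andP[Ax xB].
have [|_ F'x] := H; first by rewrite lte_fin.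
have <- : w x = v x by rewrite /w patchE mem_set.
rewrite -F'x derive1E.
suff dF : is_derive x 1 F 0 by have [_ ->] := dF.
have nearF : \forall y \near x, cst (F x) y = F y.
  have /near_in_itvoo := xAB; apply: filterS => y /= yAB.
  exact: Fconst.
exact: (near_eq_is_derive nearF (is_derive_cst (F x) x 1)).
Qed.

End fundamental.

(** * Weak derivatives of classically differentiable functions *)

Section identification.
Variable R : realType.
Notation mu := (@lebesgue_measure R).
Implicit Types (a b x y : R).

Lemma integrable_mul_test A B (v phi : R -> R) : A < B ->
  mu.-integrable `]A, B[ (EFin \o v) -> {within `[A, B], continuous phi} ->
  mu.-integrable `]A, B[ (EFin \o (fun x => v x * phi x)).
Proof.
move=> AB iv cphi.
have /compact_bounded[M [Mreal HM]] :=
  continuous_compact cphi (@segment_compact _ A B).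
have mphi : measurable_fun `]A, B[ phi by exact: cont_measurable_oo.
have -> : EFin \o (fun x => v x * phi x) = ((EFin \o v) \* (EFin \o phi))%E.
  by apply/funext => x; rewrite /= EFinM.
apply: integrableMl => //; exists M; split => // K MK x xAB.
apply: HM => //; exists x => //; exact: subset_itv_oo_cc.
Qed.

(** Integration by parts gives the same identity for the classical
    derivative, and the difference is annihilated by all rational cut-offs. *)
Lemma weak_deriv_unique A B (F f w : R -> R) : A < B ->
  {within `[A, B], continuous F} -> {within `[A, B], continuous f} ->
  (forall x, x \in `]A, B[ -> is_derive x 1 F (f x)) ->
  mu.-integrable `]A, B[ (EFin \o w) ->
  (forall p q : rat, A < ratr p -> p < q -> ratr q < B -> forall n,
     let phi := @cutoff R (ratr p) (ratr q) n in
     \int[mu]_(x in `]A, B[) (F x * derive1 phi x) =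
     - \int[mu]_(x in `]A, B[) (w x * phi x)) ->
  {ae mu, forall x, x \in `]A, B[ -> w x = f x}.
Proof.
move=> AB cF cf dF iw H.
have if_ := cont_integrable_oo cf.
have iv : mu.-integrable `]A, B[ (EFin \o (fun x => w x - f x)).
  have -> : EFin \o (fun x => w x - f x) = ((EFin \o w) \- (EFin \o f))%E.
    by apply/funext => x; rewrite /= EFinB.
  exact: integrableB.
have := fundamental_lemma_rat AB iv; case.
- move=> p q Ap pq qB n; have /= Hp := H _ _ Ap pq qB n.
  have tphi : test_fun A B (@cutoff R (ratr p) (ratr q) n) by exact: cutoff_test.
  have cphi : {within `[A, B], continuous (@cutoff R (ratr p) (ratr q) n)}.
    exact/continuous_subspaceT/(test_fun_cont tphi).
  under eq_Rintegral do rewrite mulrBl.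
  rewrite RintegralB//; [|exact: integrable_mul_test..].
  rewrite (Rintegral_test_by_parts AB cF cf dF tphi) in Hp.
  by apply/eqP; rewrite subr_eq0 -eqr_opp -Hp.
move=> N [mN N0 sN]; exists N; split => // x /= xN.
by apply: sN => /= H'; apply: xN => xAB; apply/eqP; rewrite -subr_eq0 H'.
Qed.

Lemma L2_integrable (f : R -> R) : L2 f -> mu.-integrable `]0, 1[ (EFin \o f).
Proof.
apply: Lfun2_integrable; first exact: measurable_itv.
by rewrite /= lebesgue_measure_itv /= lte_fin ltr01 -EFinB ltry.
Qed.

Lemma H1_classical (f fx g : R -> R) : H1 f fx ->
  {within `[0, 1], continuous f} -> {within `[0, 1], continuous g} ->
  (forall x, x \in `]0, 1[ -> is_derive x 1 f (g x)) ->
  {ae mu, forall x, @Omega R x -> fx x = g x}.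
Proof.
move=> [_ L2fx wd] cf cg df.
apply: weak_deriv_unique cf cg df (L2_integrable L2fx) _ => //.
move=> p q p0 pq q1 n; apply: wd; exact: cutoff_test.
Qed.

Lemma ae_rat_pair (P : rat -> rat -> nat -> R -> Prop) :
  (forall p q n, {ae mu, forall x, P p q n x}) ->
  {ae mu, forall x, forall p q n, P p q n x}.
Proof.
move=> aeP.
have : {ae mu, forall x, forall m : nat,
   if @unpickle (rat * rat * nat)%type m is Some (p, q, n) then P p q n x else True}.
  apply: ae_foralln => m; case: unpickle => [[[p q] n]|]; last exact: aeW.
  exact: aeP.
apply: filterS; first exact: (ae_filter_ringOfSetsType mu).
by move=> x /= H p q n; have := H (pickle (p, q, n)); rewrite pickleK.
Qed.

Section time_derivative.
Variables (T : R) (f ft g : R -> R -> R).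
Hypothesis T0 : 0 < T.
Hypothesis Wf : W12_L2 T f ft.
Hypothesis cf : forall x, Omega x -> {within `[0, T], continuous (f^~ x)}.
Hypothesis cg : forall x, Omega x -> {within `[0, T], continuous (g^~ x)}.
Hypothesis df : forall t x, Qdom T (t, x) -> is_derive t 1 (f^~ x) (g t x).

Let Q := Qdom T.
Let mQ : measurable Q.
Proof. by apply: measurableX; exact: measurable_itv. Qed.

Let restrQ (h : R -> R -> R) : R * R -> R := (fun p : R * R => h p.1 p.2) \_ Q.

Let L2Q_measurable h : L2Q T h -> measurable_fun setT (restrQ h).
Proof. by rewrite /L2Q inE => /andP[]; rewrite inE. Qed.

Let L2Q_integrable h : L2Q T h -> (mu \x mu)%E.-integrable setT (EFin \o restrQ h).
Proof.
move=> hL2.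
rewrite /restrQ -restrict_EFin; apply/integrable_restrict => //; rewrite setTI.
apply: Lfun2_integrable => //.
rewrite [X in (X < _)%E]product_measure1E; [|exact: measurable_itv..].
rewrite [X in (X * _)%E](lebesgue_measure_itv `]0, T[).
rewrite [X in (_ * X)%E](lebesgue_measure_itv `]0, 1[) /= !lte_fin ltr01 T0.
by rewrite -!EFinB -EFinM ltry.
Qed.

Lemma L2Q_slice_measurable h t : L2Q T h -> t \in `]0, T[ ->
  measurable_fun (@Omega R) (h t).
Proof.
move=> /L2Q_measurable mh tT.
have ms : measurable_fun setT (fun x => restrQ h (t, x)).
  by apply: measurableT_comp mh _; exact: measurable_pair1.
apply: eq_measurable_fun (measurable_funTS ms) => x; rewrite inE => x01.
by rewrite /restrQ patchE mem_set.
Qed.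

(** The classical derivative is the limit of the difference quotients, and
    those are jointly measurable because f is. *)
Lemma measurable_time_deriv : measurable_fun setT (restrQ g).
Proof.
rewrite /restrQ; apply/(measurable_restrictT (fun p : R * R => g p.1 p.2) mQ).
have [L2f _ _] := Wf.
have mf := L2Q_measurable L2f.
(* forward quotients; near the final time the shifted point leaves Q, but for
   a fixed point of Q only finitely many n are affected *)
pose h (n : nat) (p : R * R) : R :=
  n.+1%:R * (restrQ f (p.1 + n.+1%:R^-1, p.2) - restrQ f p).
apply: (@measurable_fun_cvg _ _ _ _ h).
  move=> n; apply: measurable_funTS; apply: measurable_funM => //.
  apply: measurable_funB => //.
  apply: (measurableT_comp mf); apply/measurable_fun_pairP; split.
    by apply: (@measurable_funD _ _ _ _ fst (cst n.+1%:R^-1)).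
  exact: measurable_snd.
move=> [t x] Qtx /=.
have [dtx <-] := df Qtx.
have cv : (fun h => h^-1 *: ((f^~ x \o shift t) (h *: (1 : R)) - f t x)) @ 0^' -->
   'D_1 (f^~ x) t by exact: dtx.
have hn : (fun n : nat => n.+1%:R^-1 : R) @ \oo --> 0^'.
  move=> P [e /= e0 eP].
  change (\forall n \near \oo, P (n.+1%:R^-1)); near=> n.
  apply: eP => /=; last by rewrite gt_eqF// invr_gt0.
  rewrite sub0r normrN ger0_norm ?invr_ge0//.
  near: n; exact: near_infty_natSinv_lt (PosNum e0).
have hcv := cvg_comp _ _ hn cv.
apply: cvg_trans hcv; apply: near_eq_cvg.
have [t0 tT x01] : [/\ 0 < t, t < T & `]0, 1[%classic x].
  by move: Qtx; rewrite /Qdom /= in_itv/= => -[/andP[]].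
have eT : 0 < T - t by rewrite subr_gt0.
near=> n.
have tn : n.+1%:R^-1 < T - t.
  near: n; exact: near_infty_natSinv_lt (PosNum eT).
have Qt : Q (t + n.+1%:R^-1, x).
  split => //=; rewrite in_itv/=; apply/andP; split; last by rewrite -ltrBrDl.
  by rewrite addr_gt0// invr_gt0.
rewrite /= /h /restrQ /GRing.scale /= invrK mulr1 !patchE (mem_set Qt).
by rewrite (mem_set Qtx) [_^-1 + _]addrC.
Unshelve. all: by end_near. Qed.


(** The weak identity holds for almost every x with a null set that depends
    on the test function, so it is used for countably many of them only. *)
Lemma time_deriv_ae_slices :
  {ae mu, forall x, Omega x ->
     {ae mu, forall t, t \in `]0, T[ -> ft t x = g t x}}.
Proof.
have [_ L2ft wd] := Wf.
have ae1 : {ae mu, forall x,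
    mu.-integrable setT (fun t => (EFin \o restrQ ft) (t, x))}.
  exact: ae_integrable2 (L2Q_integrable L2ft).
pose P (p q : rat) n x := 0 < ratr p :> R -> p < q -> ratr q < T -> Omega x ->
    let phi := @cutoff R (ratr p) (ratr q) n in
    \int[mu]_(t in `]0, T[) (f t x * derive1 phi t) =
      - \int[mu]_(t in `]0, T[) (ft t x * phi t).
have ae2 : {ae mu, forall x, forall p q n, P p q n x}.
  apply: ae_rat_pair => p q n; rewrite /P.
  have [p0|] := ltP 0 (ratr p : R); last by move=> _; apply: aeW.
  have [qT|] := ltP (ratr q : R) T; last by move=> _; apply: aeW.
  have := wd _ (cutoff_test n p0 qT).
  apply: filterS; first exact: (ae_filter_ringOfSetsType mu).
  by move=> x /= H _ _ _; exact: H.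
move: ae1 ae2; apply: filterS2; first exact: (ae_filter_ringOfSetsType mu).
move=> x i1 w1 Ox.
apply: (weak_deriv_unique T0 (cf Ox) (cg Ox)).
- by move=> t tT; apply: df; split.
- have i2 : mu.-integrable `]0, T[ (fun t => (EFin \o restrQ ft) (t, x)).
    by apply: integrableS i1 => //; exact: measurable_itv.
  apply: eq_integrable i2; first exact: measurable_itv.
  move=> t; rewrite inE => tT.
  by rewrite /restrQ /= patchE mem_set//; split.
- by move=> p q p0 pq qT n; exact: w1.
Qed.

(** Equality for almost every x and then almost every t becomes equality for
    almost every t and then almost every x: by the theorem of Tonelli the integral
    of [`|ft - g|] over Q vanishes. *)
Lemma time_deriv_ae :
  {ae mu, forall t, t \in `]0, T[ ->
     {ae mu, forall x, Omega x -> ft t x = g t x}}.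
Proof.
have [_ L2ft _] := Wf.
pose v p : \bar R := (`|restrQ ft p - restrQ g p|)%:E.
have mv : measurable_fun setT v.
  apply/measurable_EFinP; apply: measurableT_comp => //.
  apply: measurable_funB; first exact: L2Q_measurable.
  exact: measurable_time_deriv.
have v0 p : (0 <= v p)%E by rewrite lee_fin.
have FT := @fubini_tonelli _ _ _ _ R mu mu v mv v0.
have G0 : (\int[mu]_y \int[mu]_x v (x, y) = 0)%E.
  rewrite (ae_eq_integral (cst 0%E))//; first exact: integral0.
    exact: measurable_fun_fubini_tonelli_G.
  have := time_deriv_ae_slices.
  apply: filterS; first exact: (ae_filter_ringOfSetsType mu).
  move=> x /= H _.
  have [Ox|nOx] := pselect (Omega x); last first.
    rewrite -[RHS](integral0 mu setT); apply: eq_integral => t _.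
    rewrite /v /restrQ !patchE memNset ?subrr ?normr0//.
    by move=> [_ /=].
  rewrite (ae_eq_integral (cst 0%E))//; first exact: integral0.
    by apply: measurableT_comp mv _; exact: measurable_pair2.
  have := H Ox.
  apply: filterS; first exact: (ae_filter_ringOfSetsType mu).
  move=> t /= Ht _; rewrite /v /restrQ !patchE; case: ifPn => [|_].
    by rewrite inE => -[/= tT _]; rewrite Ht// subrr normr0.
  by rewrite subrr normr0.
rewrite G0 in FT.
have mF : measurable_fun setT (fun x => \int[mu]_y v (x, y))%E.
  exact: measurable_fun_fubini_tonelli_F.
have aeF : ae_eq mu setT (fun x => \int[mu]_y v (x, y))%E (cst 0%E).
  apply/(ae_eq_integral_abs mu measurableT mF).
  rewrite -FT; apply: eq_integral => x _.
  by rewrite gee0_abs//; apply: integral_ge0.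
have {}aeF : {ae mu, forall t, setT t -> (\int[mu]_y v (t, y) = 0)%E} := aeF.
move: aeF; apply: filterS; first exact: (ae_filter_ringOfSetsType mu).
move=> t /= /(_ I) Ft tT.
have mvt : measurable_fun setT (fun x => v (t, x)).
  by apply: measurableT_comp mv _; exact: measurable_pair1.
have aev : ae_eq mu setT (fun x => v (t, x)) (cst 0%E).
  apply/(ae_eq_integral_abs mu measurableT mvt).
  by rewrite -[RHS]Ft; apply: eq_integral => x _; rewrite gee0_abs.
have {}aev : {ae mu, forall x, setT x -> v (t, x) = 0%E} := aev.
move: aev; apply: filterS; first exact: (ae_filter_ringOfSetsType mu).
move=> x /= /(_ I) vx Ox.
have Qtx : Q (t, x) by split.
move: vx; rewrite /v /restrQ !patchE (mem_set Qtx) /= => -[] /eqP.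
by rewrite normr_eq0 subr_eq0 => /eqP.
Qed.

End time_derivative.
End identification.

(** * From the weak equation in space to the flux *)

Section flux.
Variable R : realType.
Notation mu := (@lebesgue_measure R).
Implicit Types (A B f : R -> R).
Local Notation cont01 f := {within `[0 : R, 1], continuous f}.

Lemma primitive01 f : cont01 f -> exists F : R -> R,
  [/\ F 0 = 0, cont01 F & forall x : R, x \in `]0, 1[ -> is_derive x 1 F (f x)].
Proof.
move=> cf.
have fi := cont_integrable_cc cf.
exists (fun x => \int[mu]_(t in `[0, x]) f t); split.
- by rewrite set_itv1 Rintegral_set1.
- exact: parameterized_integral_continuous.
move=> x x01; move: (x01); rewrite in_itv/= => /andP[x0 x1].
have cx : {for x, continuous f} by exact: within_continuous_continuous x01.
have [//|dF F'] := @continuous_FTC1 R f (BLeft 0) x 1 x1 fi _ cx.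
by apply: DeriveDef; [exact: dF|rewrite -derive1E; exact: F'].
Qed.

Lemma cont_H1 f g : cont01 f -> cont01 g ->
  (forall x : R, x \in `]0, 1[ -> is_derive x 1 f (g x)) -> H1 f g.
Proof.
move=> cf cg df; split; [exact: cont_L2|exact: cont_L2|].
by move=> phi tphi; exact: Rintegral_test_by_parts.
Qed.

Lemma cont01_ends f : cont01 f -> (forall x : R, x \in `]0, 1[ -> f x = 0) ->
  f 0 = 0 /\ f 1 = 0.
Proof.
move=> /(continuous_within_itvP _ ltr01)[_ f0 f1] f00; split.
  have f00' : \forall x \near 0^'+, f x = 0.
    near=> x; apply: f00; rewrite in_itv/=; apply/andP; split; near: x.
      exact: nbhs_right_gt.
    exact: nbhs_right_lt.
  by rewrite -(cvg_lim (@Rhausdorff R) f0); exact: lim_near_cst.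
have f10 : \forall x \near 1^'-, f x = 0.
  near=> x; apply: f00; rewrite in_itv/=; apply/andP; split; near: x.
    exact: nbhs_left_gt.
  exact: nbhs_left_lt.
by rewrite -(cvg_lim (@Rhausdorff R) f1); exact: lim_near_cst.
Unshelve. all: by end_near. Qed.

(** The primitive of the square is nondecreasing with equal end values,
    hence constant. *)
Lemma Rintegral_sqr_eq0 f : cont01 f ->
  \int[mu]_(x in `]0, 1[) (f x * f x) = 0 -> forall x : R, x \in `]0, 1[ -> f x = 0.
Proof.
move=> cf int0.
have cf2 : cont01 (fun x => f x * f x).
  by move=> x; apply: continuousM; exact: cf.
have [W [W0 cW dW]] := primitive01 cf2.
have W1 : W 1 = 0 by rewrite -int0 (Rintegral_FTC ltr01 cW cf2 dW) W0 subr0.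
have mono (a b : R) : 0 <= a -> b <= 1 -> a <= b -> W a <= W b.
  move=> a0 b1 ab; rewrite -subr_ge0.
  have dWab x : x \in `]a, b[ -> is_derive x 1 W (f x * f x).
    rewrite in_itv/= => /andP[ax xb]; apply: dW.
    by rewrite in_itv/= (le_lt_trans a0 ax) (lt_le_trans xb b1).
  have cWab : {within `[a, b], continuous W}.
    by apply: continuous_subspaceW cW; apply: subset_itv; rewrite bnd_simp.
  have [c _ ->] := MVT_segment ab dWab cWab.
  by rewrite mulr_ge0 ?subr_ge0// -expr2 sqr_ge0.
have WE (x : R) : x \in `]0, 1[ -> W x = 0.
  rewrite in_itv/= => /andP[x0 x1]; apply/eqP; rewrite eq_le.
  by rewrite -{1}W1 -W0 !mono// ltW.
move=> x x01; have dWx := dW _ x01.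
have nearW : \forall y \near x, cst 0 y = W y.
  have /near_in_itvoo := x01; apply: filterS => y /= y01.
  by rewrite WE.
have [_ D0] := near_eq_is_derive nearW (is_derive_cst (0 : R) x 1).
have [_ D1] := dWx.
by apply/eqP; rewrite -sqrf_eq0 expr2 -D1 D0.
Qed.

(** Let G be the primitive of A with [G 0 = 0].  The test function is the
    primitive of [B - G] that vanishes at 1; after integration by parts of A the
    weak equation says that [B - G] has zero L^2 norm.  The constant test function
    then gives [G 1 = 0]. *)
Lemma flux_of_weak A B : cont01 A -> cont01 B ->
  (forall phi phi_x, H1 phi phi_x ->
     \int[mu]_(x in @Omega R) (A x * phi x)
     + \int[mu]_(x in @Omega R) (B x * phi_x x) = 0) ->
  [/\ B 0 = 0, B 1 = 0 & forall x : R, x \in `]0, 1[ -> is_derive x 1 B (A x)].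
Proof.
move=> cA cB weak; rewrite /Omega in weak.
have [G [G0 cG dG]] := primitive01 cA.
pose V x := B x - G x.
have cV : cont01 V by move=> x; exact: (continuousB (cB x) (cG x)).
have [Phi [Phi0 cPhi dPhi]] := primitive01 cV.
pose phi x := Phi x - Phi 1.
have cphi : cont01 phi.
  by move=> x; apply: (continuousB (cPhi x)); exact: cvg_cst.
have dphi (x : R) : x \in `]0, 1[ -> is_derive x 1 phi (V x).
  move=> x01; rewrite -[V x]subr0.
  exact: (is_deriveB (dPhi x x01) (is_derive_cst (Phi 1) x 1)).
have Hphi : H1 phi V by exact: cont_H1.
have V0 : forall x : R, x \in `]0, 1[ -> V x = 0.
  apply: Rintegral_sqr_eq0 => //.
  have cM f g : cont01 f -> cont01 g -> cont01 (fun x => f x * g x).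
    by move=> cf cg x; apply: continuousM; [exact: cf|exact: cg].
  have cD f g : cont01 f -> cont01 g -> cont01 (fun x => f x + g x).
    by move=> cf cg x; exact: (continuousD (cf x) (cg x)).
  (* the integrand is the derivative of G * phi, zero at 0 by G and at 1 by phi *)
  have parts : \int[mu]_(x in `]0, 1[) (A x * phi x + G x * V x) = 0.
    transitivity (G 1 * phi 1 - G 0 * phi 0); last first.
      by rewrite G0 /phi subrr mulr0 mul0r subr0.
    apply: (@Rintegral_FTC _ 0 1 (fun x => G x * phi x)) => //.
    - exact: cM.
    - by apply: cD; exact: cM.
    move=> x x01.
    suff -> : A x * phi x + G x * V x = G x *: V x + phi x *: A x.
      exact: (is_deriveM (dG x x01) (dphi x x01)).
    by rewrite /GRing.scale/=; ring.
  have := weak _ _ Hphi; rewrite -RintegralD//; last 2 first.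
  - exact/cont_integrable_oo/cM.
  - exact/cont_integrable_oo/cM.
  under eq_Rintegral.
    move=> x _.
    rewrite (_ : A x * phi x + B x * V x = (A x * phi x + G x * V x) + V x * V x);
      last by rewrite /V; ring.
    over.
  rewrite RintegralD//; last 2 first.
  - by apply/cont_integrable_oo/cD; exact: cM.
  - exact/cont_integrable_oo/cM.
  by rewrite parts add0r.
have [V00 V01] := cont01_ends cV V0.
have G1 : G 1 = 0.
  have H1c : H1 (cst (1 : R)) (cst 0).
    apply: cont_H1.
    - by move=> x; exact: cvg_cst.
    - by move=> x; exact: cvg_cst.
  have := weak _ _ H1c; under eq_Rintegral do rewrite /= mulr1.
  under [X in _ + X = _ -> _]eq_Rintegral do rewrite /= mulr0.
  rewrite Rintegral_cst; last exact: measurable_itv.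
  rewrite mul0r addr0 => H.
  by move: (Rintegral_FTC ltr01 cG cA dG); rewrite H G0 subr0.
have BG x : V x = 0 -> B x = G x by move=> /eqP; rewrite subr_eq0 => /eqP.
split; [by rewrite BG|by rewrite BG|].
move=> x x01; apply: near_eq_is_derive (dG _ x01).
have /near_in_itvoo := x01; apply: filterS => y /= y01.
by rewrite BG// V0.
Qed.

End flux.

(** * Uniform first and second order expansions on a closed rectangle *)

Section rectangle.
Variable R : realType.
Implicit Types (a b t s x y d e : R) (f g : R -> R -> R).

Definition rect a b : set (R * R) := `[0, a]%classic `*` `[0, b]%classic.

Definition cont2 a b f := {within rect a b, continuous (fun p => f p.1 p.2)}.

(** Uniform continuity on the closed rectangle.  Unlike [cont2] it does not
    distinguish the two variables, so that results in space apply in time. *)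
Definition ucont a b f := forall e, 0 < e -> exists2 d, 0 < d &
  forall t s x y, t \in `[0, a] -> s \in `[0, a] -> x \in `[0, b] ->
    y \in `[0, b] -> `|t - s| < d -> `|x - y| < d -> `|f t x - f s y| < e.

Lemma rect_compact a b : compact (rect a b).
Proof. by apply: compact_setX; exact: segment_compact. Qed.

(** The Heine theorem, by compactness in the form of near coverings. *)
Lemma cont2_ucont a b f : cont2 a b f -> ucont a b f.
Proof.
move=> /subspace_continuousP cf e e0.
have e20 : 0 < e / 2 by rewrite divr_gt0.
pose P (d : R) (p : R * R) := rect a b p -> forall q, rect a b q ->
  `|p.1 - q.1| < d -> `|p.2 - q.2| < d -> `|f p.1 p.2 - f q.1 q.2| < e.
have : \forall d \near 0^'+, rect a b `<=` P d.
  move: (rect_compact (a := a) (b := b)) => /compact_near_coveringP; apply => p ab.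
  have /cvgrPdist_lt/(_ _ e20) := cf _ ab; rewrite near_withinE.
  move=> /nbhs_ballP[r /= r0 rf].
  have r20 : 0 < r / 2 by rewrite divr_gt0.
  exists (ball p (r / 2), [set d : R | d < r / 2]).
    split => /=; first exact: nbhsx_ballx.
    exact: nbhs_right_lt.
  move=> [q d] /= [[pq1 pq2] dr] abq z abz qz1 qz2.
  move: pq1 pq2; rewrite /ball /= => pq1 pq2.
  have fq : `|f p.1 p.2 - f q.1 q.2| < e / 2.
    apply: rf => //; split => /=; rewrite /ball /=.
      by rewrite (lt_trans pq1)// ltr_pdivrMr// ltr_pMr// ltr1n.
    by rewrite (lt_trans pq2)// ltr_pdivrMr// ltr_pMr// ltr1n.
  have fz : `|f p.1 p.2 - f z.1 z.2| < e / 2.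
    apply: rf => //; split => /=; rewrite /ball /= [r]splitr.
      by rewrite (le_lt_trans (ler_distD q.1 _ _))// ltrD// (lt_trans qz1).
    by rewrite (le_lt_trans (ler_distD q.2 _ _))// ltrD// (lt_trans qz2).
  rewrite (le_lt_trans (ler_distD (f p.1 p.2) _ _))// [e]splitr ltrD//.
  by rewrite distrC.
move=> near_d.
have [d [Pd d0]] : exists d, rect a b `<=` P d /\ 0 < d.
  near (0 : R)^'+ => d; exists d; split; near: d; first exact: near_d.
  exact: nbhs_right_gt.
exists d => // t s x y ta sa xb yb ts xy.
by apply: (Pd (t, x) _ _ (s, y)).
Unshelve. all: by end_near. Qed.

Lemma cont2_bounded a b f : cont2 a b f ->
  exists2 M, 0 < M & forall t x, t \in `[0, a] -> x \in `[0, b] -> `|f t x| <= M.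
Proof.
move=> cf.
have /compact_bounded[M [Mreal HM]] := continuous_compact cf (@rect_compact a b).
exists (Num.max (M + 1) 1); first by rewrite lt_max ltr01 orbT.
move=> t x ta xb; apply: HM; first by rewrite lt_max ltrDl ltr01.
by exists (t, x).
Qed.


Lemma ucont_swap a b f : ucont a b f -> ucont b a (fun x t => f t x).
Proof.
move=> cf e /cf[d d0 H]; exists d => // t s x y ta sa xb yb ts xy; exact: H.
Qed.

Lemma ucont_within a b f t : 0 < b -> ucont a b f -> t \in `[0, a] ->
  {within `[0, b], continuous (f t)}.
Proof.
move=> b0 cf ta; apply/subspace_continuousP => x /= xb.
apply/cvgrPdist_lt => e /cf[d d0 H]; rewrite near_withinE.
exists d => //= y xy yb; apply: H => //.
by rewrite subrr normr0.
Qed.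

Lemma itv_mem_between b x y c : x \in `[0, b] -> y \in `[0, b] ->
  c \in `]Num.min x y, (Num.max x y)[ -> (c \in `]0, b[) /\ (`|c - x| < `|x - y|).
Proof.
rewrite !in_itv/= => /andP[x0 xb] /andP[y0 yb] /andP[xc cx].
have [xy|yx] := leP x y.
  rewrite min_l// in xc; rewrite max_r// in cx.
  rewrite (le_lt_trans x0 xc) (lt_le_trans cx yb) ger0_norm ?subr_ge0 ?(ltW xc)//.
  by rewrite distrC ger0_norm ?subr_ge0// ltrD2r.
rewrite min_r ?ltW// in xc; rewrite max_l ?ltW// in cx.
rewrite (le_lt_trans y0 xc) (lt_le_trans cx xb) distrC ger0_norm ?subr_ge0 1?ltW//.
by rewrite ger0_norm ?subr_ge0 1?ltW// ltrD2l ltrN2.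
Qed.

Lemma MVT_between b (F f : R -> R) x y : {within `[0, b], continuous F} ->
  (forall z, z \in `]0, b[ -> is_derive z 1 F (f z)) ->
  x \in `[0, b] -> y \in `[0, b] -> x != y ->
  exists c, [/\ c \in `]0, b[, `|c - x| < `|x - y| & F y - F x = f c * (y - x)].
Proof.
move=> cF dF xb yb.
have main u v : u \in `[0, b] -> v \in `[0, b] -> u < v ->
    exists2 c, c \in `]u, v[ & F v - F u = f c * (v - u).
  move=> ub vb uv; move: (ub) (vb); rewrite !in_itv/= => /andP[u0 _] /andP[_ vb'].
  have dFuv z : z \in `]u, v[ -> is_derive z 1 F (f z).
    rewrite in_itv/= => /andP[uz zv]; apply: dF.
    by rewrite in_itv/= (le_lt_trans u0 uz) (lt_le_trans zv vb').
  apply: MVT => //.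
  by apply: continuous_subspaceW cF; apply: subset_itv; rewrite bnd_simp.
rewrite neq_lt => /orP[xy|yx].
  have [c cxy E] := main _ _ xb yb xy; exists c.
  have [|c0b cx] := @itv_mem_between b x y c xb yb.
    by rewrite min_l ?max_r// ltW.
  by split.
have [c cxy E] := main _ _ yb xb yx; exists c.
have [|c0b cx] := @itv_mem_between b x y c xb yb.
  by rewrite min_r ?max_l// ltW.
by split => //; rewrite -[LHS]opprB E; ring.
Qed.

(** The classical derivatives exist for inner times only, and the weak
    equation gives information at almost every time only.  Estimates are proved
    on such a dense set of times and extended to the closed interval by
    continuity. *)
Definition dense_times a (P : R -> Prop) := forall t r, t \in `[0, a] -> 0 < r ->
  exists s, [/\ s \in `[0, a], `|t - s| < r & P s].

Lemma dense_timesW a (P P' : R -> Prop) : (forall s, P s -> P' s) ->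
  dense_times a P -> dense_times a P'.
Proof.
move=> PP dP t r ta r0; have [s [sa ts Ps]] := dP _ _ ta r0.
by exists s; split => //; exact: PP.
Qed.

Lemma dense_le a (t C : R) (F : R -> R) : t \in `[0, a] ->
  F s @[s --> within `[0, a]%classic (nbhs t)] --> F t ->
  dense_times a (fun s => `|F s| <= C) -> `|F t| <= C.
Proof.
move=> ta cF dF; apply/ler_addgt0Pl => e e0.
have /cvgrPdist_le/(_ _ e0) := cF; rewrite near_withinE => /nbhs_ballP[r /= r0 H].
have [s [sa ts Fs]] := dF _ _ ta r0.
rewrite -[F t](subrK (F s)) (le_trans (ler_normD _ _))// lerD//.
exact: H.
Qed.

Lemma ucont_time a b f t x : 0 < a -> ucont a b f -> t \in `[0, a] ->
  x \in `[0, b] -> f s x @[s --> within `[0, a]%classic (nbhs t)] --> f t x.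
Proof.
move=> a0 cf ta xb.
have /subspace_continuousP := ucont_within a0 (ucont_swap cf) xb.
exact.
Qed.

Lemma ae_dense_times a (P : R -> Prop) : 0 < a ->
  {ae (@lebesgue_measure R), forall t, t \in `]0, a[ -> P t} ->
  dense_times a (fun t => (t \in `]0, a[) /\ P t).
Proof.
move=> a0 [N [mN N0 sN]] t r ta r0; apply: contrapT => none.
have ta' := ta; rewrite in_itv/= in ta'; case/andP: ta' => t0 t_a.
pose u := Num.max 0 (t - r); pose v := Num.min a (t + r).
have uv : u < v.
  by rewrite /u /v lt_min !gt_max; apply/andP; split; apply/andP; split; lra.
have sub : `]u, v[ `<=` N.
  move=> s /=; rewrite in_itv/= gt_max lt_min => /andP[/andP[s0 ts] /andP[sa st]].
  apply: sN => /= H; apply: none; exists s; split.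
  - by rewrite in_itv/= !ltW.
  - by rewrite ltr_norml; apply/andP; split; lra.
  - by split; [rewrite in_itv/= s0|apply: H; rewrite in_itv/= s0].
have : (@lebesgue_measure R `]u, v[ <= 0)%E.
  rewrite -N0; apply: le_measure; rewrite ?inE;
    [exact: measurable_itv|exact: mN|exact: sub].
by rewrite lebesgue_measure_itv /= lte_fin uv -EFinB lee_fin subr_le0 leNgt uv.
Qed.

Section taylor.
Variables (a b : R) (f fx : R -> R -> R).
Hypotheses (a0 : 0 < a) (b0 : 0 < b) (cf : ucont a b f) (cfx : ucont a b fx).

(** By the mean value theorem the remainder is an increment of fx over a
    distance less than d. *)
Lemma first_order :
  dense_times a (fun s => forall x, x \in `]0, b[ -> is_derive x 1 (f s) (fx s x)) ->
  forall e, 0 < e -> exists2 d, 0 < d & forall t x y, t \in `[0, a] ->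
    x \in `[0, b] -> y \in `[0, b] -> `|x - y| < d ->
    `|f t y - f t x - (y - x) * fx t x| <= e * `|y - x|.
Proof.
move=> dense e e0; have [d d0 H] := cfx e0; exists d => // t x y ta xb yb xyd.
apply: (@dense_le a t _ (fun t => f t y - f t x - (y - x) * fx t x)) => //.
  have uc g z := @ucont_time a b g t z a0.
  apply: cvgB; first by apply: cvgB; exact: uc.
  by apply: cvgM; [exact: cvg_cst|exact: uc].
move=> {}t r {}ta r0; have [s [sa ts ds]] := dense _ _ ta r0; exists s; split => //.
have [->|xy] := eqVneq x y; first by rewrite !subrr mul0r subrr !normr0 mulr0.
have [c [cb cx ->]] := MVT_between (ucont_within b0 cf sa) ds xb yb xy.
rewrite [_ * (y - x)]mulrC -mulrBr normrM mulrC ler_wpM2r// ltW//.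
apply: H => //; last exact: lt_trans cx xyd.
  exact: subset_itv_oo_cc cb.
by rewrite subrr normr0.
Qed.

End taylor.

(** Mean value theorem for the remainder of the expansion as a function of
    y: its derivative is the first-order remainder of fx. *)
Lemma second_order a b f fx fxx : 0 < a -> 0 < b -> ucont a b f ->
  ucont a b fx -> ucont a b fxx ->
  dense_times a (fun s => forall x, x \in `]0, b[ ->
    is_derive x 1 (f s) (fx s x) /\ is_derive x 1 (fx s) (fxx s x)) ->
  forall e, 0 < e -> exists2 d, 0 < d & forall t x y, t \in `[0, a] ->
    x \in `[0, b] -> y \in `[0, b] -> `|x - y| < d ->
    `|f t y - f t x - (y - x) * fx t x - (y - x) ^+ 2 / 2 * fxx t x|
      <= e * (y - x) ^+ 2.
Proof.
move=> a0 b0 cf cfx cfxx dense e e0.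
have [|d d0 H] := @first_order a b fx fxx a0 b0 cfx cfxx _ e e0.
  by apply: dense_timesW dense => s ds x xb; have [] := ds _ xb.
exists d => // t x y ta xb yb xyd.
apply: (@dense_le a t _ (fun t => f t y - f t x - (y - x) * fx t x -
                                  (y - x) ^+ 2 / 2 * fxx t x)) => //.
  have uc g z := @ucont_time a b g t z a0.
  apply: cvgB; last by apply: cvgM; [exact: cvg_cst|exact: uc].
  apply: cvgB; first by apply: cvgB; exact: uc.
  by apply: cvgM; [exact: cvg_cst|exact: uc].
move=> {}t r {}ta r0; have [s [sa ts ds]] := dense _ _ ta r0; exists s; split => //.
have [->|xy] := eqVneq x y.
  by rewrite !subrr mul0r subrr expr0n /= !mul0r subrr normr0 mulr0.
pose p1 := fun z : R => (z - x) * fx s x.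
pose p2 := fun z : R => (z - x) ^+ 2 / 2 * fxx s x.
pose F := (f s - p1) - p2.
have dlin z : is_derive z (1 : R) (fun z : R => z - x) (1 - 0 : R).
  exact: (is_deriveB (is_derive_id z 1) (is_derive_cst x z 1)).
have dp1 z : is_derive z (1 : R) p1 (fx s x).
  have := is_deriveM (dlin z) (is_derive_cst (fx s x) z 1).
  by rewrite /GRing.scale /= mulr0 add0r subr0 mulr1.
have dp2 z : is_derive z (1 : R) p2 ((z - x) * fxx s x).
  have := is_deriveM (is_deriveM (dlin z) (dlin z)) (is_derive_cst (fxx s x / 2) z 1).
  rewrite /GRing.scale /= mulr0 add0r subr0 mulr1.
  rewrite (_ : _ * _ * _ = p2 :> (R -> R)); last first.
    by apply/funext => w; rewrite /p2 !fctE; field.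
  by congr is_derive; field.
have dF z : z \in `]0, b[ ->
    is_derive z 1 F (fx s z - fx s x - (z - x) * fxx s x).
  move=> zb; have [dz _] := ds _ zb.
  exact: (is_deriveB (is_deriveB dz (dp1 z)) (dp2 z)).
have cF : {within `[0, b], continuous F}.
  have cp (p : R -> R) (dp : R -> R) : (forall z, is_derive z (1 : R) p (dp z)) ->
      {within `[0, b], continuous p}.
    move=> Hp; apply: continuous_subspaceT => z; apply: differentiable_continuous.
    by apply/derivable1_diffP; have [] := Hp z.
  have c0 := ucont_within b0 cf sa.
  by move=> z; exact: (continuousB (continuousB (c0 z) (cp _ _ dp1 z)) (cp _ _ dp2 z)).
have [c [cb cx E]] := MVT_between cF dF xb yb xy.
have -> : f s y - f s x - (y - x) * fx s x - (y - x) ^+ 2 / 2 * fxx s x = F y - F x.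
  have FE z : F z = f s z - p1 z - p2 z by [].
  by rewrite !FE /p1 /p2; field.
rewrite E normrM -(real_normK (num_real (y - x))) expr2 mulrA ler_wpM2r//.
apply: le_trans (H s x c sa xb _ _) _.
- exact: subset_itv_oo_cc cb.
- by rewrite distrC (lt_trans cx).
by rewrite ler_wpM2l ?(ltW e0)// [`|y - x|]distrC ltW.
Qed.

(** The second-order terms of the two one-sided expansions cancel. *)
Lemma central_difference a b f fx fxx : 0 < a -> 0 < b -> ucont a b f ->
  ucont a b fx -> ucont a b fxx ->
  dense_times a (fun s => forall x, x \in `]0, b[ ->
    is_derive x 1 (f s) (fx s x) /\ is_derive x 1 (fx s) (fxx s x)) ->
  forall e, 0 < e -> exists2 d, 0 < d & forall t m s, t \in `[0, a] ->
    0 <= s -> s < d -> 0 <= m - s -> m + s <= b ->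
    `|f t (m + s) - f t (m - s) - 2 * s * fx t m| <= e * s ^+ 2.
Proof.
move=> a0 b0 cf cfx cfxx dense e e0.
have e20 : 0 < e / 2 by rewrite divr_gt0.
have [d d0 H] := second_order a0 b0 cf cfx cfxx dense e20.
exists d => // t m s ta s0 sd ms msb.
have mb : m \in `[0, b] by rewrite in_itv/=; apply/andP; split; lra.
have pb : m + s \in `[0, b] by rewrite in_itv/=; apply/andP; split; lra.
have nb : m - s \in `[0, b] by rewrite in_itv/=; apply/andP; split; lra.
have := H t m (m + s) ta mb pb; have := H t m (m - s) ta mb nb.
rewrite opprB addrC subrK [m + s - m]addrC addKr opprD addNKr normrN ger0_norm//.
move=> /(_ sd) h1 /(_ sd) h2.
have -> : f t (m + s) - f t (m - s) - 2 * s * fx t m =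
  (f t (m + s) - f t m - s * fx t m - s ^+ 2 / 2 * fxx t m) -
  (f t (m - s) - f t m - (m - s - m) * fx t m - (m - s - m) ^+ 2 / 2 * fxx t m).
  by field.
rewrite (le_trans (ler_normB _ _))// (_ : e * s ^+ 2 = e / 2 * s ^+ 2 + e / 2 * (m - s - m) ^+ 2); last by field.
by rewrite lerD.
Qed.

End rectangle.

(** * The strong form of the system *)

Section strong_form.
Variable R : realType.
Notation mu := (@lebesgue_measure R).

(** What is kept of [A = B_x] with B = 0 at both ends.  It involves no
    derivative, and it is stable under limits in t, so it holds up to the
    boundary. *)
Definition flux_relation (T : R) (A B : R -> R -> R) :=
  (forall t, t \in `[0, T] -> B t 0 = 0 /\ B t 1 = 0) /\
  forall e, 0 < e -> exists2 d, 0 < d & forall t x y, t \in `[0, T] ->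
    x \in `[0, 1] -> y \in `[0, 1] -> `|x - y| < d ->
    `|B t y - B t x - (y - x) * A t x| <= e * `|y - x|.

Lemma ends_mem : ((0 : R) \in `[0, 1]) /\ ((1 : R) \in `[0, 1]).
Proof. by rewrite !in_itv/= !lexx ler01. Qed.

Lemma flux_relation_of_weak T A B : 0 < T -> cont2 T 1 A -> cont2 T 1 B ->
  {ae mu, forall t, t \in `]0, T[ -> forall phi phi_x, H1 phi phi_x ->
     \int[mu]_(x in @Omega R) (A t x * phi x)
     + \int[mu]_(x in @Omega R) (B t x * phi_x x) = 0} ->
  flux_relation T A B.
Proof.
move=> T0 /cont2_ucont cA /cont2_ucont cB weak.
have [m0 m1] := ends_mem.
have dense : dense_times T (fun t => [/\ B t 0 = 0, B t 1 = 0 &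
    forall x : R, x \in `]0, 1[ -> is_derive x 1 (B t) (A t x)]).
  apply: dense_timesW (ae_dense_times T0 weak) => t [tT].
  have tT' : t \in `[0, T] by exact: subset_itv_oo_cc tT.
  by apply: flux_of_weak; exact: ucont_within tT'.
split.
  move=> t tT; split; apply/eqP; rewrite -normr_le0.
    apply: (dense_le tT (ucont_time T0 cB tT m0)).
    by apply: dense_timesW dense => s [-> _ _]; rewrite normr0.
  apply: (dense_le tT (ucont_time T0 cB tT m1)).
  by apply: dense_timesW dense => s [_ -> _]; rewrite normr0.
apply: first_order => //.
by apply: dense_timesW dense => s [].
Qed.

(** g l m stands for the derivative of order l in t and m in x. *)
Definition derivs (T : R) (g : nat -> nat -> R -> R -> R) :=
  [/\ forall m t x, (m < 2)%N -> Qdom T (t, x) ->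
        is_derive x 1 (g 0%N m t) (g 0%N m.+1 t x),
      forall m t x, (m <= 1)%N -> Qdom T (t, x) ->
        is_derive t 1 (fun s => g 0%N m s x) (g 1%N m t x) &
      forall l m, (l <= 1)%N -> (m <= 2)%N -> (l + m <= 2)%N ->
        cont2 T 1 (g l m)].

Lemma Rintegral_ae_eq (D : set R) (f g : R -> R) : measurable D ->
  measurable_fun D f -> measurable_fun D g ->
  {ae mu, forall x, D x -> f x = g x} ->
  \int[mu]_(x in D) f x = \int[mu]_(x in D) g x.
Proof.
move=> mD mf mg fg; congr fine; apply: ae_eq_integral => //.
- exact/measurable_EFinP.
- exact/measurable_EFinP.
move: fg; apply: filterS; first exact: (ae_filter_ringOfSetsType mu).
by move=> x /= H /H ->.
Qed.

Lemma L2_measurable (f : R -> R) : L2 f -> measurable_fun (@Omega R) f.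
Proof.
move=> f2; apply/measurable_restrictT; first exact: measurable_itv.
by move: f2; rewrite /L2 inE => /andP[]; rewrite inE.
Qed.

Variables (T eps delta0 c kappa0 kappa nu : R) (alpha0 : R -> R -> R).
Variables (eta0 theta0 : R -> R) (g h : nat -> nat -> R -> R -> R).
Hypotheses (T0 : 0 < T) (eps0 : 0 < eps) (calpha0 : cont2 T 1 alpha0).
Hypotheses (dg : derivs T g) (dh : derivs T h).
Hypothesis sol : is_solution T eps delta0 c kappa0 kappa nu alpha0 eta0 theta0
  (g 0%N 0%N) (h 0%N 0%N).

(** The equations are [source_eta = (flux_eta)_x] and
    [source_theta = (flux_theta)_x], where g and h hold the derivatives of eta and
    theta. *)
Definition source_eta t x := g 1%N 0%N t x + c * (g 0%N 0%N t x - 1)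
  + kappa * g 0%N 0%N t x * gamma eps (h 0%N 1%N t x).
Definition flux_eta t x := kappa0 ^+ 2 * g 0%N 1%N t x.
Definition source_theta t x := alpha0 t x * h 1%N 0%N t x.
Definition flux_theta t x := kappa * alpha delta0 (g 0%N 0%N t x)
   * dgamma eps (h 0%N 1%N t x) + nu ^+ 2 * h 0%N 1%N t x.

Lemma cont2_comp (p : R -> R) f : continuous p -> cont2 T 1 f ->
  cont2 T 1 (fun t x => p (f t x)).
Proof.
by move=> cp cf z; exact: (cvg_comp _ _ (cf z) (cp _)).
Qed.

Lemma cont2D f1 f2 : cont2 T 1 f1 -> cont2 T 1 f2 ->
  cont2 T 1 (fun t x => f1 t x + f2 t x).
Proof. by move=> c1 c2 z; exact: (continuousD (c1 z) (c2 z)). Qed.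

Lemma cont2M f1 f2 : cont2 T 1 f1 -> cont2 T 1 f2 ->
  cont2 T 1 (fun t x => f1 t x * f2 t x).
Proof. by move=> c1 c2 z; exact: (continuousM (c1 z) (c2 z)). Qed.

Lemma cont2_cst k : cont2 T 1 (fun _ _ => k).
Proof. by move=> z; exact: cvg_cst. Qed.

Lemma alpha_continuous : continuous (alpha delta0).
Proof.
move=> x; apply: cvgD; last exact: cvg_cst.
by apply: cvgM; [apply: cvgM; exact: cvg_id|exact: cvg_cst].
Qed.

Lemma cont2_source_eta : cont2 T 1 source_eta.
Proof.
have [_ _ cg] := dg; have [_ _ ch] := dh.
apply: cont2D; [apply: cont2D|].
- exact: cg.
- apply: cont2M; first exact: cont2_cst.
  by apply: cont2D; [exact: cg|exact: cont2_cst].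
apply: cont2M; [apply: cont2M; [exact: cont2_cst|exact: cg]|].
by apply: cont2_comp; [exact: gamma_continuous|exact: ch].
Qed.

Lemma cont2_flux_eta : cont2 T 1 flux_eta.
Proof. by have [_ _ cg] := dg; apply: cont2M; [exact: cont2_cst|exact: cg]. Qed.

Lemma cont2_source_theta : cont2 T 1 source_theta.
Proof. by have [_ _ ch] := dh; apply: cont2M; [exact: calpha0|exact: ch]. Qed.

Lemma cont2_flux_theta : cont2 T 1 flux_theta.
Proof.
have [_ _ cg] := dg; have [_ _ ch] := dh.
apply: cont2D; last by apply: cont2M; [exact: cont2_cst|exact: ch].
apply: cont2M; last by apply: cont2_comp; [exact: dgamma_continuous|exact: ch].
apply: cont2M; first exact: cont2_cst.
by apply: cont2_comp; [exact: alpha_continuous|exact: cg].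
Qed.

(** For almost every t the weak derivatives in the weak equations may be
    replaced by the classical ones, after which both equations are of the form
    treated by [flux_relation_of_weak]. *)
Lemma strong_form :
  flux_relation T source_eta flux_eta /\ flux_relation T source_theta flux_theta.
Proof.
have [et [ex [tht [thx [[Wg Wh] [Lg Lh] _ _ weak]]]]] := sol.
have [dxg dtg cg] := dg; have [dxh dth ch] := dh.
have sl (f : R -> R -> R) t : cont2 T 1 f -> t \in `]0, T[ ->
    {within `[0, 1], continuous (f t)}.
  by move=> /cont2_ucont cf tT; apply: ucont_within cf _ => //; exact: subset_itv_oo_cc tT.
have slT (f : R -> R -> R) x : cont2 T 1 f -> Omega x ->
    {within `[0, T], continuous (f^~ x)}.
  move=> /cont2_ucont/ucont_swap cf xO; apply: (ucont_within T0 cf).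
  exact: subset_itv_oo_cc xO.
have mO : measurable (@Omega R) by exact: measurable_itv.
have msl (f : R -> R -> R) t : cont2 T 1 f -> t \in `]0, T[ ->
    measurable_fun (@Omega R) (f t).
  by move=> cf tT; apply: cont_measurable_oo; exact: sl.
have etE : {ae mu, forall t, t \in `]0, T[ ->
    {ae mu, forall x, Omega x -> et t x = g 1%N 0%N t x}}.
  apply: (time_deriv_ae T0 Wg).
  - by move=> x; apply: slT; exact: cg.
  - by move=> x; apply: slT; exact: cg.
  - by move=> t x; exact: (dtg 0%N).
have thtE : {ae mu, forall t, t \in `]0, T[ ->
    {ae mu, forall x, Omega x -> tht t x = h 1%N 0%N t x}}.
  apply: (time_deriv_ae T0 Wh).
  - by move=> x; apply: slT; exact: ch.
  - by move=> x; apply: slT; exact: ch.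
  - by move=> t x; exact: (dth 0%N).
have xE (f : nat -> nat -> R -> R -> R) fx : derivs T f ->
    Linfty_H1 T (f 0%N 0%N) fx -> {ae mu, forall t, t \in `]0, T[ ->
    H1 (f 0%N 0%N t) (fx t) /\
    {ae mu, forall x, Omega x -> fx t x = f 0%N 1%N t x}}.
  move=> [dxf _ cf] [_ _ [M]].
  apply: filterS; first exact: (ae_filter_ringOfSetsType mu).
  move=> t H tT; have [H1t _] := H tT; split => //.
  apply: H1_classical H1t _ _ _; [exact/sl/tT/cf|exact/sl/tT/cf|].
  by move=> x x01; apply: (dxf 0%N).
have exE := xE _ _ dg Lg; have thxE := xE _ _ dh Lh.
have all : {ae mu, forall t, t \in `]0, T[ ->
  [/\ {ae mu, forall x, Omega x -> et t x = g 1%N 0%N t x},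
      {ae mu, forall x, Omega x -> tht t x = h 1%N 0%N t x},
      H1 (g 0%N 0%N t) (ex t) /\
      {ae mu, forall x, Omega x -> ex t x = g 0%N 1%N t x},
      H1 (h 0%N 0%N t) (thx t) /\
      {ae mu, forall x, Omega x -> thx t x = h 0%N 1%N t x} &
      weak_eq_eta eps c kappa0 kappa (g 0%N 0%N t) (et t) (ex t) (thx t) /\
      weak_eq_theta eps delta0 kappa nu (alpha0 t) (g 0%N 0%N t) (tht t) (thx t)]}.
  have F := ae_filter_ringOfSetsType mu.
  near=> t => tT; split; [| | | |].
  - by move: tT; near: t.
  - by move: tT; near: t.
  - by move: tT; near: t.
  - by move: tT; near: t.
  - by move: tT; near: t.
have mgamma : measurable_fun setT (gamma eps).
  by apply: continuous_measurable_fun; exact: gamma_continuous.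
have mdgamma : measurable_fun setT (dgamma eps).
  by apply: continuous_measurable_fun; exact: dgamma_continuous.
have mcst (k : R) : measurable_fun (@Omega R) (fun=> k) by exact: measurable_cst.
split.
  apply: flux_relation_of_weak => //; [exact: cont2_source_eta|exact: cont2_flux_eta|].
  move: all; apply: filterS; first exact: (ae_filter_ringOfSetsType mu).
  move=> t H tT phi phi_x H1phi.
  have [etx _ [H1g exx] [H1h thxx] [weta _]] := H tT.
  have mphi := L2_measurable (let: And3 a _ _ := H1phi in a).
  have mphix := L2_measurable (let: And3 _ a _ := H1phi in a).
  have mex := L2_measurable (let: And3 _ a _ := H1g in a).
  have mthx := L2_measurable (let: And3 _ a _ := H1h in a).
  have met : measurable_fun (@Omega R) (et t).
    by case: Wg => _ l2 _; exact: L2Q_slice_measurable l2 tT.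
  have mg := msl _ _ (cg 0%N 0%N isT isT isT) tT.
  rewrite -[RHS](weta _ _ H1phi); congr (_ + _).
    apply: Rintegral_ae_eq => //.
    - apply: measurable_funM => //; exact: msl cont2_source_eta tT.
    - apply: measurable_funM => //; apply: measurable_funD.
        apply: measurable_funD => //; apply: measurable_funM => //.
        exact: measurable_funB.
      apply: measurable_funM; first exact: measurable_funM.
      exact: measurableT_comp mgamma mthx.
    - move: etx thxx; apply: filterS2; first exact: (ae_filter_ringOfSetsType mu).
      by move=> x e1 e2 Ox; rewrite e1// e2.
  have mgx := msl _ _ (cg 0%N 1%N isT isT isT) tT.
  rewrite (@Rintegral_ae_eq _ (fun x => ex t x * phi_x x)
    (fun x => phi_x x * g 0%N 1%N t x)) //; last first.
  - move: exx; apply: filterS; first exact: (ae_filter_ringOfSetsType mu).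
    by move=> x e1 Ox; rewrite e1// mulrC.
  - exact: measurable_funM.
  - exact: measurable_funM.
  rewrite -RintegralZl//; last first.
    apply: integrable_mul_test => //; last exact/sl/tT/cg.
    by case: H1phi => _ l2 _; exact: L2_integrable.
  by apply: eq_Rintegral => x _; rewrite /flux_eta; ring.
apply: flux_relation_of_weak => //; [exact: cont2_source_theta|exact: cont2_flux_theta|].
move: all; apply: filterS; first exact: (ae_filter_ringOfSetsType mu).
move=> t H tT psi psi_x H1psi.
have [_ thtx [H1g _] [H1h thxx] [_ wtheta]] := H tT.
have mpsi := L2_measurable (let: And3 a _ _ := H1psi in a).
have mpsix := L2_measurable (let: And3 _ a _ := H1psi in a).
have mthx := L2_measurable (let: And3 _ a _ := H1h in a).
have mtht : measurable_fun (@Omega R) (tht t).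
  by case: Wh => _ l2 _; exact: L2Q_slice_measurable l2 tT.
have mg := msl _ _ (cg 0%N 0%N isT isT isT) tT.
have ma := msl _ _ calpha0 tT.
rewrite -[RHS](wtheta _ _ H1psi); congr (_ + _); apply: Rintegral_ae_eq => //.
- apply: measurable_funM => //; exact: msl cont2_source_theta tT.
- by apply: measurable_funM => //; exact: measurable_funM.
- move: thtx; apply: filterS; first exact: (ae_filter_ringOfSetsType mu).
  by move=> x e1 Ox; rewrite e1.
- apply: measurable_funM => //; exact: msl cont2_flux_theta tT.
- apply: measurable_funM => //; apply: measurable_funD.
    apply: measurable_funM; last exact: measurableT_comp mdgamma mthx.
    apply: measurable_funM => //; apply: measurableT_comp mg.
    by apply: continuous_measurable_fun; exact: alpha_continuous.
  exact: measurable_funM.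
- move: thxx; apply: filterS; first exact: (ae_filter_ringOfSetsType mu).
  by move=> x e1 Ox; rewrite e1.
Unshelve. all: by end_near. Qed.

End strong_form.

(** * The weight alpha0 on the closed domain *)

Section alpha0_facts.
Variables (R : realType) (T delta0 L : R) (alpha0 : R -> R -> R).
Hypotheses (T0 : 0 < T) (delta0_gt0 : 0 < delta0) (L0 : 0 <= L).
Hypothesis calpha0 : cont2 T 1 alpha0.
Hypothesis lip : forall p q : R * R, Qdom T p -> Qdom T q ->
  `|alpha0 p.1 p.2 - alpha0 q.1 q.2|
    <= L * Num.sqrt ((p.1 - q.1) ^+ 2 + (p.2 - q.2) ^+ 2).
Hypothesis infE : inf [set alpha0 p.1 p.2 | p in Qdom T] = delta0.

Lemma interior_approx (b t d : R) : 0 < b -> t \in `[0, b] -> 0 < d ->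
  exists s, [/\ s \in `]0, b[, s \in `[0, b] & `|t - s| < d].
Proof.
move=> b0 tb d0.
have [|s [sb ts [s0 _]]] := @ae_dense_times R b (fun=> True) b0 _ t d tb d0.
  exact: aeW.
by exists s.
Qed.

(** The infimum of a set without lower bound is 0 by convention, which the
    hypothesis [0 < delta0] excludes. *)
Lemma alpha0_ge_inf_open t x : Qdom T (t, x) -> delta0 <= alpha0 t x.
Proof.
move=> Qtx; rewrite -infE; apply: inf_lbound; last by exists (t, x).
apply: contrapT => nlb; have : inf [set alpha0 p.1 p.2 | p in Qdom T] = 0.
  by apply: inf_out => -[_].
by rewrite infE => d0; move: delta0_gt0; rewrite d0 ltxx.
Qed.

Lemma alpha0_ge t x : t \in `[0, T] -> x \in `[0, 1] -> delta0 <= alpha0 t x.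
Proof.
move=> tT x1; apply/ler_addgt0Pl => e e0.
have [d d0 H] := cont2_ucont calpha0 e0.
have [s [sT sT' ts]] := interior_approx T0 tT d0.
have [y [y1 y1' xy]] := interior_approx ltr01 x1 d0.
have := H _ _ _ _ tT sT' x1 y1' ts xy; rewrite ltr_norml => /andP[+ _].
by have := @alpha0_ge_inf_open s y (conj sT y1); lra.
Qed.

(** Lipschitz continuity is given in the open domain and extended by
    continuity. *)
Lemma alpha0_lip_time t s x : t \in `[0, T] -> s \in `[0, T] -> x \in `[0, 1] ->
  `|alpha0 t x - alpha0 s x| <= L * `|t - s|.
Proof.
move=> tT sT x1; apply/ler_addgt0Pl => e e0.
have e4 : 0 < e / 4 by rewrite divr_gt0.
have [d d0 H] := cont2_ucont calpha0 e4.
pose d' := Num.min d (e / 4 / (L + 1)).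
have d'0 : 0 < d' by rewrite lt_min d0 divr_gt0// ltr_wpDl.
have [t' [tT' tT'' tt]] := interior_approx T0 tT d'0.
have [s' [sT' sT'' ss]] := interior_approx T0 sT d'0.
have [y [y1 y1' xy]] := interior_approx ltr01 x1 d'0.
move: tt ss xy; rewrite !lt_min => /andP[tt tt'] /andP[ss ss'] /andP[xy _].
have h1 := H _ _ _ _ tT tT'' x1 y1' tt xy.
have h2 := H _ _ _ _ sT sT'' x1 y1' ss xy.
have := @lip (t', y) (s', y) (conj tT' y1) (conj sT' y1).
rewrite /= subrr expr0n addr0 sqrtr_sqr => h3.
have h4 : `|t' - s'| <= `|t - s| + (`|t - t'| + `|s - s'|).
  rewrite (_ : t' - s' = (t - s) - ((t - t') - (s - s'))); last by ring.
  by rewrite (le_trans (ler_normB _ _))// lerD2l ler_normB.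
have L1 : 0 < L + 1 by rewrite ltr_wpDl.
have h5 : L * (`|t - t'| + `|s - s'|) <= e / 4 + e / 4.
  rewrite ltr_pdivlMr// in tt'; rewrite ltr_pdivlMr// in ss'.
  have n1 := normr_ge0 (t - t'); have n2 := normr_ge0 (s - s'); nra.
have h6 := ler_wpM2l L0 h4.
rewrite (_ : _ - _ = (alpha0 t x - alpha0 t' y) - (alpha0 s x - alpha0 s' y)
   + (alpha0 t' y - alpha0 s' y)); last by ring.
rewrite (le_trans (ler_normD _ _))//.
have h7 := ler_normB (alpha0 t x - alpha0 t' y) (alpha0 s x - alpha0 s' y).
rewrite mulrDr in h6.
have -> : e = e / 4 + e / 4 + (e / 4 + e / 4) by field.
lra.
Qed.

End alpha0_facts.

Section mesh.
Variable R : realType.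

Lemma dx_gt0 K : (0 < K)%N -> 0 < dx R K.
Proof. by move=> K0; rewrite divr_gt0// ltr0n. Qed.

Lemma dt_gt0 (T : R) N : 0 < T -> (0 < N)%N -> 0 < dt T N.
Proof. by move=> T0 N0; rewrite divr_gt0// ltr0n. Qed.

Lemma node_mem K k : (0 < K)%N -> (k <= K)%N -> k%:R * dx R K \in `[0, 1].
Proof.
move=> K0 kK; rewrite in_itv/= mulr_ge0 ?ler0n ?(ltW (dx_gt0 K0))//=.
by rewrite /dx mul1r ler_pdivrMr ?ltr0n// mul1r ler_nat.
Qed.

Lemma time_mem (T : R) N j : 0 < T -> (0 < N)%N -> (j <= N)%N ->
  j%:R * dt T N \in `[0, T].
Proof.
move=> T0 N0 jN; rewrite in_itv/= mulr_ge0 ?ler0n ?(ltW (dt_gt0 T0 N0))//=.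
by rewrite /dt mulrCA ger_pMr// ler_pdivrMr ?ltr0n// mul1r ler_nat.
Qed.

End mesh.

(** * Boundedness and energy decay of the scheme *)

Section scheme.
Variables (R : realType) (T eps delta0 c kappa0 kappa nu : R).
Variable alpha0 : R -> R -> R.
Hypotheses (T0 : 0 < T) (eps0 : 0 < eps) (delta0_gt0 : 0 < delta0) (c0 : 0 < c).
Hypotheses (kappa0_gt0 : 0 < kappa0) (kappa_gt0 : 0 < kappa) (nu0 : 0 < nu).
Hypothesis alpha0_ge_delta0 : forall t x, t \in `[0, T] -> x \in `[0, 1] ->
  delta0 <= alpha0 t x.
Variables (K N : nat) (H Th : nat -> 'rV[R]_K.+3).
Hypotheses (K0 : (0 < K)%N) (N0 : (0 < N)%N).
Hypothesis sch : scheme_solution T eps delta0 c kappa0 kappa nu alpha0 N H Th.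

Let h0 : 0 < dx R K. Proof. exact: dx_gt0. Qed.
Let tau0 : 0 < dt T N. Proof. exact: dt_gt0. Qed.

Lemma scheme_even_ends j : (j <= N)%N ->
  even_ends K (entry (H j)) /\ even_ends K (entry (Th j)).
Proof.
move=> jN; have [_ bc] := sch.
have [H0 Th0] := bc j 0%N jN (or_introl erefl).
have [HK ThK] := bc j K jN (or_intror erefl).
have hn : dx R K != 0 by rewrite gt_eqF.
by split; [exact: dcentral_even_ends H0 HK|exact: dcentral_even_ends Th0 ThK].
Qed.

Lemma alpha0_node_gt0 j k : (j < N)%N -> (k <= K)%N ->
  0 < alpha0 (j.+1%:R * dt T N) (k%:R * dx R K).
Proof.
move=> jN kK; apply: lt_le_trans delta0_gt0 (alpha0_ge_delta0 _ _).
  exact: time_mem.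
exact: node_mem.
Qed.

Lemma scheme_maximum_principle xi :
  (forall k, (k <= K)%N ->
     0 <= entry (H 0%N) k%:Z <= 1 /\ `|entry (Th 0%N) k%:Z| <= xi) ->
  forall j k, (j <= N)%N -> (k <= K)%N ->
    0 <= entry (H j) k%:Z <= 1 /\ `|entry (Th j) k%:Z| <= xi.
Proof.
move=> init; elim => [|j IH] k jN kK; first exact: init.
have {}IH k' := IH k' (ltnW jN).
have [eHn eTn] := scheme_even_ends jN.
have [eqs _] := sch.
pose a (k : int) := alpha0 (j.+1%:R * dt T N) (k%:~R * dx R K).
have a0 k' : (k' <= K)%N -> 0 < a k'%:Z by move=> k'K; exact: alpha0_node_gt0.
have eqH k' (k'K : (k' <= K)%N) := (eqs j k' jN k'K).1.
have eqT k' (k'K : (k' <= K)%N) := (eqs j k' jN k'K).2.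
rewrite (H_nonneg eps0 c0 kappa_gt0 h0 tau0 K0 eHn eqH)//; last first.
  by move=> k' /IH[/andP[]].
rewrite (H_le1 eps0 c0 kappa_gt0 h0 tau0 K0 eHn eqH)//; last first.
  by move=> k' /IH[/andP[]].
split => //; rewrite ler_norml.
rewrite (Theta_ge (a := a) eps0 delta0_gt0 kappa_gt0 h0 tau0 K0 eTn a0 eqT)//; last first.
  by move=> k' /IH[_]; rewrite ler_norml => /andP[].
rewrite (Theta_le (a := a) eps0 delta0_gt0 kappa_gt0 h0 tau0 K0 eTn a0 eqT)//.
by move=> k' /IH[_]; rewrite ler_norml => /andP[].
Qed.

Lemma F1dE (V W : 'rV[R]_K.+3) : even_ends K (entry V) -> even_ends K (entry W) ->
  F1d eps delta0 c kappa0 kappa nu V W =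
  edge_energy eps delta0 c kappa0 kappa nu (dx R K) K (entry V) (entry W).
Proof.
move=> eV eW; rewrite /F1d /edge_energy !trapsum_dirichlet//; congr (_ + _ * _ + _ + _ * _).
  by apply: eq_trapsum => k _; rewrite real_normK ?num_real.
by apply: eq_trapsum => k _; rewrite /gamma_avg dminusE.
Qed.

Lemma scheme_energy_decay j : (j < N)%N ->
  let F := @F1d R eps delta0 c kappa0 kappa nu K in
  let D :=
    - trapsum K (fun k =>
        `|(entry (H j.+1) k - entry (H j) k) / dt T N| ^+ 2 * dx R K)
    - trapsum K (fun k =>
        alpha0 (j.+1%:R * dt T N) (k%:~R * dx R K) *
        `|(entry (Th j.+1) k - entry (Th j) k) / dt T N| ^+ 2 * dx R K) in
  (F (H j.+1) (Th j.+1) - F (H j) (Th j)) / dt T N <= D /\ D <= 0.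
Proof.
move=> jN /=.
have [eHo eTo] := scheme_even_ends (ltnW jN).
have [eHn eTn] := scheme_even_ends jN.
have [eqs _] := sch.
pose a (k : int) := alpha0 (j.+1%:R * dt T N) (k%:~R * dx R K).
have eqH k' (k'K : (k' <= K)%N) := (eqs j k' jN k'K).1.
have eqT k' (k'K : (k' <= K)%N) := (eqs j k' jN k'K).2.
have tn : dt T N != 0 by rewrite gt_eqF.
split.
  rewrite !F1dE// ler_pdivrMr//.
  apply: le_trans (energy_step (a := a) eps0 delta0_gt0 c0 kappa_gt0 h0 K0
    eHn eTo eTn eqH eqT) _.
  rewrite mulrBl !mulNr ![trapsum _ _ * dt T N]mulrC -!trapsumZ le_eqVlt; apply/orP; left.
  apply/eqP; congr (- _ - _); apply: eq_trapsum => k _; rewrite real_normK ?num_real//.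
    by field.
  by rewrite /a; field.
rewrite -opprD oppr_le0 addr_ge0//; apply: trapsum_ge0 => k kK.
  by rewrite mulr_ge0 ?sqr_ge0 ?ltW.
by rewrite !mulr_ge0 ?sqr_ge0 ?(ltW h0)// ltW// alpha0_node_gt0.
Qed.

End scheme.

(** * Stability: one step of the error equation *)

Section error_step.
Variables (R : realType) (eps delta0 c kappa0 kappa nu h tau C1 rho : R) (K : nat).
Hypotheses (eps0 : 0 < eps) (delta0_gt0 : 0 < delta0) (c0 : 0 < c).
Hypotheses (kappa_gt0 : 0 < kappa) (nu0 : 0 < nu).
Hypotheses (h0 : 0 < h) (tau0 : 0 < tau) (K0 : (0 < K)%N) (Kh : K%:R * h = 1).
Variables (a Hold Hnew Thold Thnew yold ynew zold znew : int -> R).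
Hypotheses (eHn : even_ends K Hnew) (eTo : even_ends K Thold) (eTn : even_ends K Thnew).
Hypotheses (eyn : even_ends K ynew) (ezo : even_ends K zold) (ezn : even_ends K znew).
Hypothesis a_ge : forall k, (k <= K)%N -> delta0 <= a k%:Z.
Hypothesis eqH : forall k, (k <= K)%N ->
  scheme_eq_H eps c kappa0 kappa h tau Hold Hnew Thold k%:Z.
Hypothesis eqTheta : forall k, (k <= K)%N ->
  scheme_eq_Theta eps delta0 kappa nu h tau (a k%:Z) Hnew Thold Thnew k%:Z.
Hypothesis HC : forall k, (k <= K)%N -> `|Hnew k%:Z| <= C1.
Hypothesis yC : forall k, (k <= K)%N -> `|ynew k%:Z| <= C1.

(** What is left when the exact values are inserted into the scheme. *)
Definition residual_eta (yold ynew zold : int -> R) (k : int) : R :=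
  (ynew k - yold k) / tau
  - (kappa0 ^+ 2 * ((dplus h ynew k - dplus h ynew (k - 1)) / h)
     - c * (ynew k - 1) - kappa * ynew k * gamma_avg eps h zold k).

Definition residual_theta (a ynew zold znew : int -> R) (k : int) : R :=
  a k * ((znew k - zold k) / tau)
  - (theta_flux eps delta0 kappa nu h ynew znew k
     - theta_flux eps delta0 kappa nu h ynew znew (k - 1)) / h.

Hypothesis r1 : forall k, (k <= K)%N -> `|residual_eta yold ynew zold k%:Z| <= rho.
Hypothesis r2 : forall k, (k <= K)%N -> `|residual_theta a ynew zold znew k%:Z| <= rho.

Let eo k := Hold k - yold k.
Let en k := Hnew k - ynew k.
Let qo k := Thold k - zold k.
Let qn k := Thnew k - znew k.

Definition sqnorm (f : int -> R) : R := trapsum K (fun k => f k ^+ 2 * h).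
Definition wsqnorm (w f : int -> R) : R := trapsum K (fun k => w k * f k ^+ 2 * h).
Definition gradsq (f : int -> R) : R := \sum_(0 <= k < K) dplus h f k%:Z ^+ 2 * h.

Lemma young_nu (M x y : R) : `|M * x * y| <= M ^+ 2 / (2 * nu ^+ 2) * x ^+ 2 + nu ^+ 2 / 2 * y ^+ 2.
Proof.
have -> : M ^+ 2 / (2 * nu ^+ 2) * x ^+ 2 = (M * x / nu) ^+ 2 / 2.
  by field; rewrite gt_eqF.
have -> : nu ^+ 2 / 2 * y ^+ 2 = (nu * y) ^+ 2 / 2 by field.
have -> : M * x * y = (M * x / nu) * (nu * y) by field; rewrite gt_eqF.
set u := M * x / nu; set v := nu * y.
have := sqr_ge0 (u - v); have := sqr_ge0 (u + v).
by move=> h1 h2; rewrite ler_norml; apply/andP; split; lra.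
Qed.

Lemma dplusB (f g : int -> R) (k : int) : dplus h (fun k => f k - g k) k = dplus h f k - dplus h g k.
Proof. by rewrite /dplus; field; rewrite gt_eqF. Qed.

Lemma even_endsB (f g : int -> R) : even_ends K f -> even_ends K g -> even_ends K (fun k => f k - g k).
Proof. by move=> [f0 fK] [g0 gK]; split; rewrite ?f0 ?g0 ?fK ?gK. Qed.

Lemma trapsum_cst : trapsum K (fun=> h) = 1.
Proof.
rewrite trapsum_edges// -[RHS]Kh (eq_bigr (fun=> h)); last by move=> k _; field.
by rewrite sumr_const_nat subn0 mulr_natl.
Qed.

Lemma gradsq_avg (f : int -> R) : even_ends K f ->
  trapsum K (fun k => (dplus h f k ^+ 2 + dplus h f (k - 1) ^+ 2) / 2 * h) = gradsq f.
Proof.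
move=> ef; have [d0 dK] := dplus_even_ends h ef.
rewrite (@trapsum_average _ K (fun k => dplus h f k ^+ 2) (fun=> h))//.
- by apply: eq_bigr => k _; congr (_ * _); field.
- by rewrite d0 sqrrN.
- by rewrite dK sqrrN.
Qed.

(** The error equation is tested with the new error.  Since [gamma] is
    1-Lipschitz, the explicit coupling is bounded by [kappa * C1] times the error
    of H times the old gradient of the error of Theta, and is split by the Young
    inequality so that this gradient has the coefficient [nu ^+ 2 / 2]. *)
Lemma error_eta :
  (sqnorm en - sqnorm eo) / (2 * tau) <=
  ((kappa * C1) ^+ 2 / (2 * nu ^+ 2) + 1 / 2) * sqnorm en + nu ^+ 2 / 2 * gradsq qo
  + rho ^+ 2 / 2.
Proof.
have hn : h != 0 by rewrite gt_eqF.
have tn : tau != 0 by rewrite gt_eqF.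
have een := even_endsB eHn eyn; have eqo := even_endsB eTo ezo.
have [De0 DeK] := dplus_even_ends h een.
set M := kappa * C1.
pose lhs (k : int) := (en k ^+ 2 * h - eo k ^+ 2 * h) / (2 * tau).
pose rhs (k : int) :=
  kappa0 ^+ 2 * ((dplus h en k - dplus h en (k - 1)) * en k)
  + (M ^+ 2 / (2 * nu ^+ 2) + 1 / 2) * (en k ^+ 2 * h)
  + nu ^+ 2 / 2 * ((dplus h qo k ^+ 2 + dplus h qo (k - 1) ^+ 2) / 2 * h)
  + rho ^+ 2 / 2 * h.
have key k : (k <= K)%N -> lhs k%:Z <= rhs k%:Z.
  rewrite /lhs /rhs.
  move=> kK; have /(scheme_eq_HE _ _ _ _ _ h0) E := eqH kK.
  have := r1 kK; rewrite /residual_eta; set r := (X in `|X|) => rk.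
  set Go := gamma_avg eps h Thold k%:Z in E.
  set Gz := gamma_avg eps h zold k%:Z in r rk.
  have Go0 : 0 < Go by exact: gamma_avg_gt0.
  have Gd : `|Go - Gz| <= (`|dplus h qo k%:Z| + `|dplus h qo (k%:Z - 1)|) / 2.
    rewrite /Go /Gz /gamma_avg -mulrBl normrM (ger0_norm (x := 2^-1))//.
    rewrite ler_pM2r// opprD addrACA (le_trans (ler_normD _ _))//.
    by rewrite /qo !dplusB lerD// gamma_lipschitz.
  have errE : (en k%:Z - eo k%:Z) / tau =
     kappa0 ^+ 2 * ((dplus h en k%:Z - dplus h en (k%:Z - 1)) / h) - c * en k%:Z
     - kappa * (en k%:Z * Go + ynew k%:Z * (Go - Gz)) - r.
    transitivity ((Hnew k%:Z - Hold k%:Z) / tau - (ynew k%:Z - yold k%:Z) / tau).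
      by rewrite /en /eo; field.
    by rewrite E /r /en !dplusB; field; rewrite hn tn.
  have sq : (en k%:Z ^+ 2 * h - eo k%:Z ^+ 2 * h) / (2 * tau) <=
      (en k%:Z - eo k%:Z) / tau * (en k%:Z * h).
    rewrite -subr_ge0 (_ : _ - _ = (en k%:Z - eo k%:Z) ^+ 2 * (h / (2 * tau))); last first.
      by field.
    by rewrite mulr_ge0 ?sqr_ge0// ltW// divr_gt0// mulr_gt0.
  apply: le_trans sq _; rewrite errE.
  have t1 : - (kappa * (ynew k%:Z * (Go - Gz)) * en k%:Z) <=
     M ^+ 2 / (2 * nu ^+ 2) * en k%:Z ^+ 2
     + nu ^+ 2 / 2 * ((dplus h qo k%:Z ^+ 2 + dplus h qo (k%:Z - 1) ^+ 2) / 2).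
    rewrite (le_trans (ler_norm _))// normrN !normrM (gtr0_norm kappa_gt0).
    have y1 := le_trans (ler_norm _) (young_nu M `|en k%:Z| `|dplus h qo k%:Z|).
    have y2 := le_trans (ler_norm _) (young_nu M `|en k%:Z| `|dplus h qo (k%:Z - 1)|).
    rewrite !real_normK ?num_real// in y1 y2.
    have M0 : 0 <= M by rewrite mulr_ge0 ?(ltW kappa_gt0)// (le_trans _ (yC kK)).
    have : kappa * (`|ynew k%:Z| * `|Go - Gz|) * `|en k%:Z| <=
        M * `|en k%:Z| * ((`|dplus h qo k%:Z| + `|dplus h qo (k%:Z - 1)|) / 2).
      rewrite mulrA -/M mulrAC ler_pM ?mulr_ge0 ?(ltW kappa_gt0)//.
      by rewrite ler_wpM2r// ler_wpM2l ?(ltW kappa_gt0)// yC.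
    lra.
  have t2 : - (r * en k%:Z) <= rho ^+ 2 / 2 + en k%:Z ^+ 2 / 2.
    have : r ^+ 2 <= rho ^+ 2.
      by rewrite -(real_normK (num_real r)) ler_sqr ?nnegrE// (le_trans _ rk).
    have := sqr_ge0 (r + en k%:Z); lra.
  have t3 : 0 <= c * en k%:Z ^+ 2 by rewrite mulr_ge0 ?sqr_ge0 ?ltW.
  have t4 : 0 <= kappa * (en k%:Z ^+ 2 * Go).
    by rewrite mulr_ge0 ?(ltW kappa_gt0)// mulr_ge0 ?sqr_ge0// ltW.
  rewrite [X in X <= _](_ : _ =
    kappa0 ^+ 2 * ((dplus h en k%:Z - dplus h en (k%:Z - 1)) * en k%:Z)
    + (- (c * en k%:Z ^+ 2) - kappa * (en k%:Z ^+ 2 * Go)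
       - (kappa * (ynew k%:Z * (Go - Gz)) * en k%:Z) - r * en k%:Z) * h); last first.
    by field.
  rewrite -!addrA lerD2l.
  rewrite [X in _ <= X](_ : _ = ((M ^+ 2 / (2 * nu ^+ 2) * en k%:Z ^+ 2
     + nu ^+ 2 / 2 * ((dplus h qo k%:Z ^+ 2 + dplus h qo (k%:Z - 1) ^+ 2) / 2))
     + (rho ^+ 2 / 2 + en k%:Z ^+ 2 / 2)) * h); last by ring.
  by rewrite ler_wpM2r ?(ltW h0)//; lra.
have := ler_trapsum key; rewrite /lhs /rhs.
rewrite (@eq_trapsum _ K _ (fun k => (2 * tau)^-1 * (en k ^+ 2 * h - eo k ^+ 2 * h))); last first.
  by move=> k _; rewrite mulrC.
rewrite !trapsumD !trapsumZ trapsumB gradsq_avg// trapsum_cst -/(sqnorm _) -/(sqnorm _).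
rewrite (trapsum_by_parts _ K0 De0 DeK) => S.
have P : 0 <= kappa0 ^+ 2 *
    (\sum_(0 <= k < K) dplus h en k%:Z * (en (k%:Z + 1) - en k%:Z)).
  rewrite mulr_ge0 ?sqr_ge0//; apply: sumr_ge0 => k _.
  have -> : en (k%:Z + 1) - en k%:Z = dplus h en k%:Z * h by rewrite /dplus; field.
  by rewrite mulrA -expr2 mulr_ge0 ?sqr_ge0 ?ltW.
rewrite mulrC; lra.
Qed.


Lemma alpha_lipschitz x y : `|x| <= C1 -> `|y| <= C1 ->
  `|alpha delta0 x - alpha delta0 y| <= C1 * `|x - y|.
Proof.
move=> xC yC'; rewrite /alpha (_ : _ - _ = (x + y) / 2 * (x - y)); last by field.
rewrite normrM ler_wpM2r// normrM (ger0_norm (x := 2^-1))// ler_pdivrMr//.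
by have := ler_normD x y; lra.
Qed.

(** The flux difference is split as [A (dgamma Theta - dgamma theta)] plus
    [(A - B) dgamma theta].  The first part is dissipative by monotonicity and the
    second one takes half of the diffusion. *)
Lemma error_theta :
  (wsqnorm a qn - wsqnorm a qo) / (2 * tau) <=
  (kappa * C1) ^+ 2 / (2 * nu ^+ 2) * sqnorm en - nu ^+ 2 / 2 * gradsq qn
  + rho ^+ 2 / 2 + sqnorm qn / 2.
Proof.
have hn : h != 0 by rewrite gt_eqF.
have tn : tau != 0 by rewrite gt_eqF.
set M := kappa * C1.
have C10 : 0 <= C1 by rewrite (le_trans _ (yC (leq0n K))).
have M0 : 0 <= M by rewrite mulr_ge0 ?(ltW kappa_gt0).
pose flux := theta_flux eps delta0 kappa nu h.
pose dPhi (k : int) := flux Hnew Thnew k - flux ynew znew k.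
have [P0 PK] : dPhi (-1) = - dPhi 0 /\ dPhi K%:Z = - dPhi (K%:Z - 1).
  have [n0 nK] := theta_flux_even_ends eps delta0 kappa nu h eHn eTn.
  have [y0 yK] := theta_flux_even_ends eps delta0 kappa nu h eyn ezn.
  by rewrite /dPhi /flux n0 nK y0 yK; split; ring.
pose lhs (k : int) := (2 * tau)^-1 * (a k * qn k ^+ 2 * h - a k * qo k ^+ 2 * h).
pose rhs (k : int) := (dPhi k - dPhi (k - 1)) * qn k + rho ^+ 2 / 2 * h
  + 1 / 2 * (qn k ^+ 2 * h).
have key k : (k <= K)%N -> lhs k%:Z <= rhs k%:Z.
  rewrite /lhs /rhs => kK; have /(scheme_eq_ThetaE _ _ _ _ _ h0) E := eqTheta kK.
  have := r2 kK; rewrite /residual_theta; set r := (X in `|X|) => rk.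
  have errE : a k%:Z * ((qn k%:Z - qo k%:Z) / tau) =
      (dPhi k%:Z - dPhi (k%:Z - 1)) / h - r.
    transitivity (a k%:Z * ((Thnew k%:Z - Thold k%:Z) / tau)
      - a k%:Z * ((znew k%:Z - zold k%:Z) / tau)); first by rewrite /qn /qo; field.
    by rewrite E /r /dPhi /flux; field; rewrite hn tn.
  have sq : (2 * tau)^-1 * (a k%:Z * qn k%:Z ^+ 2 * h - a k%:Z * qo k%:Z ^+ 2 * h) <=
      a k%:Z * ((qn k%:Z - qo k%:Z) / tau) * (qn k%:Z * h).
    rewrite -subr_ge0 (_ : _ - _ =
      a k%:Z * (qn k%:Z - qo k%:Z) ^+ 2 * (h / (2 * tau))); last by field.
    rewrite mulr_ge0//; last by rewrite ltW// divr_gt0// mulr_gt0.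
    by rewrite mulr_ge0 ?sqr_ge0// (le_trans (ltW delta0_gt0) (a_ge kK)).
  apply: le_trans sq _; rewrite errE.
  have t2 : - (r * qn k%:Z) <= rho ^+ 2 / 2 + qn k%:Z ^+ 2 / 2.
    have : r ^+ 2 <= rho ^+ 2.
      by rewrite -(real_normK (num_real r)) ler_sqr ?nnegrE// (le_trans _ rk).
    have := sqr_ge0 (r + qn k%:Z); lra.
  rewrite [X in X <= _](_ : _ = (dPhi k%:Z - dPhi (k%:Z - 1)) * qn k%:Z
    + - (r * qn k%:Z) * h); last by field.
  have := ler_wpM2r (ltW h0) t2; lra.
have := ler_trapsum key; rewrite /lhs /rhs.
rewrite !trapsumD !trapsumZ trapsumB trapsum_cst -/(sqnorm _).
rewrite -/(wsqnorm a qn) -/(wsqnorm a qo) (trapsum_by_parts _ K0 P0 PK) => S.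
(* on every edge: monotone part, coefficient error and diffusion *)
have edge : M ^+ 2 / (2 * nu ^+ 2) * sqnorm en - nu ^+ 2 / 2 * gradsq qn >=
    - \sum_(0 <= k < K) dPhi k%:Z * (qn (k%:Z + 1) - qn k%:Z).
  rewrite /sqnorm trapsum_edges// /gradsq !mulr_sumr -sumrB -sumrN.
  apply: ler_sum_nat => k /andP[_ kK].
  have -> : qn (k%:Z + 1) - qn k%:Z = dplus h qn k%:Z * h by rewrite /dplus; field.
  have eD : dplus h qn k%:Z = dplus h Thnew k%:Z - dplus h znew k%:Z.
    exact: dplusB.
  rewrite -int_add1 /dPhi /flux /theta_flux.
  have a1 := alpha_lipschitz (HC (ltnW kK)) (yC (ltnW kK)).
  have a2 := alpha_lipschitz (HC kK) (yC kK).
  rewrite -int_add1 -/(en _) in a2; rewrite -/(en _) in a1.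
  set A := (alpha delta0 (Hnew k%:Z) + alpha delta0 (Hnew (k%:Z + 1))) / 2.
  set B := (alpha delta0 (ynew k%:Z) + alpha delta0 (ynew (k%:Z + 1))) / 2.
  set D := dplus h qn k%:Z in eD *.
  have A0 : 0 <= A by rewrite divr_ge0// addr_ge0// ltW// alpha_gt0.
  have AB : `|A - B| <= C1 * ((`|en k%:Z| + `|en (k%:Z + 1)|) / 2).
    rewrite /A /B -mulrBl normrM (ger0_norm (x := 2^-1))// mulrA ler_pM2r//.
    rewrite opprD addrACA mulrDr (le_trans (ler_normD _ _))//.
    exact: lerD.
  have mono := dgamma_mono eps0 (dplus h Thnew k%:Z) (dplus h znew k%:Z).
  rewrite -eD in mono.
  set g1 := dgamma eps (dplus h Thnew k%:Z) in mono *.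
  set g2 := dgamma eps (dplus h znew k%:Z) in mono *.
  have g2le : `|g2| <= 1 by exact: norm_dgamma_le1.
  have cross : - (kappa * (A - B) * g2 * D) <=
      M ^+ 2 / (2 * nu ^+ 2) * ((en k%:Z ^+ 2 + en (k%:Z + 1) ^+ 2) / 2)
      + nu ^+ 2 / 2 * D ^+ 2.
    rewrite (le_trans (ler_norm _))// normrN 3!normrM (gtr0_norm kappa_gt0).
    have y1 := le_trans (ler_norm _) (young_nu M `|en k%:Z| `|D|).
    have y2 := le_trans (ler_norm _) (young_nu M `|en (k%:Z + 1)| `|D|).
    rewrite !real_normK ?num_real// in y1 y2.
    have : kappa * `|A - B| * `|g2| * `|D| <=
        kappa * (C1 * ((`|en k%:Z| + `|en (k%:Z + 1)|) / 2)) * 1 * `|D|.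
      rewrite ler_wpM2r// ler_pM ?mulr_ge0 ?(ltW kappa_gt0)//.
      by rewrite ler_wpM2l ?(ltW kappa_gt0).
    have -> : kappa * (C1 * ((`|en k%:Z| + `|en (k%:Z + 1)|) / 2)) * 1 * `|D| =
      M * `|en k%:Z| * `|D| / 2 + M * `|en (k%:Z + 1)| * `|D| / 2.
      by rewrite /M; field.
    move=> le; set w := M ^+ 2 / _ in y1 y2 *; lra.
  have mono' : 0 <= kappa * A * ((g1 - g2) * D).
    by rewrite mulr_ge0// mulr_ge0// ltW.
  rewrite [X in X <= _](_ : _ = (- (kappa * A * ((g1 - g2) * D))
     - kappa * (A - B) * g2 * D - nu ^+ 2 * D ^+ 2) * h); last first.
    by rewrite eD; ring.
  rewrite [X in _ <= X](_ : _ = (M ^+ 2 / (2 * nu ^+ 2) *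
     ((en k%:Z ^+ 2 + en (k%:Z + 1) ^+ 2) / 2) - nu ^+ 2 / 2 * D ^+ 2) * h); last first.
    by field; rewrite gt_eqF.
  by rewrite ler_wpM2r ?(ltW h0)//; lra.
rewrite mulrC; lra.
Qed.


(** The old gradient that [error_eta] leaves on the right is the reason for
    the last term: it is paid by the half of the diffusion of the previous step
    that [error_theta] has not used. *)
Definition error_energy (w e q : int -> R) : R :=
  sqnorm e / 2 + wsqnorm w q / 2 + tau * (nu ^+ 2 / 2 * gradsq q).

Definition growth_rate (L : R) : R :=
  2 * ((kappa * C1) ^+ 2 / nu ^+ 2) + 1 + (L + 1) / delta0.

Lemma sqnorm_ge0 f : 0 <= sqnorm f.
Proof. by apply: trapsum_ge0 => k _; rewrite mulr_ge0 ?sqr_ge0 ?ltW. Qed.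

Lemma gradsq_ge0 f : 0 <= gradsq f.
Proof. by apply: sumr_ge0 => k _; rewrite mulr_ge0 ?sqr_ge0 ?ltW. Qed.

Lemma wsqnorm_ge w f : (forall k, (k <= K)%N -> delta0 <= w k%:Z) ->
  delta0 * sqnorm f <= wsqnorm w f.
Proof.
move=> w_ge; rewrite -trapsumZ; apply: ler_trapsum => k kK.
by rewrite mulrA ler_wpM2r ?(ltW h0)// ler_wpM2r ?sqr_ge0// w_ge.
Qed.

Lemma wsqnorm_ge0 w f : (forall k, (k <= K)%N -> delta0 <= w k%:Z) -> 0 <= wsqnorm w f.
Proof.
by move=> /(wsqnorm_ge f); apply: le_trans; rewrite mulr_ge0 ?sqnorm_ge0 ?ltW.
Qed.

Lemma error_energy_ge0 w e q : (forall k, (k <= K)%N -> delta0 <= w k%:Z) ->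
  0 <= error_energy w e q.
Proof.
move=> w_ge; rewrite /error_energy addr_ge0//.
  by rewrite addr_ge0// divr_ge0 ?sqnorm_ge0 ?wsqnorm_ge0.
by rewrite mulr_ge0 ?(ltW tau0)// mulr_ge0 ?gradsq_ge0// divr_ge0 ?sqr_ge0.
Qed.

(** The weight is changed from the new to the old time at the price of
    [L * tau / delta0], by the Lipschitz continuity of alpha0 in time. *)
Lemma error_energy_step (L : R) (aold : int -> R) : 0 <= L ->
  (forall k, (k <= K)%N -> delta0 <= aold k%:Z) ->
  (forall k, (k <= K)%N -> a k%:Z <= aold k%:Z + L * tau) ->
  error_energy a en qn <= error_energy aold eo qo
    + tau * growth_rate L * (error_energy aold eo qo + error_energy a en qn)
    + tau * rho ^+ 2.
Proof.
move=> L0 ao_ge a_le.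
have m0 : 0 <= (kappa * C1) ^+ 2 / nu ^+ 2 by rewrite divr_ge0 ?sqr_ge0.
have := error_theta; have := error_eta.
rewrite !ler_pdivrMr ?mulr_gt0//.
rewrite (_ : (kappa * C1) ^+ 2 / (2 * nu ^+ 2) = (kappa * C1) ^+ 2 / nu ^+ 2 / 2); last first.
  by field; rewrite gt_eqF.
rewrite /growth_rate; set m := _ / nu ^+ 2 in m0 *.
have E0 := error_energy_ge0 eo qo ao_ge; have E1 := error_energy_ge0 en qn a_ge.
have Q : sqnorm qn <= wsqnorm a qn / delta0.
  by rewrite ler_pdivlMr// mulrC wsqnorm_ge.
have Yo : wsqnorm a qo <= wsqnorm aold qo + tau * (L / delta0 * wsqnorm aold qo).
  rewrite -!trapsumZ -trapsumD; apply: ler_trapsum => k kK.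
  rewrite (_ : _ + _ = (aold k%:Z + L * tau * (aold k%:Z / delta0)) * qo k%:Z ^+ 2 * h); last by ring.
  rewrite ler_wpM2r ?(ltW h0)// ler_wpM2r ?sqr_ge0// (le_trans (a_le _ kK))// lerD2l.
  by rewrite ler_peMr ?mulr_ge0 ?(ltW tau0)// ler_pdivlMr// mul1r ao_ge.
have X0 := sqnorm_ge0 eo; have X1 := sqnorm_ge0 en.
have Y0 := wsqnorm_ge0 qo ao_ge; have Y1 := wsqnorm_ge0 qn a_ge.
have Z0 := gradsq_ge0 qo; have Z1 := gradsq_ge0 qn.
have d1 : 0 <= delta0^-1 by rewrite invr_ge0 ltW.
have n2 : 0 <= nu ^+ 2 / 2 by rewrite divr_ge0 ?sqr_ge0.
rewrite /error_energy in E0 E1 *.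
set X := sqnorm eo in X0 E0 *; set X' := sqnorm en in X1 E1 *.
set Y := wsqnorm aold qo in Y0 E0 Yo *; set Y' := wsqnorm a qn in Y1 E1 Q *.
set n := nu ^+ 2 / 2 in n2 E0 E1 *.
set Zo := gradsq qo in Z0 E0 *; set Z' := gradsq qn in Z1 E1 *.
set Yt := wsqnorm a qo in Yo *; set Qn := sqnorm qn in Q *.
set d := delta0^-1 in d1 Q Yo *.
move=> He Ht.
pose Eo := X / 2 + Y / 2 + tau * (n * Zo).
pose En := X' / 2 + Y' / 2 + tau * (n * Z').
rewrite -/Eo in E0 *; rewrite -/En in E1 *.
have t0 := ltW tau0.
have tnZ0 : 0 <= tau * (n * Zo) by rewrite mulr_ge0// mulr_ge0.
have tnZ1 : 0 <= tau * (n * Z') by rewrite mulr_ge0// mulr_ge0.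
have ineq : En <= Eo + tau * ((m + 1 / 2) * X' + d * Y' / 2 + L * d * Y / 2)
    + tau * rho ^+ 2.
  have := ler_wpM2l t0 Q; rewrite /En /Eo; lra.
apply: le_trans ineq _; rewrite lerD2r lerD2l -[leRHS]mulrA ler_wpM2l//.
have XE : X' <= 2 * En by rewrite /En; lra.
have YE : Y' <= 2 * En by rewrite /En; lra.
have YE0 : Y <= 2 * Eo by rewrite /Eo; lra.
have i1 := ler_wpM2l m0 XE; have i2 := ler_wpM2l d1 YE.
have i3 := ler_wpM2l (mulr_ge0 L0 d1) YE0.
have := mulr_ge0 m0 E0; have := mulr_ge0 d1 E0.
have := mulr_ge0 (mulr_ge0 L0 d1) E1.
lra.
Qed.

End error_step.

Section gronwall.
Variable R : realType.

(** For [x <= 1 / 2] one has [(1 + x) / (1 - x) <= 1 + 4 * x <= expR (4 * x)]. *)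
Lemma discrete_gronwall (E : nat -> R) (N : nat) (x s : R) :
  0 <= x -> x <= 1 / 2 -> 0 <= s -> E 0%N = 0 ->
  (forall j, (j <= N)%N -> 0 <= E j) ->
  (forall j, (j < N)%N -> E j.+1 <= E j + x * (E j + E j.+1) + s) ->
  forall j, (j <= N)%N -> E j <= 2 * s * j%:R * expR (4 * x * j%:R).
Proof.
move=> x0 x1 s0 E0 Ege Est; elim => [|j IH] jN; first by rewrite E0 mulr0 mul0r.
have {}IH := IH (ltnW jN).
have e0 := Ege _ (ltnW jN); have e1 := Ege _ jN.
have step : E j.+1 <= (1 + 4 * x) * E j + 2 * s.
  have := Est _ jN; set u := E j in e0 *; set v := E j.+1 in e1 *.
  move=> H; have x2 : 0 <= 1 - 2 * x by lra.
  have := mulr_ge0 x2 (mulr_ge0 x0 e0).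
  have := mulr_ge0 x2 s0.
  have H' : (1 - x) * v <= (1 + x) * u + s by lra.
  have x3 : 0 < 1 - x by lra.
  move=> h1 h2; rewrite -(ler_pM2l x3); apply: le_trans H' _; lra.
have ex : 1 + 4 * x <= expR (4 * x) by rewrite expR_ge1Dx.
have E1 : 1 <= expR (4 * x * j.+1%:R).
  by rewrite -[leLHS]expR0 ler_expR mulr_ge0// mulr_ge0.
apply: (le_trans step).
rewrite (_ : 2 * s * j.+1%:R * expR (4 * x * j.+1%:R) =
   expR (4 * x) * (2 * s * j%:R * expR (4 * x * j%:R))
   + 2 * s * expR (4 * x * j.+1%:R)).
  apply: lerD; first by rewrite ler_pM// addr_ge0// mulr_ge0.
  by rewrite ler_peMr// mulr_ge0.
have -> : expR (4 * x * j.+1%:R) = expR (4 * x) * expR (4 * x * j%:R).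
  by rewrite -expRD; congr expR; rewrite -natr1; ring.
by rewrite -natr1; ring.
Qed.

End gronwall.

(** * Consistency *)

Section nodes.
Variable R : realType.
Implicit Types (f : R -> R -> R).

Definition node_fn K f t (k : int) : R := even_ext f t (k%:~R * dx R K).

Lemma mesh_length K : (0 < K)%N -> K%:R * dx R K = 1 :> R.
Proof. by move=> K0; rewrite /dx mulrCA mulfV ?mulr1// pnatr_eq0 -lt0n. Qed.

Lemma node_fnE K f t k : (0 < K)%N -> (k <= K)%N ->
  node_fn K f t k%:Z = f t (k%:R * dx R K).
Proof.
move=> K0 kK; rewrite /node_fn /even_ext.
have := node_mem R K0 kK; rewrite in_itv/= => /andP[x0 x1].
by rewrite ltNge x0/= x1.
Qed.

Lemma node_fn_even_ends K f t : (0 < K)%N -> even_ends K (node_fn K f t).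
Proof.
move=> K0; have h0 := dx_gt0 R K0; split.
  rewrite (node_fnE _ _ K0 K0) /node_fn /even_ext mulN1r oppr_lt0 h0 opprK mul1r.
  by [].
case: K K0 h0 => // n K0 h0; rewrite intS_sub1 (node_fnE _ _ K0 (leqnSn n)).
have E : (n.+1%:Z + 1)%:~R * dx R n.+1 = 1 + dx R n.+1.
  by rewrite rmorphD /= mulrDl mul1r (mesh_length K0).
rewrite /node_fn /even_ext E ltNge addr_ge0 ?(ltW h0)//= gerDl leNgt h0 /=.
congr (f t _); have := mesh_length K0; rewrite -natr1 mulrDl mul1r; lra.
Qed.

Lemma mid_itv K k : (0 < K)%N -> (k < K)%N ->
  let m := k%:R * dx R K + dx R K / 2 in
  [/\ m - dx R K / 2 = k%:R * dx R K, m + dx R K / 2 = k.+1%:R * dx R K,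
      m \in `[0, 1] & 0 <= m - dx R K / 2 /\ m + dx R K / 2 <= 1].
Proof.
move=> K0 kK m; have h0 := dx_gt0 R K0.
have e1 : m - dx R K / 2 = k%:R * dx R K by rewrite /m addrK.
have e2 : m + dx R K / 2 = k.+1%:R * dx R K by rewrite /m -natr1; field.
have := node_mem R K0 (ltnW kK); have := node_mem R K0 kK.
rewrite -e1 -e2 !in_itv/= => /andP[_ b1] /andP[b2 _]; split => //.
by apply/andP; split; lra.
Qed.

End nodes.

Section consistency_tools.
Variables (R : realType) (T : R).
Hypothesis T0 : 0 < T.
Implicit Types (f fx : R -> R -> R).

(** At an inner node both half steps are expanded from the node.  At an end
    node the odd reflection doubles one half step, and B vanishes there, which has
    the same effect; hence the same bound at all nodes. *)
Lemma flux_consistency A B : flux_relation T A B ->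
  forall e, 0 < e -> exists2 d, 0 < d & forall K t (Phi : int -> R) e',
    (0 < K)%N -> dx R K < d -> t \in `[0, T] ->
    Phi (-1) = - Phi 0 -> Phi K%:Z = - Phi (K%:Z - 1) ->
    (forall k, (k < K)%N ->
       `|Phi k%:Z - B t (k%:R * dx R K + dx R K / 2)| <= e' * dx R K) ->
    forall k, (k <= K)%N ->
      `|(Phi k%:Z - Phi (k%:Z - 1)) / dx R K - A t (k%:R * dx R K)| <= e + 2 * e'.
Proof.
move=> [Bends FR] e e0; have [d d0 H] := FR e e0; exists d => //.
move=> K t Phi e' K0 hd tT P0 PK PhiB k kK.
have h0 := dx_gt0 R K0; have hn : dx R K != 0 by rewrite gt_eqF.
have [Bt0 Bt1] := Bends t tT.
set h := dx R K in hd PhiB h0 hn *.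
have h20 : 0 < h / 2 by rewrite divr_gt0.
have absh2 : `|h / 2| = h / 2 by rewrite gtr0_norm.
have xk := node_mem R K0 kK; rewrite -/h in xk.
set x := k%:R * h in xk *.
have right : (k < K)%N -> `|B t (x + h / 2) - B t x - h / 2 * A t x| <= e * (h / 2).
  move=> kK'; have [_ _ m01 _] := mid_itv R K0 kK'; rewrite -/h -/x in m01.
  have := H t x (x + h / 2) tT xk m01.
  rewrite distrC (_ : x + h / 2 - x = h / 2); last by ring.
  by rewrite absh2; apply; lra.
have left : (0 < k)%N -> `|B t (x - h / 2) - B t x + h / 2 * A t x| <= e * (h / 2).
  move=> k0; have kK' : (k.-1 < K)%N by rewrite prednK.
  have [_ e2 m01 _] := mid_itv R K0 kK'; rewrite -/h in e2 m01.
  have xm : x - h / 2 = k.-1%:R * h + h / 2.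
    by rewrite /x -{1}(prednK k0) -natr1; field.
  rewrite -xm in m01.
  have := H t x (x - h / 2) tT xk m01.
  rewrite (_ : x - (x - h / 2) = h / 2); last by ring.
  rewrite (_ : x - h / 2 - x = - (h / 2)); last by ring.
  by rewrite normrN absh2 mulNr opprK; apply; lra.
suff : `|Phi k%:Z - Phi (k%:Z - 1) - h * A t x| <= (e + 2 * e') * h.
  move=> le; rewrite (_ : _ - _ = (Phi k%:Z - Phi (k%:Z - 1) - h * A t x) / h); last by field.
  by rewrite normrM normfV (gtr0_norm h0) ler_pdivrMr.
have Pr : (k < K)%N -> `|Phi k%:Z - B t (x + h / 2)| <= e' * h by exact: PhiB.
have Pl : (0 < k)%N -> `|Phi (k%:Z - 1) - B t (x - h / 2)| <= e' * h.
  move=> k0; have kK' : (k.-1 < K)%N by rewrite prednK.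
  have := PhiB _ kK'; have xm : x - h / 2 = k.-1%:R * h + h / 2.
    by rewrite /x -{1}(prednK k0) -natr1; field.
  by rewrite -xm -{2}(prednK k0) intS_sub1.
have [k0|k0] := posnP k.
  have x0 : x = 0 by rewrite /x k0 mul0r.
  have kK' : (k < K)%N by rewrite k0.
  have := right kK'; have := Pr kK'; rewrite k0 sub0r P0 x0 Bt0.
  rewrite !ler_norml => /andP[? ?] /andP[? ?]; apply/andP; split; lra.
have [kK'|Kk] := ltnP k K.
  have := right kK'; have := Pr kK'; have := left k0; have := Pl k0.
  rewrite !ler_norml => /andP[? ?] /andP[? ?] /andP[? ?] /andP[? ?].
  by apply/andP; split; lra.
have kE : k = K by apply/eqP; rewrite eqn_leq kK.
have x1 : x = 1 by rewrite /x kE /h mesh_length.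
have := left k0; have := Pl k0; rewrite kE PK x1 Bt1.
rewrite !ler_norml => /andP[? ?] /andP[? ?]; apply/andP; split; lra.
Qed.

(** The difference quotient over an edge is central at the midpoint of the
    edge, so its error is of order o(dx); flux differences divided by dx need this. *)
Lemma quotient_mid f fx fxx : ucont T 1 f -> ucont T 1 fx -> ucont T 1 fxx ->
  dense_times T (fun s => forall x : R, x \in `]0, 1[ ->
    is_derive x 1 (f s) (fx s x) /\ is_derive x 1 (fx s) (fxx s x)) ->
  forall e, 0 < e -> exists2 d, 0 < d & forall K t k, (0 < K)%N -> dx R K < d ->
    t \in `[0, T] -> (k < K)%N ->
    `|dplus (dx R K) (node_fn K f t) k%:Z - fx t (k%:R * dx R K + dx R K / 2)|
      <= e * dx R K.
Proof.
move=> cf cfx cfxx dense e e0.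
have [d d0 H] := central_difference T0 ltr01 cf cfx cfxx dense e0.
exists d => // K t k K0 hd tT kK; have h0 := dx_gt0 R K0.
have [e1 e2 m01 [m0 m1]] := mid_itv R K0 kK.
set h := dx R K in hd h0 e1 e2 m01 m0 m1 *; set m := k%:R * h + h / 2 in e1 e2 m01 m0 m1 *.
have hs : h / 2 < d by lra.
have h20 : 0 <= h / 2 by lra.
have := H t m (h / 2) tT h20 hs m0 m1; rewrite e1 e2 => le.
rewrite /dplus int_add1 !node_fnE// 1?ltnW// -/h.
rewrite (_ : _ - _ = (f t (k.+1%:R * h) - f t (k%:R * h) - 2 * (h / 2) * fx t m) / h);
  last by field; rewrite gt_eqF.
rewrite normrM normfV (gtr0_norm h0) ler_pdivrMr// (le_trans le)//.
have := mulr_ge0 (ltW e0) (mulr_ge0 (ltW h0) (ltW h0)); lra.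
Qed.

Lemma average_mid f fx : ucont T 1 f -> ucont T 1 fx ->
  dense_times T (fun s => forall x : R, x \in `]0, 1[ -> is_derive x 1 (f s) (fx s x)) ->
  forall e, 0 < e -> exists2 d, 0 < d & forall K t k, (0 < K)%N -> dx R K < d ->
    t \in `[0, T] -> (k < K)%N ->
    `|(f t (k%:R * dx R K) + f t (k.+1%:R * dx R K)) / 2
      - f t (k%:R * dx R K + dx R K / 2)| <= e * dx R K.
Proof.
move=> cf cfx dense e e0.
have [d d0 H] := first_order T0 ltr01 cf cfx dense e0.
exists d => // K t k K0 hd tT kK; have h0 := dx_gt0 R K0.
have [e1 e2 m01 [m0 m1]] := mid_itv R K0 kK.
have n0 := node_mem R K0 (ltnW kK); have n1 := node_mem R K0 kK.
set h := dx R K in hd h0 e1 e2 m01 m0 m1 n0 n1 *.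
set m := k%:R * h + h / 2 in e1 e2 m01 m0 m1 *.
rewrite -e1 -e2 in n0 n1 *.
have absh2 : `|h / 2| = h / 2 by rewrite gtr0_norm// divr_gt0.
have := H t m _ tT m01 n0; have := H t m _ tT m01 n1.
have -> : m - (m - h / 2) = h / 2 by ring.
have -> : m - h / 2 - m = - (h / 2) by ring.
have -> : m - (m + h / 2) = - (h / 2) by ring.
have -> : m + h / 2 - m = h / 2 by ring.
rewrite !normrN !absh2.
have hs : h / 2 < d by lra.
move=> /(_ hs) + /(_ hs); rewrite !ler_norml => /andP[? ?] /andP[? ?].
have := mulr_gt0 e0 h0; move=> ?; apply/andP; split; lra.
Qed.

(** At a ghost edge the quotient is the opposite of the one over the
    reflected edge, hence the disjunctions; [gamma] is even and does not see the
    sign. *)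
Lemma quotient_node f fx : ucont T 1 f -> ucont T 1 fx ->
  dense_times T (fun s => forall x : R, x \in `]0, 1[ -> is_derive x 1 (f s) (fx s x)) ->
  forall e, 0 < e -> exists2 d, 0 < d & forall K t k, (0 < K)%N -> dx R K < d ->
    t \in `[0, T] -> (k <= K)%N ->
    (`|dplus (dx R K) (node_fn K f t) k%:Z - fx t (k%:R * dx R K)| <= e \/
     `|- dplus (dx R K) (node_fn K f t) k%:Z - fx t (k%:R * dx R K)| <= e) /\
    (`|dplus (dx R K) (node_fn K f t) (k%:Z - 1) - fx t (k%:R * dx R K)| <= e \/
     `|- dplus (dx R K) (node_fn K f t) (k%:Z - 1) - fx t (k%:R * dx R K)| <= e).
Proof.
move=> cf cfx dense e e0.
have [d d0 H] := first_order T0 ltr01 cf cfx dense e0.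
exists d => // K t k K0 hd tT kK; have h0 := dx_gt0 R K0.
have [P0 PK] := dplus_even_ends (dx R K) (node_fn_even_ends f t K0).
have right : (k < K)%N ->
    `|dplus (dx R K) (node_fn K f t) k%:Z - fx t (k%:R * dx R K)| <= e.
  move=> kK'; rewrite /dplus int_add1 !node_fnE//.
  have n0 := node_mem R K0 kK; have n1 := node_mem R K0 kK'.
  have := H t _ _ tT n0 n1; set h := dx R K in hd h0 *.
  have -> : k.+1%:R * h - k%:R * h = h by rewrite -natr1; ring.
  rewrite distrC (_ : _ - _ * h = h); last by rewrite -natr1; ring.
  rewrite (gtr0_norm h0) => /(_ hd) le.
  rewrite (_ : _ - fx t _ = (f t (k.+1%:R * h) - f t (k%:R * h) - h * fx t (k%:R * h)) / h);
    last by field; rewrite gt_eqF.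
  by rewrite normrM normfV (gtr0_norm h0) ler_pdivrMr.
have left : (0 < k)%N ->
    `|dplus (dx R K) (node_fn K f t) (k%:Z - 1) - fx t (k%:R * dx R K)| <= e.
  case: k kK {right} => // n kK _; rewrite intS_sub1 /dplus int_add1 !node_fnE// 1?ltnW//.
  have n0 := node_mem R K0 (ltnW kK); have n1 := node_mem R K0 kK.
  have := H t _ _ tT n1 n0; set h := dx R K in hd h0 *.
  rewrite (_ : n.+1%:R * h - n%:R * h = h); last by rewrite -natr1; ring.
  rewrite (_ : n%:R * h - n.+1%:R * h = - h); last by rewrite -natr1; ring.
  rewrite normrN (gtr0_norm h0) => /(_ hd) le.
  rewrite (_ : _ - fx t _ = - (f t (n%:R * h) - f t (n.+1%:R * h) - - h * fx t (n.+1%:R * h)) / h);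
    last by field; rewrite gt_eqF.
  by rewrite normrM normfV normrN (gtr0_norm h0) ler_pdivrMr.
split.
  have [kK'|Kk] := ltnP k K; first by left; exact: right.
  have kE : k = K by apply/eqP; rewrite eqn_leq kK.
  by right; rewrite kE PK opprK; have := left; rewrite kE; apply.
have [k0|k0] := posnP k; last by left; exact: left.
by right; rewrite k0 sub0r P0 opprK; have := right; rewrite k0; apply.
Qed.

Lemma quotient_time f ft : ucont T 1 f -> ucont T 1 ft ->
  dense_times 1 (fun x => forall t : R, t \in `]0, T[ -> is_derive t 1 (f^~ x) (ft t x)) ->
  forall e, 0 < e -> exists2 d, 0 < d & forall t s x, t \in `[0, T] -> s \in `[0, T] ->
    x \in `[0, 1] -> s < t -> t - s < d -> `|(f t x - f s x) / (t - s) - ft t x| <= e.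
Proof.
move=> /ucont_swap cf /ucont_swap cft dense e e0.
have [d d0 H] := first_order ltr01 T0 cf cft dense e0.
exists d => // t s x tT sT x1 st td.
have ts0 : 0 < t - s by rewrite subr_gt0.
have := H x t s x1 tT sT; rewrite [`|s - t|]distrC (gtr0_norm ts0) => /(_ td) le.
rewrite (_ : _ - ft t x = - (f s x - f t x - (s - t) * ft t x) / (t - s)); last first.
  by field; rewrite gt_eqF.
by rewrite normrM normfV normrN (gtr0_norm ts0) ler_pdivrMr.
Qed.

End consistency_tools.

Section consistency.
Variables (R : realType) (T eps delta0 c kappa0 kappa nu : R).
Variables (alpha0 : R -> R -> R) (g w : nat -> nat -> R -> R -> R).
Hypotheses (T0 : 0 < T) (eps0 : 0 < eps) (delta0_gt0 : 0 < delta0).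
Hypotheses (kappa0_gt0 : 0 < kappa0) (kappa_gt0 : 0 < kappa) (nu0 : 0 < nu).
Hypotheses (calpha0 : cont2 T 1 alpha0) (dg : derivs T g) (dw : derivs T w).
Hypothesis FR_eta : flux_relation T (source_eta eps c kappa g w) (flux_eta kappa0 g).
Hypothesis FR_theta :
  flux_relation T (source_theta alpha0 w) (flux_theta eps delta0 kappa nu g w).

Lemma dense_times_open a (P : R -> Prop) : 0 < a ->
  (forall t, t \in `]0, a[ -> P t) -> dense_times a P.
Proof.
move=> a0 HP.
have ae : {ae (@lebesgue_measure R), forall t, t \in `]0, a[ -> P t} by exact: aeW.
by apply: dense_timesW (ae_dense_times a0 ae) => s [].
Qed.

Lemma derivs_dense_x (f : nat -> nat -> R -> R -> R) : derivs T f ->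
  dense_times T (fun s => forall x : R, x \in `]0, 1[ ->
    is_derive x 1 (f 0%N 0%N s) (f 0%N 1%N s x) /\
    is_derive x 1 (f 0%N 1%N s) (f 0%N 2%N s x)).
Proof.
move=> [dx _ _]; apply: dense_times_open => // t tT x x1.
by split; [apply: (dx 0%N)|apply: (dx 1%N)].
Qed.

Lemma derivs_dense_x1 (f : nat -> nat -> R -> R -> R) : derivs T f ->
  dense_times T (fun s => forall x : R, x \in `]0, 1[ ->
    is_derive x 1 (f 0%N 0%N s) (f 0%N 1%N s x)).
Proof.
by move=> /derivs_dense_x; apply: dense_timesW => s H x /H[].
Qed.

Lemma derivs_dense_t (f : nat -> nat -> R -> R -> R) : derivs T f ->
  dense_times 1 (fun x => forall t : R, t \in `]0, T[ ->
    is_derive t 1 (fun s => f 0%N 0%N s x) (f 1%N 0%N t x)).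
Proof.
by move=> [_ dt _]; apply: dense_times_open => // x x1 t tT; apply: (dt 0%N).
Qed.

Lemma derivs_ucont f : derivs T f ->
  [/\ ucont T 1 (f 0%N 0%N), ucont T 1 (f 0%N 1%N), ucont T 1 (f 0%N 2%N) &
      ucont T 1 (f 1%N 0%N)].
Proof. by move=> [_ _ cf]; split; apply: cont2_ucont; exact: cf. Qed.

Lemma time_step (N j : nat) : (0 < N)%N -> j.+1%:R * dt T N - j%:R * dt T N = dt T N.
Proof. by move=> N0; rewrite -natr1; ring. Qed.

Lemma time_consistency f : derivs T f -> forall e, 0 < e -> exists2 d, 0 < d &
  forall K N j k, (0 < K)%N -> (0 < N)%N -> (j < N)%N -> (k <= K)%N -> dt T N < d ->
    `|(f 0%N 0%N (j.+1%:R * dt T N) (k%:R * dx R K)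
       - f 0%N 0%N (j%:R * dt T N) (k%:R * dx R K)) / dt T N
      - f 1%N 0%N (j.+1%:R * dt T N) (k%:R * dx R K)| <= e.
Proof.
move=> df e e0.
have [u0 _ _ ut] := derivs_ucont df.
have [d d0 H] := quotient_time T0 u0 ut (derivs_dense_t df) e0.
exists d => // K N j k K0 N0 jN kK td; have t0 := dt_gt0 T0 N0.
have tn := time_mem T0 N0 jN; have to := time_mem T0 N0 (ltnW jN).
have := H _ _ _ tn to (node_mem R K0 kK).
rewrite time_step//; apply => //.
by rewrite -subr_gt0 time_step.
Qed.

Lemma gamma_consistency (e : R) : 0 < e -> exists2 d, 0 < d &
  forall K N j k, (0 < K)%N -> (0 < N)%N -> (j < N)%N -> (k <= K)%N ->
    dx R K < d -> dt T N < d ->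
    `|gamma_avg eps (dx R K) (node_fn K (w 0%N 0%N) (j%:R * dt T N)) k%:Z
      - gamma eps (w 0%N 1%N (j.+1%:R * dt T N) (k%:R * dx R K))| <= e.
Proof.
move=> e0; have e20 : 0 < e / 2 by rewrite divr_gt0.
have [u0 u1 _ _] := derivs_ucont dw.
have [d1 d10 H1] := quotient_node T0 u0 u1 (derivs_dense_x1 dw) e20.
have [d2 d20 H2] := u1 _ e20.
exists (Num.min d1 d2); first by rewrite lt_min d10.
move=> K N j k K0 N0 jN kK; rewrite !lt_min => /andP[x1 _] /andP[_ t2].
have tn := time_mem T0 N0 jN; have to := time_mem T0 N0 (ltnW jN).
have xk := node_mem R K0 kK.
have [r l] := H1 K _ k K0 x1 to kK.
have tt : `|w 0%N 1%N (j%:R * dt T N) (k%:R * dx R K)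
    - w 0%N 1%N (j.+1%:R * dt T N) (k%:R * dx R K)| <= e / 2.
  apply/ltW/H2 => //; last by rewrite subrr normr0.
  by rewrite distrC time_step// gtr0_norm// dt_gt0.
have sgn (D v : R) : `|D - v| <= e / 2 \/ `|- D - v| <= e / 2 ->
    `|gamma eps D - gamma eps v| <= e / 2.
  move=> [|] h; apply: le_trans h; last rewrite -gammaN; exact: gamma_lipschitz.
have := gamma_lipschitz eps0 (w 0%N 1%N (j%:R * dt T N) (k%:R * dx R K))
  (w 0%N 1%N (j.+1%:R * dt T N) (k%:R * dx R K)).
move=> /le_trans/(_ tt); have := sgn _ _ r; have := sgn _ _ l.
rewrite /gamma_avg !ler_norml => /andP[? ?] /andP[? ?] /andP[? ?].
by apply/andP; split; lra.
Qed.

(** The residual is the sum of the errors of the time quotient, of the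
    flux difference and of the lagged [gamma]; each is at most [rho / 4] or
    [rho / 2]. *)
Lemma consistency_eta (rho : R) : 0 < rho -> exists2 d, 0 < d &
  forall K N j k, (0 < K)%N -> (0 < N)%N -> (j < N)%N -> (k <= K)%N ->
    dx R K < d -> dt T N < d ->
    `|residual_eta eps c kappa0 kappa (dx R K) (dt T N)
       (grid_val T K N (g 0%N 0%N) j) (grid_val T K N (g 0%N 0%N) j.+1)
       (grid_val T K N (w 0%N 0%N) j) k%:Z| <= rho.
Proof.
move=> rho0.
have [_ _ cg] := dg.
have [M M0 HM] := cont2_bounded (cg 0%N 0%N isT isT isT).
have k2 : 0 < kappa0 ^+ 2 by rewrite exprn_gt0.
have [d1 d10 H1] := @time_consistency g dg (rho / 4) (divr_gt0 rho0 (ltr0n _ 4)).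
have [d2 d20 H2] := flux_consistency FR_eta (divr_gt0 rho0 (ltr0n _ 4)).
have eq0 : 0 < rho / 8 / kappa0 ^+ 2 by rewrite !divr_gt0.
have [u0 u1 u2 _] := derivs_ucont dg.
have [d3 d30 H3] := quotient_mid T0 u0 u1 u2 (derivs_dense_x dg) eq0.
have eg0 : 0 < rho / 4 / (kappa * M) by rewrite !divr_gt0// mulr_gt0.
have [d4 d40 H4] := gamma_consistency eg0.
exists (Num.min (Num.min d1 d2) (Num.min d3 d4)); first by rewrite !lt_min d10 d20 d30.
move=> K N j k K0 N0 jN kK; rewrite !lt_min.
move=> /andP[/andP[_ x2] /andP[x3 x4]] /andP[/andP[t1 _] /andP[_ t4]].
have h0 := dx_gt0 R K0.
have tn := time_mem T0 N0 jN; have to := time_mem T0 N0 (ltnW jN).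
have xk := node_mem R K0 kK.
set t := j.+1%:R * dt T N in tn *.
pose Phi (i : int) := kappa0 ^+ 2 * dplus (dx R K) (node_fn K (g 0%N 0%N) t) i.
have [P0 PK] := dplus_even_ends (dx R K) (node_fn_even_ends (g 0%N 0%N) t K0).
have F : `|(Phi k%:Z - Phi (k%:Z - 1)) / dx R K - source_eta eps c kappa g w t (k%:R * dx R K)|
    <= rho / 4 + 2 * (rho / 8).
  apply: H2 => //; [by rewrite /Phi P0 mulrN|by rewrite /Phi PK mulrN|].
  move=> i iK; rewrite /Phi /flux_eta -mulrBr normrM (gtr0_norm k2).
  have -> : rho / 8 * dx R K = kappa0 ^+ 2 * (rho / 8 / kappa0 ^+ 2 * dx R K).
    by field; rewrite gt_eqF.
  by rewrite ler_wpM2l ?(ltW k2)//; exact: H3.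
have TC := H1 _ _ _ _ K0 N0 jN kK t1.
have GC := H4 _ _ _ _ K0 N0 jN kK x4 t4.
rewrite -/t in TC GC.
rewrite /residual_eta /grid_val -!/(node_fn _ _ _ _) -/t.
rewrite -[X in gamma_avg _ _ X]/(node_fn K (w 0%N 0%N) (j%:R * dt T N)).
rewrite !(node_fnE _ _ K0 kK).
have etaM := HM _ _ tn xk.
move: F; rewrite /Phi /source_eta -mulrBr -[_ * _ / dx R K]mulrA.
rewrite -/(node_fn K (g 0%N 0%N) t).
set b := _ / dx R K; set y := g 0%N 0%N t _ in etaM *.
set a1 := _ / dt T N in TC *; set yt := g 1%N 0%N t _ in TC *.
set G := gamma_avg _ _ _ _ in GC *; set ga := gamma eps _ in GC * => F.
have GY : `|kappa * y * (G - ga)| <= rho / 4.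
  rewrite !normrM (gtr0_norm kappa_gt0).
  have -> : rho / 4 = kappa * M * (rho / 4 / (kappa * M)).
    by field; rewrite !gt_eqF.
  by rewrite ler_pM ?mulr_ge0 ?(ltW kappa_gt0)// ler_wpM2l ?(ltW kappa_gt0).
move: F GY TC; rewrite !ler_norml => /andP[? ?] /andP[? ?] /andP[? ?].
by apply/andP; split; lra.
Qed.

Lemma derivs_alpha_dense :
  dense_times T (fun s => forall x : R, x \in `]0, 1[ ->
    is_derive x 1 (fun x => alpha delta0 (g 0%N 0%N s x))
      (g 0%N 0%N s x * g 0%N 1%N s x)).
Proof.
apply: dense_timesW (derivs_dense_x1 dg) => s ds x /ds d.
have d2 := is_deriveD (is_deriveM (is_deriveM d d) (is_derive_cst (2^-1 : R) x 1))
  (is_derive_cst delta0 x 1).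
suff -> : g 0%N 0%N s x * g 0%N 1%N s x =
  (g 0%N 0%N s * g 0%N 0%N s) x *: 0 + 2^-1 *:
   (g 0%N 0%N s x *: g 0%N 1%N s x + g 0%N 0%N s x *: g 0%N 1%N s x) + 0.
  exact: d2.
by rewrite /GRing.scale /=; field.
Qed.

(** The numerical flux is compared with the exact one at the midpoint of the
    edge: the averaged alpha and the quotient are both accurate to o(dx) there. *)
Lemma consistency_theta (rho : R) : 0 < rho -> exists2 d, 0 < d &
  forall K N j k, (0 < K)%N -> (0 < N)%N -> (j < N)%N -> (k <= K)%N ->
    dx R K < d -> dt T N < d ->
    `|residual_theta eps delta0 kappa nu (dx R K) (dt T N)
       (fun k => alpha0 (j.+1%:R * dt T N) (k%:~R * dx R K))
       (grid_val T K N (g 0%N 0%N) j.+1) (grid_val T K N (w 0%N 0%N) j)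
       (grid_val T K N (w 0%N 0%N) j.+1) k%:Z| <= rho.
Proof.
move=> rho0.
have [_ _ cg] := dg; have [_ _ cw] := dw.
have cal : cont2 T 1 (fun t x => alpha delta0 (g 0%N 0%N t x)).
  apply: cont2_comp; first exact: alpha_continuous.
  exact: cg.
have [M M0 HM] := cont2_bounded cal.
have [Ma Ma0 HMa] := cont2_bounded calpha0.
have eT0 : 0 < rho / 4 / Ma by rewrite !divr_gt0.
have [d1 d10 H1] := time_consistency dw eT0.
have [d2 d20 H2] := flux_consistency FR_theta (divr_gt0 rho0 (ltr0n _ 4)).
pose L := kappa * M * (2 / eps) + nu ^+ 2.
have L0 : 0 < L by rewrite addr_gt0 ?exprn_gt0// mulr_gt0 ?divr_gt0// mulr_gt0.
have eq0 : 0 < rho / 16 / L by rewrite !divr_gt0.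
have [u0 u1 u2 _] := derivs_ucont dw.
have [d3 d30 H3] := quotient_mid T0 u0 u1 u2 (derivs_dense_x dw) eq0.
have eA0 : 0 < rho / 16 / kappa by rewrite !divr_gt0.
have cgg : cont2 T 1 (fun t x => g 0%N 0%N t x * g 0%N 1%N t x).
  by apply: cont2M; exact: cg.
have [d4 d40 H4] := average_mid T0 (cont2_ucont cal) (cont2_ucont cgg)
  derivs_alpha_dense eA0.
exists (Num.min (Num.min d1 d2) (Num.min d3 d4)); first by rewrite !lt_min d10 d20 d30.
move=> K N j k K0 N0 jN kK; rewrite !lt_min.
move=> /andP[/andP[_ x2] /andP[x3 x4]] /andP[/andP[t1 _] _].
have h0 := dx_gt0 R K0.
have tn := time_mem T0 N0 jN; have to := time_mem T0 N0 (ltnW jN).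
have xk := node_mem R K0 kK.
set t := j.+1%:R * dt T N in tn *.
pose Phi := theta_flux eps delta0 kappa nu (dx R K) (node_fn K (g 0%N 0%N) t)
  (node_fn K (w 0%N 0%N) t).
have [P0 PK] := theta_flux_even_ends eps delta0 kappa nu (dx R K)
  (node_fn_even_ends (g 0%N 0%N) t K0) (node_fn_even_ends (w 0%N 0%N) t K0).
have F : `|(Phi k%:Z - Phi (k%:Z - 1)) / dx R K - source_theta alpha0 w t (k%:R * dx R K)|
    <= rho / 4 + 2 * (rho / 8).
  apply: H2 => // i iK; rewrite /Phi /theta_flux /flux_theta.
  have [_ _ m01 _] := mid_itv R K0 iK.
  set m := i%:R * dx R K + dx R K / 2 in m01 *.
  have D := H3 K t i K0 x3 tn iK; rewrite -/m in D.
  have A := H4 K t i K0 x4 tn iK; rewrite -/m in A.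
  have Mm := HM t m tn m01.
  rewrite int_add1 !(node_fnE (g 0%N 0%N))// 1?ltnW//.
  set Ak := (alpha delta0 _ + _) / 2 in A *.
  set al := alpha delta0 (g 0%N 0%N t m) in A Mm *.
  set Dk := dplus _ _ _ in D *; set v := w 0%N 1%N t m in D *.
  rewrite (_ : _ - _ = kappa * (Ak - al) * dgamma eps Dk
     + (kappa * al * (dgamma eps Dk - dgamma eps v) + nu ^+ 2 * (Dk - v))); last by ring.
  rewrite (le_trans (ler_normD _ _))// (_ : rho / 8 * dx R K =
     rho / 16 * dx R K + rho / 16 * dx R K); last by field.
  apply: lerD.
    rewrite 2!normrM (gtr0_norm kappa_gt0).
    have -> : rho / 16 * dx R K = kappa * (rho / 16 / kappa * dx R K) * 1.
      by field; rewrite gt_eqF.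
    rewrite ler_pM ?mulr_ge0 ?(ltW kappa_gt0) ?norm_dgamma_le1//.
    by rewrite ler_wpM2l ?(ltW kappa_gt0).
  have -> : rho / 16 * dx R K = L * (rho / 16 / L * dx R K).
    by field; rewrite gt_eqF.
  apply: le_trans (ler_wpM2l (ltW L0) D).
  rewrite (le_trans (ler_normD _ _))// /L mulrDl; apply: lerD; last first.
    by rewrite normrM ger0_norm ?sqr_ge0.
  rewrite 2!normrM (gtr0_norm kappa_gt0) -mulrA -[leRHS]mulrA.
  rewrite -[leRHS]mulrA ler_wpM2l ?(ltW kappa_gt0)// ler_pM//.
  exact: dgamma_lipschitz.
have TC := H1 _ _ _ _ K0 N0 jN kK t1; rewrite -/t in TC.
have aM := HMa _ _ tn xk.
rewrite /residual_theta /grid_val; cbv beta.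
rewrite -/(node_fn K (g 0%N 0%N) t) -/(node_fn K (w 0%N 0%N) t).
rewrite -[X in theta_flux _ _ _ _ _ X _ _]/(node_fn K (g 0%N 0%N) t).
rewrite -/(node_fn K (w 0%N 0%N) (j%:R * dt T N)) -/Phi.
rewrite [even_ext _ t _](node_fnE (w 0%N 0%N) t K0 kK).
rewrite [even_ext _ _ _](node_fnE (w 0%N 0%N) (j%:R * dt T N) K0 kK).
move: F; rewrite /source_theta => F.
set b := _ / dx R K in F *.
set a1 := _ / dt T N in TC *; set wt := w 1%N 0%N t _ in TC F *.
set al := alpha0 t _ in aM F *.
have AT : `|al * (a1 - wt)| <= rho / 4.
  rewrite normrM (_ : rho / 4 = Ma * (rho / 4 / Ma)); last by field; rewrite gt_eqF.
  by rewrite ler_pM.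
move: F AT; rewrite !ler_norml => /andP[? ?] /andP[? ?].
by apply/andP; split; lra.
Qed.

End consistency.

(** * Convergence *)

Section convergence.
Variables (R : realType) (T eps delta0 c kappa0 kappa nu Lalpha0 C1 : R).
Variables (alpha0 : R -> R -> R) (g w : nat -> nat -> R -> R -> R).
Hypotheses (T0 : 0 < T) (eps0 : 0 < eps) (delta0_gt0 : 0 < delta0) (delta0_lt1 : delta0 < 1).
Hypotheses (c0 : 0 < c).
Hypotheses (kappa0_gt0 : 0 < kappa0) (kappa_gt0 : 0 < kappa) (nu0 : 0 < nu).
Hypotheses (L0 : 0 <= Lalpha0) (calpha0 : cont2 T 1 alpha0).
Hypothesis alpha0_ge_delta0 : forall t x, t \in `[0, T] -> x \in `[0, 1] ->
  delta0 <= alpha0 t x.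
Hypothesis alpha0_lip : forall t s x, t \in `[0, T] -> s \in `[0, T] ->
  x \in `[0, 1] -> `|alpha0 t x - alpha0 s x| <= Lalpha0 * `|t - s|.
Hypotheses (dg : derivs T g) (dw : derivs T w).
Hypothesis FR_eta : flux_relation T (source_eta eps c kappa g w) (flux_eta kappa0 g).
Hypothesis FR_theta :
  flux_relation T (source_theta alpha0 w) (flux_theta eps delta0 kappa nu g w).
Let eta := g 0%N 0%N.
Let theta := w 0%N 0%N.
Let b := growth_rate delta0 kappa nu C1 Lalpha0.

Section mesh.
Variables (rho : R) (K N : nat) (H Th : nat -> 'rV[R]_K.+3).
Hypotheses (K0 : (0 < K)%N) (N0 : (0 < N)%N).
Hypothesis sch : scheme_solution T eps delta0 c kappa0 kappa nu alpha0 N H Th.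
Hypothesis init : forall k : int, -1 <= k <= K.+1%:Z ->
  entry (H 0%N) k = grid_val T K N eta 0 k /\
  entry (Th 0%N) k = grid_val T K N theta 0 k.
Hypothesis bound : forall j k : nat, (j <= N)%N -> (k <= K)%N ->
  Num.max `|entry (H j) k%:Z| `|eta (j%:R * dt T N) (k%:R * dx R K)| <= C1.
Hypothesis small : dt T N * b <= 1 / 2.
Hypothesis res_eta : forall j k, (j < N)%N -> (k <= K)%N ->
  `|residual_eta eps c kappa0 kappa (dx R K) (dt T N) (grid_val T K N eta j)
     (grid_val T K N eta j.+1) (grid_val T K N theta j) k%:Z| <= rho.
Hypothesis res_theta : forall j k, (j < N)%N -> (k <= K)%N ->
  `|residual_theta eps delta0 kappa nu (dx R K) (dt T N)
     (fun k => alpha0 (j.+1%:R * dt T N) (k%:~R * dx R K))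
     (grid_val T K N eta j.+1) (grid_val T K N theta j)
     (grid_val T K N theta j.+1) k%:Z| <= rho.

Let weight j (k : int) : R := alpha0 (j%:R * dt T N) (k%:~R * dx R K).
Let E j := error_energy nu (dx R K) (dt T N) K (weight j)
  (grid_err T N H eta j) (grid_err T N Th theta j).

Let h0 : 0 < dx R K. Proof. exact: dx_gt0. Qed.
Let tau0 : 0 < dt T N. Proof. exact: dt_gt0. Qed.

Lemma weight_ge j k : (j <= N)%N -> (k <= K)%N -> delta0 <= weight j k%:Z.
Proof.
by move=> jN kK; apply: alpha0_ge_delta0; [exact: time_mem|exact: node_mem].
Qed.

Lemma growth_rate_ge0 : 0 <= b.
Proof.
rewrite /b /growth_rate addr_ge0 ?addr_ge0//.
  by rewrite mulr_ge0// divr_ge0 ?sqr_ge0.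
by rewrite divr_ge0 ?addr_ge0// ltW.
Qed.

Lemma error_energy0 : E 0%N = 0.
Proof.
have e0 (k : nat) : (k <= K)%N -> grid_err T N H eta 0 k%:Z = 0 /\
    grid_err T N Th theta 0 k%:Z = 0.
  move=> kK; have [|h1 h2] := init (k := k%:Z); last by rewrite /grid_err h1 h2 !subrr.
  by rewrite lez_nat (leq_trans kK)// andbT (le_trans _ (lez0_nat k)).
rewrite /E /error_energy.
have -> : sqnorm (dx R K) K (grid_err T N H eta 0) = 0.
  rewrite -[RHS](trapsum0 R K); apply: eq_trapsum => k kK.
  by rewrite (e0 k kK).1 expr0n mul0r.
have -> : wsqnorm (dx R K) K (weight 0) (grid_err T N Th theta 0) = 0.
  rewrite -[RHS](trapsum0 R K); apply: eq_trapsum => k kK.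
  by rewrite (e0 k kK).2 expr0n mulr0 mul0r.
have -> : gradsq (dx R K) K (grid_err T N Th theta 0) = 0.
  rewrite /gradsq big_nat big1// => k /andP[_ kK].
  by rewrite /dplus int_add1 (e0 _ kK).2 (e0 _ (ltnW kK)).2 subrr mul0r expr0n mul0r.
by rewrite mul0r !mulr0 !addr0.
Qed.

Lemma error_energy_rec j : (j < N)%N ->
  E j.+1 <= E j + dt T N * b * (E j + E j.+1) + dt T N * rho ^+ 2.
Proof.
move=> jN.
have [eHo eTo] := scheme_even_ends K0 sch (ltnW jN).
have [eHn eTn] := scheme_even_ends K0 sch jN.
have [eqs _] := sch.
have eqH k' (k'K : (k' <= K)%N) := (eqs j k' jN k'K).1.
have eqT k' (k'K : (k' <= K)%N) := (eqs j k' jN k'K).2.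
apply: (error_energy_step (a := weight j.+1) eps0 delta0_gt0 c0 kappa_gt0 nu0
  h0 tau0 K0 (mesh_length R K0) eHn eTo eTn _ _ _ _ eqH eqT) => //.
- exact: node_fn_even_ends.
- exact: node_fn_even_ends.
- exact: node_fn_even_ends.
- by move=> k kK; exact: weight_ge.
- by move=> k kK; have := bound jN kK; rewrite ge_max => /andP[].
- move=> k kK; have := bound jN kK; rewrite ge_max => /andP[_].
  by rewrite -(node_fnE eta (j.+1%:R * dt T N) K0 kK).
- by move=> k kK; exact: res_eta.
- by move=> k kK; exact: res_theta.
- by move=> k kK; apply: weight_ge => //; exact: ltnW.
move=> k kK; rewrite /weight -lerBlDl (le_trans (ler_norm _))//.
have tn := time_mem T0 N0 jN; have to := time_mem T0 N0 (ltnW jN).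
apply: le_trans (alpha0_lip tn to (node_mem R K0 kK)) _.
by rewrite time_step// gtr0_norm.
Qed.

Lemma error_energy_bound j : (j <= N)%N ->
  E j <= 2 * T * rho ^+ 2 * expR (4 * b * T).
Proof.
move=> jN; have b0 := growth_rate_ge0.
have jT : j%:R * dt T N <= T.
  by have := time_mem T0 N0 jN; rewrite in_itv/= => /andP[].
apply: le_trans (@discrete_gronwall R E N (dt T N * b) (dt T N * rho ^+ 2)
  _ small _ error_energy0 _ error_energy_rec j jN) _.
- by rewrite mulr_ge0// ltW.
- by rewrite mulr_ge0 ?sqr_ge0// ltW.
- move=> i iN; apply: (error_energy_ge0 nu delta0_gt0 h0 tau0) => k kK.
  exact: weight_ge.
apply: ler_pM.
- by rewrite mulr_ge0// mulr_ge0// mulr_ge0 ?sqr_ge0// ltW.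
- exact: expR_ge0.
- rewrite (_ : _ * j%:R = 2 * (j%:R * dt T N) * rho ^+ 2); last by ring.
  by rewrite ler_wpM2r ?sqr_ge0// ler_wpM2l.
rewrite ler_expR (_ : _ * j%:R = 4 * b * (j%:R * dt T N)); last by ring.
by rewrite ler_wpM2l// mulr_ge0.
Qed.

(** The energy controls the squares of both discrete norms, for theta up to
    the factor delta0. *)
Lemma sup_err_bound :
  let X := 4 * T * expR (4 * b * T) / delta0 in
  forall y, 0 <= y -> rho ^+ 2 * X <= y ^+ 2 ->
  sup_err T N H eta + sup_err T N Th theta <= 2 * y.
Proof.
move=> X y y0 Xy.
have bnd j : (j <= N)%N ->
    sqnorm (dx R K) K (grid_err T N H eta j) <= y ^+ 2 /\
    sqnorm (dx R K) K (grid_err T N Th theta j) <= y ^+ 2.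
  move=> jN; have := error_energy_bound jN.
  have wg k : (k <= K)%N -> delta0 <= weight j k%:Z by exact: weight_ge.
  have Xn := sqnorm_ge0 K h0 (grid_err T N H eta j).
  have Yn := wsqnorm_ge h0 (grid_err T N Th theta j) wg.
  have Y0 := sqnorm_ge0 K h0 (grid_err T N Th theta j).
  have Zn := gradsq_ge0 K h0 (grid_err T N Th theta j).
  have tZ : 0 <= dt T N * (nu ^+ 2 / 2 * gradsq (dx R K) K (grid_err T N Th theta j)).
    by rewrite mulr_ge0 ?(ltW tau0)// mulr_ge0// divr_ge0 ?sqr_ge0.
  have dY := mulr_ge0 (ltW delta0_gt0) Y0.
  move: Xy; rewrite /X mulrA ler_pdivrMr// /E /error_energy.
  set ex := expR _; move=> Xy Eb.
  have dy : y ^+ 2 * delta0 <= y ^+ 2 by rewrite ler_piMr ?sqr_ge0// ltW.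
  split; first by lra.
  by rewrite -(ler_pM2l delta0_gt0); lra.
have norm_le (f : int -> R) : sqnorm (dx R K) K f <= y ^+ 2 -> L2d_norm K f <= y.
  move=> fy; rewrite /L2d_norm -[leRHS](ger0_norm y0) -sqrtr_sqr ler_sqrt ?sqr_ge0//.
  apply: le_trans fy; rewrite le_eqVlt; apply/orP; left; apply/eqP.
  by apply: eq_trapsum => k _; rewrite real_normK ?num_real.
rewrite mulrDl !mul1r; apply: lerD; apply: bigmax_le => // i _; apply: norm_le.
  by have [] := bnd i (ltn_ord i).
by have [] := bnd i (ltn_ord i).
Qed.

End mesh.

(** The residual bound is chosen first, from the tolerance and the Gronwall
    factor; then the mesh is taken so fine that this bound holds and that the
    growth over one step is at most 1/2. *)
Lemma scheme_convergence (tol : R) : 0 < tol -> exists2 rho : R, 0 < rho &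
  forall (K N : nat) (H Th : nat -> 'rV[R]_K.+3), (0 < K)%N -> (0 < N)%N ->
    scheme_solution T eps delta0 c kappa0 kappa nu alpha0 N H Th ->
    (forall k : int, -1 <= k <= K.+1%:Z ->
       entry (H 0%N) k = grid_val T K N eta 0 k /\
       entry (Th 0%N) k = grid_val T K N theta 0 k) ->
    (forall j k : nat, (j <= N)%N -> (k <= K)%N ->
       Num.max `|entry (H j) k%:Z| `|eta (j%:R * dt T N) (k%:R * dx R K)| <= C1) ->
    dx R K < rho -> dt T N < rho ->
    sup_err T N H eta + sup_err T N Th theta < tol.
Proof.
move=> tol0; pose X := 4 * T * expR (4 * b * T) / delta0.
have X0 : 0 <= X.
  by rewrite divr_ge0 ?(ltW delta0_gt0)// mulr_ge0 ?expR_ge0// mulr_ge0 ?(ltW T0).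
have y0 : 0 < tol / 3 by rewrite divr_gt0.
have X1 : 0 < 1 + X by rewrite ltr_pwDl.
have r0 : 0 < tol / 3 / (1 + X) by rewrite divr_gt0.
have [d1 d10 H1] := consistency_eta T0 eps0 kappa0_gt0 kappa_gt0 dg dw FR_eta r0.
have [d2 d20 H2] := consistency_theta T0 eps0 kappa_gt0 nu0 calpha0 dg dw FR_theta r0.
have b0 := growth_rate_ge0.
have b1 : 0 < 1 + b by rewrite ltr_pwDl.
exists (Num.min (Num.min d1 d2) (1 / 2 / (1 + b))).
  by rewrite !lt_min d10 d20 !divr_gt0.
move=> K N H Th K0 N0 sch init bound.
rewrite !lt_min => /andP[/andP[x1 x2] _] /andP[/andP[t1 t2] t3].
have t0 := dt_gt0 T0 N0.
have small : dt T N * b <= 1 / 2.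
  rewrite ltr_pdivlMr// in t3; lra.
apply: (@le_lt_trans _ _ (2 * (tol / 3))); last by lra.
apply: (sup_err_bound K0 N0 sch init bound small) (ltW y0) _.
- by move=> j k jN kK; exact: H1.
- by move=> j k jN kK; exact: H2.
rewrite -/X exprMn -[leRHS]mulr1 -mulrA ler_wpM2l ?sqr_ge0//.
rewrite mulrC exprVn ler_pdivrMr ?exprn_gt0// mul1r.
have := sqr_ge0 X; rewrite sqrrD; lra.
Qed.

End convergence.

Theorem theorem1 (R : realType)
    (T eps delta0 c kappa0 kappa nu Lalpha0 : R)
    (alpha0 : R -> R -> R) (eta0 theta0 : R -> R)
    (hT : 0 < T)
    (heps : 0 < eps < 1) (hdelta0 : 0 < delta0 < 1)
    (hc : 0 < c) (hkappa0 : 0 < kappa0) (hkappa : 0 < kappa) (hnu : 0 < nu)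
    (hL : 0 <= Lalpha0)
    (halpha0_lip : forall p q : R * R, Qdom T p -> Qdom T q ->
       `|alpha0 p.1 p.2 - alpha0 q.1 q.2|
         <= Lalpha0 * Num.sqrt ((p.1 - q.1) ^+ 2 + (p.2 - q.2) ^+ 2))
    (halpha0_cont :
       {within Qdom_bar T, continuous (fun p : R * R => alpha0 p.1 p.2)})
    (halpha0_inf : inf [set alpha0 p.1 p.2 | p in Qdom T] = delta0)
    (heta0 : in_H1 eta0) (htheta0 : in_H1 theta0)
    (heta0_01 : {ae (@lebesgue_measure R), forall x,
                   @Omega R x -> 0 <= eta0 x <= 1}) :
  (forall (K N : nat) (H Th : nat -> 'rV[R]_K.+3),
     mesh_ok T eps delta0 kappa nu K N ->
     scheme_solution T eps delta0 c kappa0 kappa nu alpha0 N H Th ->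
     (forall xi0 : R, 0 < xi0 ->
        (forall k : nat, (k <= K)%N ->
           0 <= entry (H 0%N) k%:Z <= 1 /\ `|entry (Th 0%N) k%:Z| <= xi0) ->
        forall j k : nat, (j <= N)%N -> (k <= K)%N ->
          0 <= entry (H j) k%:Z <= 1 /\ `|entry (Th j) k%:Z| <= xi0)
     /\
     (forall j : nat, (j < N)%N ->
        let F := @F1d R eps delta0 c kappa0 kappa nu K in
        let D :=
          - trapsum K (fun k =>
              `|(entry (H j.+1) k - entry (H j) k) / dt T N| ^+ 2 * dx R K)
          - trapsum K (fun k =>
              alpha0 (j.+1%:R * dt T N) (k%:~R * dx R K) *
              `|(entry (Th j.+1) k - entry (Th j) k) / dt T N| ^+ 2 * dx R K) in
        (F (H j.+1) (Th j.+1) - F (H j) (Th j)) / dt T N <= D /\ D <= 0))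
  /\
  (forall eta theta : R -> R -> R,
     is_solution T eps delta0 c kappa0 kappa nu alpha0 eta0 theta0 eta theta ->
     regular T eta -> regular T theta ->
     forall C1 : R,
     let a := Num.max (2 * (kappa * C1 / nu) ^+ 2 - (2 * kappa * eps + c))
                      ((Lalpha0 + 1) / delta0) in
     forall tol : R, 0 < tol ->
     exists2 rho : R, 0 < rho &
       forall (K N : nat) (H Th : nat -> 'rV[R]_K.+3),
         mesh_ok T eps delta0 kappa nu K N ->
         dt T N < 1 / (3 * a) ->
         scheme_solution T eps delta0 c kappa0 kappa nu alpha0 N H Th ->
         (forall k : int, -1 <= k <= K.+1%:Z ->
            entry (H 0%N) k = grid_val T K N eta 0 k /\
            entry (Th 0%N) k = grid_val T K N theta 0 k) ->
         (forall j k : nat, (j <= N)%N -> (k <= K)%N ->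
            Num.max `|entry (H j) k%:Z|
                    `|eta (j%:R * dt T N) (k%:R * dx R K)| <= C1) ->
         dx R K < rho -> dt T N < rho ->
         sup_err T N H eta + sup_err T N Th theta < tol).
Proof.
have /andP[eps0 _] := heps; have /andP[delta0_gt0 delta0_lt1] := hdelta0.
have calpha0 : cont2 T 1 alpha0 by exact: halpha0_cont.
have alpha0_ge_delta0 (t x : R) : t \in `[0, T] -> x \in `[0, 1] -> delta0 <= alpha0 t x.
  exact: (alpha0_ge hT delta0_gt0 calpha0 halpha0_inf).
split.
  move=> K N H Th [K0 N0 _] sch; split.
    move=> xi0 _ init j k jN kK.
    exact: (scheme_maximum_principle hT eps0 delta0_gt0 hc hkappa alpha0_ge_delta0
      K0 N0 sch init).
  move=> j jN.
  exact: (scheme_energy_decay hT eps0 delta0_gt0 hc hkappa alpha0_ge_delta0 K0 N0 sch).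
move=> eta theta sol [g gE dg] [w wE dw] C1 a tol tol0.
rewrite -gE -wE in sol *.
have [FR_eta FR_theta] := strong_form hT eps0 calpha0 dg dw sol.
have lip (t s x : R) : t \in `[0, T] -> s \in `[0, T] -> x \in `[0, 1] ->
    `|alpha0 t x - alpha0 s x| <= Lalpha0 * `|t - s|.
  exact: (alpha0_lip_time hT hL calpha0 halpha0_lip).
have [rho rho0 conv] := @scheme_convergence R T eps delta0 c kappa0 kappa nu Lalpha0
  C1 alpha0 g w hT eps0 delta0_gt0 delta0_lt1 hc
  hkappa0 hkappa hnu hL calpha0 alpha0_ge_delta0 lip dg dw FR_eta FR_theta tol tol0.
by exists rho => // K N H Th [K0 N0 _] _; exact: conv.
Qed.
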